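(* Let $\theta>0$, let $\mathcal{L}$ be a probability measure on $\mathbb{C}^*$, and let $(M_N)_{N\ge1}$ be a sequence of random matrices such that $M_N$ follows the distribution $\mathbb{P}(N,\theta,\mathcal{L})$. Suppose that if $Z$ follows the distribution $\mathcal{L}$, then $\log|Z|$ is integrable, and let $R:=\exp(\mathbb{E}[\log|Z|])$. Then the probability measure $\tilde\mu_N/N$ converges weakly, as $N\to\infty$, to the uniform distribution on the circle $\{|z|=R\}$. Moreover, if $\log|Z|$ is in $\mathcal{U}^2$, then for all $0<R_1<R<R_2$, the restriction of $\tilde\mu_N$ to the set $\{|z|\notin(R_1,R_2)\}$ converges weakly to the corresponding restriction of $\tilde\mu_\infty$, which is a finite measure.
   Context: $\Sigma_N$ is the group of permutations of $\{1,\dots,N\}$. For $\sigma\in\Sigma_N$ and $z_1,\dots,z_N\in\mathbb{C}^*$, $M(\sigma,z_1,\dots,z_N)$ is the $N\times N$ matrix $M$ with entries $M_{jk}=z_j\mathbf{1}_{j=\sigma(k)}$. $\mathbb{P}(N,\theta,\mathcal{L})$ is the law of $M(\sigma,z_1,\dots,z_N)$ where $\sigma$ follows the Ewens measure of parameter $\theta$ on $\Sigma_N$ (each permutation has probability proportional to $\theta^n$, $n$ its number of cycles), $z_1,\dots,z_N$ have law $\mathcal{L}$, and $\sigma,z_1,\dots,z_N$ are independent. $\mu(M)=\sum_\lambda m_M(\lambda)\delta_\lambda$ is the sum over the eigenvalues $\lambda$ of $M$ with multiplicity $m_M(\lambda)$, and $\tilde\mu_N$ is the expectation of the random measure $\mu(M_N)$.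 $\tilde\mu_\infty$ is the expectation of the random measure $$\mu_\infty=\sum_{k=1}^\infty\sum_{p=1}^{a_k}\sum_{\omega^k=T_{k,p}}\delta_\omega,$$ where all the variables $(a_k)_{k\ge1}$, $(T_{k,p})_{k,p\ge1}$ are independent, $a_k$ is a Poisson variable with $\mathbb{E}[a_k]=\theta/k$, and $T_{k,p}$ is distributed as the product of $k$ independent random variables of law $\mathcal{L}$. For $q>0$, a real integrable random variable $X$ is said to be in $\mathcal{U}^q$ if, for $(X_k)_{k\ge1}$ i.i.d. with the distribution of $X$ and for all $\epsilon>0$, there exists $C>0$ such that for all $n\ge1$, $\mathbb{P}\left[\left|\left(\frac1n\sum_{k=1}^nX_k\right)-\mathbb{E}[X]\right|\ge\epsilon\right]\le C/n^q$. *)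

(* Defs.v *)
From HB Require Import structures.
From mathcomp Require Import all_boot all_order all_algebra all_fingroup.
From mathcomp Require Import complex.
From mathcomp Require Import all_classical all_reals all_analysis.

Set Implicit Arguments.
Unset Strict Implicit.
Unset Printing Implicit Defensive.

Import Order.TTheory GRing.Theory Num.Theory.
Import numFieldNormedType.Exports.

Local Open Scope classical_set_scope.
Local Open Scope ring_scope.

(* R[i] carries its usual topology (the one given by the modulus) and the      *)
(* Borel sigma-algebra.                                                       *)
HB.instance Definition _ (R : realType) := Pointed.copy R[i] (R[i]^o).
HB.instance Definition _ (R : realType) := Topological.copy R[i] (R[i]^o).
HB.instance Definition _ (R : realType) :=
  Measurable.copy R[i] (g_sigma_algebraType (@open R[i])).

Definition mx_cylinders (R : realType) (N : nat) : set (set 'M[R[i]]_N) :=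
  \bigcup_(jk in [set: 'I_N * 'I_N])
    preimage_set_system setT (fun M : 'M[R[i]]_N => M jk.1 jk.2) measurable.

HB.instance Definition _ (R : realType) (N : nat) :=
  Measurable.copy 'M[R[i]]_N (g_sigma_algebraType (@mx_cylinders R N)).

(* The modulus as an element of R: the norm of R[i] is valued in R[i].         *)
Notation normc := Normc.normc.

Section Laws.
Context {d} {Omega : measurableType d} {R : realType} (P : probability Omega R).

Definition has_law {d'} {T : measurableType d'} (X : Omega -> T)
    (nu : set T -> \bar R) : Prop :=
  forall A, measurable A -> P (X @^-1` A) = nu A.

(* Mutual independence of the sigma-algebras F i, for i ranging over D.        *)
Definition independent_systems {I : choiceType} (D : set I)
    (F : I -> set (set Omega)) : Prop :=
  forall (s : seq I) (E : I -> set Omega),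
    uniq s -> (forall i, i \in s -> D i /\ F i (E i)) ->
    P (\bigcap_(i in [set i | i \in s]) E i) = (\prod_(i <- s) P (E i))%E.

Definition independent_rvs {I : choiceType} {d'} {T : measurableType d'}
    (X : I -> Omega -> T) : Prop :=
  independent_systems setT (fun i => g_sigma_algebra_preimage (X i)).

End Laws.

(* The set function m coincides with a finite measure on the sigma-algebra;    *)
(* nothing is asked on non-measurable sets.                                   *)
Definition is_finite_measure {d} {T : measurableType d} {R : realType}
    (m : set T -> \bar R) : Prop :=
  exists nu : {finite_measure set T -> \bar R},
    forall A, measurable A -> m A = nu A.

Definition is_probability {d} {T : measurableType d} {R : realType}
    (m : set T -> \bar R) : Prop :=
  exists nu : probability T R, forall A, measurable A -> m A = nu A.

Section ComplexMeasures.
Context {R : realType}.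
Implicit Types (m : set R[i] -> \bar R).

Definition weakly_converges (m_ : nat -> set R[i] -> \bar R) m : Prop :=
  [/\ forall n, is_finite_measure (m_ n), is_finite_measure m &
      forall f : R[i] -> R, continuous f ->
        (exists B : R, forall z, `|f z| <= B) ->
        (fun n => \int[m_ n]_z (f z)%:E)%E @ \oo --> (\int[m]_z (f z)%:E)%E].

Definition restriction m (E : set R[i]) : set R[i] -> \bar R :=
  fun A => m (A `&` E).

Lemma two_pi_gt0 : 0 < 2 * pi :> R.
Proof. by rewrite mulr_gt0 ?pi_gt0. Qed.

Definition uniform_circle (r : R) : set R[i] -> \bar R :=
  pushforward (uniform_prob two_pi_gt0)
    (fun t : R => Complex (r * cos t) (r * sin t)).

(* Sum of the Dirac masses at the eigenvalues of M, counted with their         *)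
(* multiplicity as roots of the characteristic polynomial.                    *)
Definition spectral_measure (N : nat) (M : 'M[R[i]]_N) : set R[i] -> \bar R :=
  fun A => (\sum_(l \in [set l | eigenvalue M l])
              ((mup l (char_poly M))%:R : R)%:E * \d_l A)%E.

Definition mean_measure {d} {Omega : measurableType d}
    (P : probability Omega R) (X : Omega -> set R[i] -> \bar R) :
    set R[i] -> \bar R :=
  fun A => (\int[P]_w X w A)%E.

End ComplexMeasures.

Section Ensemble.
Context {R : realType}.

Definition monomial_mx (N : nat) (s : 'S_N) (z : 'I_N -> R[i]) : 'M[R[i]]_N :=
  \matrix_(j, k) (if j == s k then z j else 0).

Definition ewens (N : nat) (theta : R) (s : 'S_N) : R :=
  theta ^+ #|porbits s| / \sum_(t : 'S_N) theta ^+ #|porbits t|.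

(* Index None stands for the permutation, Some j for the variable z_j; the     *)
(* finite group 'S_N carries the discrete sigma-algebra.                      *)
Definition ensemble_system {d} {Omega : measurableType d} (N : nat)
    (s : Omega -> 'S_N) (z : 'I_N -> Omega -> R[i]) (i : option 'I_N) :
    set (set Omega) :=
  if i is Some j then g_sigma_algebra_preimage (z j)
  else preimage_set_system setT s setT.

(* M follows the distribution P(N, theta, L). A probability measure on C^* is  *)
(* represented by a probability measure L on C such that L {0} = 0.           *)
Definition follows_ensemble (N : nat) (theta : R) (L : probability R[i] R)
    {d} {Omega : measurableType d} (P : probability Omega R)
    (M : Omega -> 'M[R[i]]_N) : Prop :=
  exists (d' : measure_display) (Omega' : measurableType d')
    (P' : probability Omega' R)
    (s : Omega' -> 'S_N) (z : 'I_N -> {RV P' >-> R[i]}),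
  [/\ forall t, measurable (s @^-1` [set t]) /\
                P' (s @^-1` [set t]) = (ewens theta t)%:E,
      forall j, has_law P' (z j) L,
      independent_systems P' setT (ensemble_system s (fun j => z j)) &
      forall A, measurable A ->
        P (M @^-1` A) = P' [set w | A (monomial_mx (s w) (fun j => z j w))]].

Definition is_product_law (k : nat) (L : probability R[i] R)
    (nu : set R[i] -> \bar R) : Prop :=
  exists (d' : measure_display) (Omega' : measurableType d')
    (P' : probability Omega' R) (z : 'I_k -> {RV P' >-> R[i]}),
  [/\ forall i, has_law P' (z i) L,
      independent_rvs P' (fun i => z i : Omega' -> R[i]) &
      has_law P' (fun w => \prod_(i < k) z i w) nu].

(* Index inl k stands for a_k, index inr (k, p) for T_{k,p}; only k, p >= 1    *)
(* are relevant, the other variables of the families a and T are unused.      *)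
Definition limit_index : set (nat + nat * nat) :=
  [set i | match i with
           | inl k => (0 < k)%N
           | inr (k, p) => (0 < k)%N /\ (0 < p)%N
           end].

Definition limit_system {d} {Omega : measurableType d}
    (a : nat -> Omega -> nat) (T : nat -> nat -> Omega -> R[i])
    (i : nat + nat * nat) : set (set Omega) :=
  match i with
  | inl k => g_sigma_algebra_preimage (a k)
  | inr (k, p) => g_sigma_algebra_preimage (T k p)
  end.

(* E[a_k] = theta / k is the rate; the second argument of poisson_prob is       *)
(* unused in its definition.                                                  *)
Definition limit_variables (theta : R) (L : probability R[i] R)
    {d} {Omega : measurableType d} (P : probability Omega R)
    (a : nat -> {RV P >-> nat}) (T : nat -> nat -> {RV P >-> R[i]}) : Prop :=
  [/\ forall k, (0 < k)%N -> has_law P (a k) (poisson_prob (theta / k%:R) 0),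
      forall k p, (0 < k)%N -> (0 < p)%N ->
        is_product_law k L (distribution P (T k p)) &
      independent_systems P limit_index
        (limit_system (fun k => a k) (fun k p => T k p))].

Definition limit_measure {d} {Omega : measurableType d}
    (a : nat -> Omega -> nat) (T : nat -> nat -> Omega -> R[i]) (w : Omega) :
    set R[i] -> \bar R :=
  fun A => (\sum_(1 <= k <oo) \sum_(1 <= p < (a k w).+1)
              \sum_(z \in [set z : R[i] | (z ^+ k = T k p w)%R])
                (\d_z A : \bar R))%E.

(* The class U^q; the i.i.d. sequence (X_k)_{k >= 1} is indexed from 0 here.   *)
Definition class_U (q : R) {d} {Omega : measurableType d}
    (P : probability Omega R) (X : Omega -> R) : Prop :=
  P.-integrable setT (EFin \o X) /\
  forall (d' : measure_display) (Omega' : measurableType d')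
    (P' : probability Omega' R) (Y : nat -> {RV P' >-> R}),
    (forall k, has_law P' (Y k) (pushforward P X)) ->
    independent_rvs P' (fun k => Y k : Omega' -> R) ->
    forall eps : R, 0 < eps ->
      exists2 C : R, 0 < C & forall n, (0 < n)%N ->
        (P' [set w | (eps <=
               `|n%:R^-1 * (\sum_(k < n) Y k w) - fine 'E_P[X]|)%R]
         <= (C / n%:R `^ q)%:E)%E.

End Ensemble.

(* Main.v *)
Require Import Defs.
From HB Require Import structures.
From mathcomp Require Import all_boot all_order all_algebra all_fingroup.
From mathcomp Require Import complex.
From mathcomp Require Import all_classical all_reals all_analysis.
From mathcomp Require Import measurable_realfun poisson_distribution.
From mathcomp Require Import ring lra.

(** A monomial matrix splits along the cycles of its permutation: a cycle [C]
contributes the factor 'X^|C| - (product of the entries carried by C) to the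
characteristic polynomial ([char_poly_monomial]).  The eigenvalues carried by a
cycle of size k are therefore the k-th roots of a product of k independent
variables of law L, exactly as for the points of the limit measure of index k.
Let rho_k ([root_measure L k]) be the expected number of k-th roots of such a
product, so that rho_k has mass k.  Both mean measures are mixtures of the rho_k:
- if p_N(k) ([cycle_prob]) is the probability that the cycle of a given point of
  an Ewens permutation of N points has k + 1 points, the mean number of cycles of
  size k + 1 is N p_N(k) / (k + 1), since each is seen from its k + 1 points; so the
  mean spectral measure is the sum over k < N of N p_N(k) / (k + 1) rho_(k+1)
  ([mean_spectral_mixture]);
- the mean limit measure is the sum over k of theta / (k + 1) rho_(k+1)
  ([mean_limit_measure]).
Inserting a point in a permutation gives p_(N+1)(0) = theta / (theta + N) and
p_(N+1)(k+1) = N / (theta + N) p_N(k).  Everything that is needed on the Ewens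
measure follows from this recursion: the p_N(k) sum to 1 over k, N p_N(k) tends to
theta, and N p_N(k) <= 2 theta as long as 2 (k + 1) <= N.

Convergence to the circle.  The k-th roots of t have modulus exp(log|t| / k) and
one argument in each of k consecutive arcs of length 2 pi / k.  By the weak law of
large numbers the modulus is close to R with high probability, and then the mean
of a continuous function over the roots is close to a Riemann sum of its integral
over the circle ([root_average_near]).  Hence the integrals against rho_k / k tend
to the mean over the circle ([root_measure_average_cvg]), and so do their averages
with weights p_N(k), because these weights have sum 1 and each of them tends to 0
([cycle_average_cvg]).

Convergence off the circle.  The k-th roots of t are outside the annulus
r1 < |z| < r2 only if log|t| / k is at distance at least some eps from log R.  This
has probability at most C / k^2 when log|Z| is in the class of exponent 2.
So rho_k gives mass at most C / k to the complement of the annulus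
([root_measure_restriction_le]).  The terms of the N-th mixture with 2 (k + 1) <= N
are then dominated by 2 theta C / (k + 1)^2, those of larger k sum to at most
4 C / N, and the convergence of each coefficient to theta / (k + 1) passes to the
sum ([cycle_sum_cvg], [restricted_mixture_cvg]).

The law of large numbers and the class of exponent 2 are both applied to the
sequence T_(1,1), T_(1,2), and so on, which is independent and has law L.  As the
spectral measure is not assumed to be a measurable function of the matrix, its
mean is computed by replacing it, off the null event that the matrix is not
monomial with nonzero entries, by a sum of indicators of measurable events
([ge0_integral_eq_off]). *)

Set Implicit Arguments.
Unset Strict Implicit.
Unset Printing Implicit Defensive.

Import Order.TTheory GRing.Theory Num.Theory.
Import numFieldNormedType.Exports.

Local Open Scope ring_scope.

Local Notation Re := complex.Re.
Local Notation Im := complex.Im.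

(** * Cycles and the characteristic polynomial of a monomial matrix *)

Section Porbits.
Import mathcomp.boot.fintype mathcomp.boot.finset.
Variable T : finType.
Implicit Types (t u : {perm T}) (x y : T) (B : {set {set T}}) (J C : {set T}).

Lemma porbit_perm1 t x : porbit t (t x) = porbit t x.
Proof. by have := porbit_perm t 1 x; rewrite expg1. Qed.

Lemma mem_porbit_perm t x y : (t y \in porbit t x) = (y \in porbit t x).
Proof. by rewrite -!eq_porbit_mem porbit_perm1. Qed.

Lemma porbits_mem t C x : C \in porbits t -> x \in C -> C = porbit t x.
Proof. by case/imsetP => y _ -> xC; apply/eqP; rewrite eq_sym eq_porbit_mem. Qed.

Lemma porbits_partition t : partition (porbits t) [set: T].
Proof.
apply/and3P; split.
- apply/eqP/setP => x; rewrite !inE; apply/bigcupP.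
  by exists (porbit t x); rewrite ?imset_f ?porbit_id.
- apply/trivIsetP => C D tC tD; apply: contraR => /pred0Pn [x /andP[/= xC xD]].
  by rewrite (porbits_mem tC xC) (porbits_mem tD xD).
- by apply/imsetP => -[x _ /setP /(_ x)]; rewrite inE porbit_id.
Qed.

Lemma porbit_eq_on t u x :
  {in porbit t x, u =1 t} -> porbit u x = porbit t x.
Proof.
move=> utx.
have E i : (u ^+ i)%g x = (t ^+ i)%g x.
  elim: i => [|i IH]; first by rewrite !expg0.
  by rewrite !expgSr !permM IH utx ?mem_porbit.
by apply/setP => y; apply/porbitP/porbitP => -[i ->]; exists i; rewrite E.
Qed.

Lemma porbit_fix t x : t x = x -> porbit t x = [set x].
Proof.
move=> tx; apply/setP => y; rewrite inE; apply/porbitP/eqP => [[i ->]|->].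
  elim: i => [|i IH]; first by rewrite expg0 perm1.
  by rewrite expgSr permM IH.
by exists 0; rewrite expg0 perm1.
Qed.

Definition stable t J := [forall i in J, t i \in J].

Lemma stable_porbit t J x : stable t J -> x \in J -> porbit t x \subset J.
Proof.
move=> /forallP tJ xJ; apply/subsetP => y /porbitP [i ->].
elim: i => [|i IH]; first by rewrite expg0 perm1.
by rewrite expgSr permM; have /implyP := tJ ((t ^+ i)%g x); apply.
Qed.

Lemma stable_cover t B : B \subset porbits t -> stable t (cover B).
Proof.
move=> /subsetP tB; apply/forallP => i; apply/implyP => /bigcupP [C BC iC].
apply/bigcupP; exists C => //.
by rewrite (porbits_mem (tB _ BC) iC) -(porbit_perm1 t) porbit_id.
Qed.

Lemma cover_porbits t J : stable t J -> cover (porbit t @: J) = J.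
Proof.
move=> tJ; apply/setP => x; apply/bigcupP/idP => [[C /imsetP [y yJ ->]]|xJ].
  by apply/subsetP/stable_porbit.
by exists (porbit t x); rewrite ?imset_f ?porbit_id.
Qed.

Lemma porbits_cover t B : B \subset porbits t -> porbit t @: cover B = B.
Proof.
move=> /subsetP tB; apply/setP => C; apply/imsetP/idP => [[x /bigcupP [D BD xD] ->]|BC].
  by rewrite -(porbits_mem (tB _ BD) xD).
have /imsetP [x _ Cx] := tB _ BC; exists x => //.
by apply/bigcupP; exists C => //; rewrite Cx porbit_id.
Qed.

Lemma astabs_stable t J : stable t J -> t \in ('N(J | 'P))%g.
Proof.
move=> tJ; rewrite inE in_setT inE /=; apply/subsetP => x xJ.
by rewrite !inE /= /aperm; have /forallP /(_ x) /implyP := tJ; apply.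
Qed.

Lemma restr_permE_if t J x : stable t J ->
  restr_perm J t x = if x \in J then t x else x.
Proof.
move=> tJ; case: ifPn => xJ; first by rewrite restr_permE ?astabs_stable.
by rewrite (out_perm (restr_perm_on _ _)).
Qed.

(** A union of cycles is stable, and the restriction of the permutation to it is
the product of these cycles, of signs [(-1) ^+ #|C|.-1]; the exponent is shifted by
2 to avoid truncated subtraction. *)
Lemma odd_restr_perm t B : B \subset porbits t ->
  restr_perm (cover B) t = odd (\sum_(C in B) #|C|.+1) :> bool.
Proof.
move=> tB; set J := cover B; set u := restr_perm J t.
have tJ : stable t J by apply: stable_cover.
have uE x : u x = if x \in J then t x else x by apply: restr_permE_if.
have uin x : x \in J -> porbit u x = porbit t x.
  move=> xJ; apply: porbit_eq_on => y yx.
  by rewrite uE (subsetP (stable_porbit tJ xJ) _ yx).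
have uout x : x \notin J -> porbit u x = [set x].
  by move=> xJ; apply: porbit_fix; rewrite uE (negbTE xJ).
have E : porbits u = B :|: set1 @: ~: J.
  apply/setP => C; apply/imsetP/idP => [[x _ ->]|].
    rewrite inE; have [xJ|xJ] := boolP (x \in J).
      by rewrite uin // -{1}(porbits_cover tB) imset_f.
    by rewrite uout // imset_f ?orbT // inE.
  rewrite inE => /orP [BC|/imsetP [x]]; last first.
    by rewrite inE => xJ ->; exists x; rewrite ?uout.
  have /imsetP [x _ Cx] := subsetP tB _ BC; exists x => //.
  by rewrite uin //; apply/bigcupP; exists C => //; rewrite Cx porbit_id.
have D : [disjoint B & set1 @: ~: J].
  apply/pred0P => C /=; apply/negbTE/negP => /andP [BC /imsetP [x xJ Cx]].
  move: xJ; rewrite inE => /negP; apply; apply/bigcupP; exists C => //.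
  by rewrite Cx inE.
have tI : trivIset B.
  by apply: (trivIsetS tB); apply: partition_trivIset (porbits_partition t).
have cJ : #|J| = (\sum_(C in B) #|C|)%N by rewrite -(eqP (tI : _ == _)).
rewrite /odd_perm E cardsU disjoint_setI0 // cards0 subn0 card_imset; last first.
  by move=> x y /setP /(_ x); rewrite !inE eqxx => /esym /eqP.
under eq_bigr => C _ do rewrite -addn1.
rewrite big_split /= sum1_card -cJ -(cardsC J) !oddD.
by case: (odd _) (odd _) (odd _) => [] [] [].
Qed.

End Porbits.

Section Det.
Import mathcomp.boot.fintype mathcomp.boot.finset.
Variable (K : comNzRingType) (n : nat) (t : 'S_n) (a b : 'I_n -> K).
Let A : 'M[K]_n :=
  \matrix_(i, j) ((if j == t i then b i else 0) + (if j == i then a i else 0)).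

(** The row [i] is the sum of two rows with a single nonzero entry, at the
columns [t i] and [i].  In the expansion, the set [J] of rows that use the first kind
contributes only if [t] stabilises [J], through the single permutation equal to [t]
on [J] and to the identity elsewhere.  The stable sets are the unions of sets of
cycles, so the sum over them factors into a product over the cycles. *)
Lemma det_cycles :
  \det A = \prod_(C in porbits t)
      ((-1) ^+ #|C|.+1 * \prod_(i in C) b i + \prod_(i in C) a i).
Proof.
(* If J is not stable, two rows would have to share a column. *)
have S0 J (c : 'S_n -> K) : ~~ stable t J ->
  \sum_(s : 'S_n) c s * (\prod_i (if i \in J then if s i == t i then b i else 0
          else if s i == i then a i else 0)) = 0.
  move=> /forallPn [i +]; rewrite negb_imply => /andP [iJ tiJ].
  rewrite big1 // => s _.
  have [si|si] := eqVneq (s i) (t i); last first.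
    by rewrite (bigD1 i) //= iJ (negbTE si) mul0r mulr0.
  rewrite (bigD1 (t i)) //= (negbTE tiJ) ifN ?mul0r ?mulr0 //.
  by rewrite -si (inj_eq perm_inj) si; apply: contraNneq tiJ => ->.
have S1 J (c : 'S_n -> K) : stable t J ->
  \sum_(s : 'S_n) c s * (\prod_i (if i \in J then if s i == t i then b i else 0
          else if s i == i then a i else 0))
  = c (restr_perm J t) * (\prod_(i in J) b i * \prod_(i in ~: J) a i).
  move=> tJ; rewrite (bigD1 (restr_perm J t)) //= [X in _ + X]big1 ?addr0.
    congr (_ * _); rewrite (bigID (mem J)) /=; congr (_ * _).
      by apply: eq_bigr => i iJ; rewrite restr_permE_if // iJ eqxx.
    apply: eq_big => i; first by rewrite inE.
    by move=> iJ; rewrite restr_permE_if // (negbTE iJ) eqxx.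
  move=> s sN.
  have [i si] : exists i, s i != restr_perm J t i.
    apply/existsP; apply: contraR sN; rewrite negb_exists => /forallP si.
    by apply/eqP/permP => i; apply/eqP; have := si i; rewrite negbK.
  rewrite (bigD1 i) //=; move: si; rewrite restr_permE_if //.
  by case: ifP => _ /negbTE ->; rewrite mul0r mulr0.
have -> : \det A = \sum_(J : {set 'I_n} | stable t J)
    (-1) ^+ (restr_perm J t) * (\prod_(i in J) b i * \prod_(i in ~: J) a i).
  rewrite /determinant.
  under eq_bigr => s _.
    under eq_bigr => i _ do rewrite mxE.
    rewrite bigA_distr big_distrr /=.
    over.
  rewrite exchange_big /= [RHS]big_mkcond /=; apply: eq_bigr => J _.
  by case: ifPn => tJ; [apply: S1|apply: S0].
rewrite (reindex_onto (@cover _) (fun J => porbit t @: J)) /=; last first.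
  by move=> J; apply: cover_porbits.
have pI B : stable t (cover B) && (porbit t @: cover B == B) = (B \subset porbits t).
  apply/andP/idP => [[_ /eqP <-]|tB]; first by apply/subsetP => _ /imsetP [x _ ->]; exact: imset_f.
  by rewrite stable_cover // porbits_cover.
rewrite (eq_bigl _ _ pI) big_mkcond /=.
rewrite [RHS]big_mkcond /=.
(* al and be are extended by 0 and 1 off the set of cycles, so that both sides
   become distributed products over all sets of indices. *)
pose al C := if C \in porbits t then (-1) ^+ #|C|.+1 * \prod_(i in C) b i else 0.
pose be C := if C \in porbits t then \prod_(i in C) a i else 1.
rewrite [RHS](eq_bigr (fun C => al C + be C)); last first.
  by move=> C _; rewrite /al /be; case: ifP => // _; rewrite add0r.
rewrite bigA_distr; apply: eq_bigr => B _; case: ifPn => tB; last first.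
  have [C BC tC] := subsetPn tB.
  by rewrite (bigD1 C) //= BC /al (negbTE tC) mul0r.
have tI : trivIset B.
  by apply: (trivIsetS tB); apply: partition_trivIset (porbits_partition t).
rewrite odd_restr_perm // signr_odd expr_sum big_trivIset // mulrA -big_split /=.
rewrite [RHS](bigID (mem B)) /=; congr (_ * _).
  by apply: eq_bigr => C BC; rewrite BC /al (subsetP tB _ BC).
transitivity (\prod_(C in porbits t :\: B) \prod_(i in C) a i).
  rewrite -big_trivIset; last first.
    apply: (trivIsetS (subsetDl _ _)).
    by apply: partition_trivIset (porbits_partition t).
  apply: eq_bigl => i; rewrite inE.
  have porb : porbit t i \in porbits t by apply: imset_f.
  apply/idP/bigcupP => [iB|[C]].
    exists (porbit t i); last exact: porbit_id.
    rewrite inE porb andbT; apply: contra iB => iB; apply/bigcupP.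
    by exists (porbit t i) => //; exact: porbit_id.
  rewrite inE => /andP [BC tC] iC; apply/negP => /bigcupP [D BD iD].
  by move: BC; rewrite (porbits_mem tC iC) -(porbits_mem (subsetP tB _ BD) iD) BD.
rewrite [LHS]big_mkcond [RHS]big_mkcond /=; apply: eq_bigr => C _.
by rewrite inE /be; case: (C \in B) => //=; case: ifP.
Qed.
End Det.

(** [det_cycles] applies to the characteristic matrix, where the
entries of the monomial matrix sit along the inverse permutation, which has the same
cycles. *)
Lemma char_poly_monomial (K : comNzRingType) n (s : 'S_n) (z : 'I_n -> K) :
  char_poly (\matrix_(j, k) (if j == s k then z j else 0)) =
  \prod_(C in porbits s) ('X^#|C| - (\prod_(j in C) z j)%:P).
Proof.
rewrite /char_poly -porbitsV.
rewrite (_ : char_poly_mx _ = \matrix_(i, j) ((if j == s^-1%g i then - (z i)%:P else 0)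
   + (if j == i then 'X else 0))); last first.
  apply/matrixP => i j; rewrite !mxE -(canF_eq (permK s)) (eq_sym (s j)).
  rewrite (eq_sym j) addrC; congr (_ + _); last by case: (i == j).
  by case: ifP => // _; rewrite ?rmorph0 ?oppr0.
rewrite (det_cycles s^-1%g (fun=> 'X) (fun i => - (z i)%:P)).
apply: eq_bigr => C _; rewrite prodrN prodr_const mulrA -exprD addSn addnn.
rewrite exprS mulN1r -signr_odd odd_double expr0 mulN1r addrC.
by rewrite rmorph_prod.
Qed.

(** * Cycle sizes under the Ewens measure *)

Section Insertion.
Import mathcomp.boot.fintype mathcomp.boot.finset.
Variables (n : nat) (x : 'I_n.+1).
Implicit Types (s : 'S_n) (k : 'I_n) (y : 'I_n.+1).

(** The new point [x] is inserted just after [y] in the cycle of [y]; for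
[y = x] it becomes a fixed point.  This is one step of the Chinese restaurant
process. *)
Definition insert_perm y s : 'S_n.+1 := (tperm x y * lift_perm x x s)%g.

Lemma insert_perm_bij : bijective (fun ys : 'I_n.+1 * 'S_n => insert_perm ys.1 ys.2).
Proof.
apply: inj_card_bij; last by rewrite card_prod !card_ord !card_Sn factS.
move=> [y s] [y' s'] /= E.
have ix z r : (insert_perm z r)^-1%g x = z.
  by apply: (canLR (permK _)); rewrite /insert_perm permM tpermR lift_perm_id.
have yy : y = y' by rewrite -(ix y s) E ix.
rewrite yy; congr (_, _); move: E; rewrite /insert_perm yy => /mulgI E.
by apply/permP => k; apply: (@lift_inj _ x); rewrite -!(lift_perm_lift x x) E.
Qed.

Lemma porbit_lift_perm s k :
  porbit (lift_perm x x s) (lift x k) = lift x @: porbit s k.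
Proof.
have E i : ((lift_perm x x s) ^+ i)%g (lift x k) = lift x ((s ^+ i)%g k).
  elim: i => [|i IH]; first by rewrite !expg0 !perm1.
  by rewrite !expgSr !permM IH lift_perm_lift.
apply/setP => y; apply/porbitP/imsetP => [[i ->]|[z /porbitP [i ->] ->]].
  by exists ((s ^+ i)%g k); rewrite ?mem_porbit.
by exists i; rewrite E.
Qed.

Lemma porbit_lift_perm_id s : porbit (lift_perm x x s) x = [set x].
Proof. by apply: porbit_fix; rewrite lift_perm_id. Qed.

Lemma card_porbits_lift_perm s : #|porbits (lift_perm x x s)| = #|porbits s|.+1.
Proof.
set u := lift_perm x x s.
have -> : porbits u = [set x] |: [set lift x @: (C : {set 'I_n}) | C in porbits s].
  apply/setP => C; rewrite !inE; apply/imsetP/orP => [[z _ ->]|].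
    case: (unliftP x z) => [k ->|->]; last by left; rewrite porbit_lift_perm_id.
    by right; rewrite porbit_lift_perm; apply/imset_f/imset_f.
  case=> [/eqP ->|/imsetP [D /imsetP [k _ ->] ->]].
    by exists x; rewrite ?porbit_lift_perm_id.
  by exists (lift x k); rewrite ?porbit_lift_perm.
rewrite cardsU1 card_imset; last exact/imset_inj/lift_inj.
case: imsetP => [[C _ /setP /(_ x)]|_] //=.
rewrite inE eqxx => /esym /imsetP [k _ /eqP].
by rewrite (negbTE (neq_lift x k)).
Qed.

Lemma card_porbits_insert_lift s k :
  #|porbits (insert_perm (lift x k) s)| = #|porbits s|.
Proof.
have := porbits_mul_tperm (lift_perm x x s) x (lift x k).
rewrite -/(insert_perm _ _) /= card_porbits_lift_perm neq_lift.
have -> : x \notin porbit (lift_perm x x s) (lift x k).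
  by rewrite porbit_sym porbit_lift_perm_id inE eq_sym neq_lift.
by rewrite addn1 addn2 => -[].
Qed.

Lemma insert_perm_id s : insert_perm x s = lift_perm x x s.
Proof. by rewrite /insert_perm tperm1 mul1g. Qed.

Lemma card_porbit_insert_lift s k :
  #|porbit (insert_perm (lift x k) s) x| = #|porbit s k|.+1.
Proof.
set y := lift x k; set u := lift_perm x x s; set t := insert_perm y s.
have yx : y != x by rewrite eq_sym neq_lift.
have ux : u x = x by rewrite lift_perm_id.
have tx : t x = u y by rewrite /t permM tpermL.
have ty : t y = x by rewrite /t permM tpermR.
have tz z : z != x -> z != y -> t z = u z.
  by move=> zx zy; rewrite /t permM tpermD // eq_sym.
have Nx : x \notin porbit u y by rewrite porbit_sym porbit_lift_perm_id inE.
suff -> : porbit t x = x |: porbit u y.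
  by rewrite cardsU1 Nx porbit_lift_perm card_imset //; exact: lift_inj.
apply/eqP; rewrite eqEsubset; apply/andP; split.
  apply: stable_porbit; last by rewrite !inE eqxx.
  apply/forallP => z; apply/implyP; rewrite !inE => /orP [/eqP ->|zy].
    by rewrite tx mem_porbit_perm porbit_id orbT.
  have zx : z != x by apply: contraNneq Nx => <-.
  have [->|zny] := eqVneq z y; first by rewrite ty eqxx.
  by rewrite tz // mem_porbit_perm zy orbT.
rewrite subUset sub1set porbit_id /=.
have J : porbit u y \subset porbit t x :\ x.
  apply: stable_porbit; last first.
    by rewrite !inE yx -(mem_porbit_perm t) ty porbit_id.
  apply/forallP => z; apply/implyP; rewrite !inE => /andP [zx zt].
  apply/andP; split.
    by apply: contraNneq zx => uz; apply/eqP/(@perm_inj _ u); rewrite uz ux.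
  have [->|zny] := eqVneq z y; first by rewrite -tx mem_porbit_perm porbit_id.
  by rewrite -tz // mem_porbit_perm.
by apply: subset_trans J (subsetDl _ _).
Qed.

(** Every permutation of [n.+1] points is obtained once by an insertion of [x].
With [card_porbits_insert_lift] and [card_porbit_insert_lift], this turns sums over
permutations weighted by the number of cycles into recursions on [n]. *)
Lemma sum_insert_perm (V : nmodType) (F : 'S_n.+1 -> V) :
  \sum_t F t = \sum_(s : 'S_n) F (lift_perm x x s)
    + \sum_(k < n) \sum_(s : 'S_n) F (insert_perm (lift x k) s).
Proof.
rewrite (reindex _ (onW_bij _ insert_perm_bij)) /=.
rewrite -(pair_bigA _ (fun y s => F (insert_perm y s))) /= (bigD1 x) //=.
congr (_ + _); first by apply: eq_bigr => s _; rewrite insert_perm_id.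
rewrite (reindex_omap (lift x) (unlift x)) /=; last first.
  by move=> y yx; case: unliftP yx => [k ->|->]; rewrite ?eqxx.
by apply: eq_bigl => k; rewrite liftK eqxx eq_sym neq_lift.
Qed.

End Insertion.

Section Ewens.
Import mathcomp.boot.fintype mathcomp.boot.finset.
Variables (R : numFieldType) (theta : R).
Hypothesis theta_gt0 : 0 < theta.

Let W n := \sum_(s : 'S_n) theta ^+ #|porbits s|.

(** The probability that the cycle of a given point of an Ewens permutation of
[n] points has [k.+1] points, in the form of the recursion that the insertion of
this point provides; see [sum_ewens_porbit]. *)
Fixpoint cycle_prob n k : R :=
  match n, k with
  | 0, _ => 0
  | n'.+1, 0 => theta / (theta + n'%:R)
  | n'.+1, k'.+1 => n'%:R / (theta + n'%:R) * cycle_prob n' k'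
  end.

Lemma ewens_partition_gt0 n : 0 < W n.
Proof.
rewrite /W; apply: (@lt_le_trans _ _ (theta ^+ #|porbits (1%g : 'S_n)|)).
  exact: exprn_gt0.
rewrite (bigD1 1%g) //= lerDl sumr_ge0 // => s _; exact/exprn_ge0/ltW.
Qed.

Let WS n : W n.+1 = (theta + n%:R) * W n.
Proof.
rewrite /W (sum_insert_perm ord0) mulrDl; congr (_ + _).
  by rewrite mulr_sumr; apply: eq_bigr => s _; rewrite card_porbits_lift_perm exprS.
rewrite exchange_big /= mulr_sumr; apply: eq_bigr => s _.
under eq_bigr do rewrite card_porbits_insert_lift.
by rewrite sumr_const card_ord mulr_natl.
Qed.

Lemma sum_ewens_porbit n (x : 'I_n) k :
  \sum_(s : 'S_n) theta ^+ #|porbits s| * (#|porbit s x| == k.+1)%:R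
    = W n * cycle_prob n k.
Proof.
elim: n k x => [|n IH] k x; first by case: x.
have tn : theta + n%:R != 0 by rewrite gt_eqF // ltr_wpDr.
rewrite (sum_insert_perm x) WS.
under eq_bigr => s _ do
  rewrite card_porbits_lift_perm porbit_lift_perm_id cards1 exprS.
under [X in _ + X]eq_bigr => y _ do
  (under eq_bigr => s _ do rewrite card_porbits_insert_lift card_porbit_insert_lift eqSS).
case: k => [|k] /=.
  rewrite [X in _ + X]big1 ?addr0; last first.
    move=> y _; rewrite big1 // => s _.
    by rewrite (negbTE (card_porbit_neq0 s y)) mulr0.
  under eq_bigr do rewrite mulr1.
  by rewrite -mulr_sumr -/(W n); field.
rewrite big1 ?add0r; last by move=> s _; rewrite mulr0.
under eq_bigr do rewrite IH.
by rewrite sumr_const card_ord -mulr_natl; field.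
Qed.

(** A sum over the cycles is a sum over the points, each weighted by the inverse
of the size of its cycle. *)
Lemma sum_ewens_porbits n (g : nat -> R) :
  \sum_(s : 'S_n) theta ^+ #|porbits s| / W n * \sum_(C in porbits s) g #|C|
  = \sum_(k < n) n%:R * cycle_prob n k / k.+1%:R * g k.+1.
Proof.
have gE (s : 'S_n) : \sum_(C in porbits s) g #|C| =
    \sum_(x < n) \sum_(k < n) (#|porbit s x| == k.+1)%:R * (g k.+1 / k.+1%:R).
  transitivity (\sum_(x : 'I_n) g #|porbit s x| / #|porbit s x|%:R).
    rewrite (eq_bigl (fun x => x \in [set: 'I_n])); last by move=> x; rewrite inE.
    rewrite (set_partition_big _ (porbits_partition s)) /=.
    apply: eq_bigr => C sC.
    rewrite (eq_bigr (fun=> g #|C| / #|C|%:R)); last first.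
      by move=> x xC; rewrite -(porbits_mem sC xC).
    rewrite sumr_const -[RHS]mulr_natr divfK // pnatr_eq0.
    by case/imsetP: sC => x _ ->; rewrite card_porbit_neq0.
  apply: eq_bigr => x _.
  have c0 : (0 < #|porbit s x|)%N by rewrite lt0n card_porbit_neq0.
  have cn : (#|porbit s x|.-1 < n)%N.
    by rewrite prednK // -[X in (_ <= X)%N]card_ord max_card.
  rewrite (bigD1 (Ordinal cn)) //= prednK // eqxx mul1r big1 ?addr0 // => k kN.
  case: eqP => [ck|_]; last by rewrite mul0r.
  by case/eqP: kN; apply/val_inj; rewrite /= ck.
have W0 : W n != 0 by rewrite gt_eqF // ewens_partition_gt0.
under eq_bigr => s _ do rewrite gE mulr_sumr.
rewrite exchange_big /=.
under eq_bigr => x _.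
  under eq_bigr => s _ do rewrite mulr_sumr.
  rewrite exchange_big /=.
  under eq_bigr => k _.
    rewrite (eq_bigr (fun s : 'S_n => theta ^+ #|porbits s| * (#|porbit s x| == k.+1)%:R
       * (g k.+1 / k.+1%:R / W n))); last first.
      by move=> s _; rewrite mulrACA; congr (_ * _); rewrite mulrC.
    rewrite -mulr_suml sum_ewens_porbit.
    over.
  over.
rewrite exchange_big /=; apply: eq_bigr => k _.
rewrite sumr_const card_ord -mulr_natl; field.
by rewrite W0 andbT addrC natr1 pnatr_eq0.
Qed.

End Ewens.

(** * Topology and Borel structure of the complex plane *)

Local Open Scope classical_set_scope.

Section ComplexTopology.
Variable R : realType.
Implicit Types (z w : R[i]) (A : set R[i]).

(** The topology of [R[i]] comes from its norm, which takes its values in [R[i]]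
itself; radii are brought back to [R] here. *)
Lemma nbhs_normcP z A :
  nbhs z A <-> exists2 e : R, 0 < e & forall w, normc (z - w) < e -> A w.
Proof.
have E : nbhs z A <-> nbhs_ball (z : R[i]^o) A by exact: (@nbhs_ballP _ (R[i]^o)).
rewrite E; split.
  move=> [e /= e0 zA]; exists (Re e); first by move: e0; rewrite ltcE /= => /andP[].
  move=> w zw; apply: zA; rewrite /ball /= /ball_ ltcE /= zw andbT.
  by move: e0; rewrite ltcE /= => /andP[].
move=> [e e0 zA]; exists (e%:C)%C => /=; first by rewrite ltcE /= eqxx.
move=> w; rewrite /ball /= /ball_ ltcE /= => /andP[_ zw]; exact: zA.
Qed.

Lemma open_normcP A :
  open A <-> forall z, A z -> exists2 e : R, 0 < e & forall w, normc (z - w) < e -> A w.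
Proof.
rewrite openE; split => H z Az; first exact/nbhs_normcP/H.
exact/nbhs_normcP/H.
Qed.

Lemma normc_Re z : `|Re z| <= normc z.
Proof.
case: z => a b /=; rewrite -sqrtr_sqr ler_sqrt ?addr_ge0 ?sqr_ge0 //.
by rewrite lerDl sqr_ge0.
Qed.

Lemma normc_Im z : `|Im z| <= normc z.
Proof.
case: z => a b /=; rewrite -sqrtr_sqr ler_sqrt ?addr_ge0 ?sqr_ge0 //.
by rewrite lerDr sqr_ge0.
Qed.

Lemma normc_le_ReIm z : normc z <= `|Re z| + `|Im z|.
Proof.
case: z => a b /=; rewrite -[leRHS]ger0_norm ?addr_ge0 // -sqrtr_sqr.
rewrite ler_sqrt ?sqr_ge0 // sqrrD !real_normK ?num_real //.
by rewrite -addrA lerD2l lerDr mulrn_wge0 // mulr_ge0.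
Qed.

Lemma normc_ge0 z : 0 <= normc z.
Proof. exact: le_trans (normr_ge0 _) (normc_Re z). Qed.

Lemma normc_gt0 z : (0 < normc z) = (z != 0).
Proof.
rewrite lt_def normc_ge0 andbT; congr (~~ _); apply/eqP/eqP.
  exact: Normc.eq0_normc.
by move=> ->; rewrite Normc.normc0.
Qed.

Lemma normc_distD z w v : normc (z - v) <= normc (z - w) + normc (w - v).
Proof. by rewrite -[z - v](subrKA w) le_normcD. Qed.

Lemma normc_distC z w : normc (z - w) = normc (w - z).
Proof. by rewrite -normcN opprB. Qed.

Lemma open_measurableC A : open A -> measurable A.
Proof. by move=> oA; exact: sub_sigma_algebra. Qed.

Lemma continuous_measurableC (f : R[i] -> R) :
  continuous f -> measurable_fun setT f.
Proof.
move=> /continuousP cf; apply: (measurability _ (RGenOpens.measurableE R)).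
move=> _ [_ [a [b ->] <-]]; rewrite setTI; apply: open_measurableC.
exact/cf/interval_open.
Qed.

Lemma lipschitz_measurableC (f : R[i] -> R) :
  (forall z w, `|f z - f w| <= normc (z - w)) -> measurable_fun setT f.
Proof.
move=> lf; apply: continuous_measurableC => z.
move=> A /nbhs_ballP [e e0 fA]; apply/nbhs_normcP; exists e => // w zw.
by apply: fA; apply: le_lt_trans (lf _ _) zw.
Qed.

Lemma measurable_Re : measurable_fun setT (@Re R : R[i] -> R).
Proof.
by apply: lipschitz_measurableC => -[a b] [c d]; exact: (normc_Re (Complex (a - c) (b - d))).
Qed.

Lemma measurable_Im : measurable_fun setT (@Im R : R[i] -> R).
Proof.
by apply: lipschitz_measurableC => -[a b] [c d]; exact: (normc_Im (Complex (a - c) (b - d))).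
Qed.

Lemma measurable_normc : measurable_fun setT (@normc R : R[i] -> R).
Proof.
apply: lipschitz_measurableC => z w; have H (u v : R[i]) : normc u <= normc v + normc (u - v).
  by have := le_normcD v (u - v); rewrite addrC subrK.
by rewrite ler_distl lerBlDr {1}normc_distC !H.
Qed.

(** An open set of the plane is a countable union of squares with rational centre
and radius; the preimage of a square is an intersection of two preimages of
intervals. *)
Lemma measurable_fun_Complex d (T : measurableType d) (f g : T -> R) :
  measurable_fun setT f -> measurable_fun setT g ->
  measurable_fun setT (fun t => Complex (f t) (g t)).
Proof.
move=> mf mg; apply: (measurability (@open R[i])) => //.
move=> _ [A oA <-]; rewrite setTI.
pose box (q : rat * rat * rat) (t : T) :=
  `|f t - ratr q.1.1| < ratr q.2 /\ `|g t - ratr q.1.2| < ratr q.2.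
pose good (q : rat * rat * rat) := forall u v : R,
  `|u - ratr q.1.1| < ratr q.2 -> `|v - ratr q.1.2| < ratr q.2 -> A (Complex u v).
have -> : (fun t => Complex (f t) (g t)) @^-1` A =
   \bigcup_(q : rat * rat * rat) (if `[< good q >] then box q else set0).
  apply/seteqP; split => t /=; last first.
    by move=> [q _]; case: ifPn => // /asboolP gq [? ?]; exact: gq.
  move=> /(proj1 (open_normcP A) oA) [e e0 eA].
  have e84 : e / 8 < e / 4 by lra.
  have [r /[!in_itv]/= /andP[r1 r2]] := rat_in_itvoo e84.
  have r0 : 0 < ratr r :> R by apply: lt_trans r1; rewrite divr_gt0.
  have fr : f t - ratr r < f t + ratr r by lra.
  have gr : g t - ratr r < g t + ratr r by lra.
  have [a /[!in_itv]/= /andP[a1 a2]] := rat_in_itvoo fr.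
  have [b /[!in_itv]/= /andP[b1 b2]] := rat_in_itvoo gr.
  exists (a, b, r) => //; rewrite ifT; last first.
    apply/asboolP => u v /=; rewrite !ltr_distl => /andP[u1 u2] /andP[v1 v2].
    apply: eA; apply: (le_lt_trans (normc_le_ReIm _)) => /=.
    have : `|f t - u| < 2 * ratr r by rewrite ltr_distl; apply/andP; split; lra.
    have : `|g t - v| < 2 * ratr r by rewrite ltr_distl; apply/andP; split; lra.
    by lra.
  by split => /=; rewrite ltr_distl; apply/andP; split; lra.
apply: countable_bigcupT_measurable => // q; case: ifP => // _.
have -> : box q = (f @^-1` ball (ratr q.1.1 : R) (ratr q.2))
   `&` (g @^-1` ball (ratr q.1.2 : R) (ratr q.2)).
  by apply/seteqP; split => t /=; rewrite /box /ball /= !(distrC (ratr _)).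
by apply: measurableI; rewrite -[X in measurable X]setTI; [apply: mf|apply: mg] => //;
   exact: measurable_ball.
Qed.

Lemma measurable_funMC d (T : measurableType d) (f g : T -> R[i]) :
  measurable_fun setT f -> measurable_fun setT g ->
  measurable_fun setT (fun t => f t * g t).
Proof.
move=> mf mg.
have mRe (h : T -> R[i]) : measurable_fun setT h -> measurable_fun setT (fun t : T => Re (h t)).
  by move=> mh; exact: (measurableT_comp measurable_Re mh).
have mIm (h : T -> R[i]) : measurable_fun setT h -> measurable_fun setT (fun t : T => Im (h t)).
  by move=> mh; exact: (measurableT_comp measurable_Im mh).
rewrite (_ : (fun t => _) = fun t => Complex
  (Re (f t) * Re (g t) - Im (f t) * Im (g t))
  (Re (f t) * Im (g t) + Im (f t) * Re (g t))); last first.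
  by apply/funext => t; case: (f t) (g t) => a b [c e].
apply: measurable_fun_Complex.
  by apply: measurable_funB; apply: measurable_funM; auto.
by apply: measurable_funD; apply: measurable_funM; auto.
Qed.

Lemma measurable_prodC d (T : measurableType d) (I : eqType) (s : seq I)
    (f : I -> T -> R[i]) :
  {in s, forall i, measurable_fun setT (f i)} ->
  measurable_fun setT (fun t => \prod_(i <- s) f i t).
Proof.
elim: s => [|i s IH] mf.
  rewrite (_ : (fun t => _) = cst 1); first exact: measurable_cst.
  by apply/funext => t; rewrite big_nil.
rewrite (_ : (fun t => _) = fun t => f i t * \prod_(j <- s) f j t).
  apply: measurable_funMC; first exact/mf/mem_head.
  by apply: IH => j js; apply: mf; rewrite inE js orbT.
by apply/funext => t; rewrite big_cons.
Qed.

End ComplexTopology.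

(** * Polar coordinates and measurable roots *)

Section Polar.
Variable R : realType.
Implicit Types (z t : R[i]) (x y : R).

Definition cis x : R[i] := Complex (cos x) (sin x).

Lemma cisD x y : cis (x + y) = cis x * cis y.
Proof. by rewrite /cis cosD sinD [_ + cos x * _]addrC. Qed.

Lemma normc_cis x : normc (cis x) = 1.
Proof. by rewrite /= cos2Dsin2 sqrtr1. Qed.

Lemma cis_expn x n : cis x ^+ n = cis (x * n%:R).
Proof.
elim: n => [|n IH]; first by rewrite expr0 mulr0 /cis cos0 sin0.
by rewrite exprS IH -cisD -natr1 mulrDr mulr1 addrC.
Qed.

Lemma cis_periodic x n : cis (x + 2 * pi * n%:R) = cis x.
Proof.
rewrite /cis; have -> : 2 * pi * n%:R = (pi *+ 2 : R) *+ n.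
  by rewrite !mulr_natr mulr_natl.
by rewrite (periodicn (@cosD2pi R)) (periodicn (@sinD2pi R)).
Qed.

Lemma cos_eq1 x : 0 <= x < 2 * pi -> cos x = 1 -> x = 0.
Proof.
move=> /andP[x0 x2] cx; have p0 := pi_gt0 R.
have [xp|xp] := leP x pi.
  by apply: (@cos_inj R); rewrite ?in_itv /= ?x0 ?lexx ?pi_ge0 // cos0.
have : 2 * pi - x = 0.
  apply: (@cos_inj R); rewrite ?in_itv /= ?lexx ?pi_ge0 //.
    by apply/andP; split; lra.
  by rewrite cos0 cosB mulr_natl cos2pi sin2pi mul0r mul1r addr0.
by lra.
Qed.

Lemma cis_inj x y : 0 <= x < 2 * pi -> 0 <= y < 2 * pi -> cis x = cis y -> x = y.
Proof.
wlog yx : x y / y <= x.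
  by move=> H hx hy E; case: (leP y x) => [|/ltW] h; [|apply/esym]; apply: H.
move=> /andP[x0 x2] /andP[y0 y2] [cxy sxy].
apply/eqP; rewrite -subr_eq0; apply/eqP/cos_eq1; first by apply/andP; split; lra.
by rewrite cosB cxy sxy -!expr2 cos2Dsin2.
Qed.

(** The determination of the argument from 0 to 2 pi, with 2 pi excluded. *)
Definition argc z : R :=
  let a := acos (Re z / normc z) in if 0 <= Im z then a else 2 * pi - a.

Lemma normc_sqr z : normc z ^+ 2 = Re z ^+ 2 + Im z ^+ 2.
Proof. by case: z => a b; rewrite sqr_sqrtr // addr_ge0 // sqr_ge0. Qed.

Lemma Re_div_normc z : -1 <= Re z / normc z <= 1.
Proof.
have [->|z0] := eqVneq z 0; first by rewrite mul0r; apply/andP; split; lra.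
have n0 : 0 < normc z by rewrite normc_gt0.
rewrite ler_pdivlMr // ler_pdivrMr // mulN1r mul1r -ler_norml; exact: normc_Re.
Qed.

Lemma argc_itv z : 0 <= argc z < 2 * pi.
Proof.
have p0 := pi_gt0 R; rewrite /argc; set u := _ / _.
have u1 : -1 <= u <= 1 := Re_div_normc z.
have := acos_ge0 u1; have := acos_lepi u1.
case: (leP 0 (Im z)) => zi; first by move=> ? ?; apply/andP; split; lra.
have : 0 < acos u.
  apply: acos_gt0; case/andP: u1 => -> u1 /=; rewrite lt_neqAle u1 andbT.
  apply/eqP => E; have n0 : 0 < normc z.
    by rewrite normc_gt0; apply: contraTneq zi => ->; rewrite ltxx.
  have RN : Re z = normc z by rewrite -[RHS]mul1r -E /u divfK // gt_eqF.
  have := normc_sqr z; rewrite RN => /eqP; rewrite -subr_eq0 opprD addNKr oppr_eq0.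
  by rewrite sqrf_eq0 lt_eqF.
by move=> ? ? ?; apply/andP; split; lra.
Qed.

Lemma polarE z : z != 0 -> z = (normc z)%:C%C * cis (argc z).
Proof.
move=> z0; have n0 : 0 < normc z by rewrite normc_gt0.
have nn : normc z != 0 by rewrite gt_eqF.
set u := Re z / normc z.
have u1 : -1 <= u <= 1 := Re_div_normc z.
have ca : cos (acos u) = u by apply: acosK; rewrite in_itv.
have sa : sin (acos u) = `|Im z| / normc z.
  rewrite sin_acos // -[RHS]ger0_norm; last by rewrite divr_ge0 // ltW.
  rewrite -sqrtr_sqr; congr Num.sqrt.
  rewrite /u !expr_div_n real_normK ?num_real // normc_sqr.
  have h : Re z ^+ 2 + Im z ^+ 2 != 0 by rewrite -normc_sqr expf_neq0.
  by field.
have cisE : cis (argc z) = Complex u (Im z / normc z).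
  rewrite /argc -/u; case: leP => zi.
    by rewrite /cis ca sa ger0_norm.
  rewrite /cis cosB sinB mulr_natl cos2pi sin2pi ca sa ltr0_norm //.
  by congr Complex; ring.
rewrite cisE; case: z z0 n0 nn @u u1 ca sa cisE => a b z0 n0 nn u u1 ca sa cisE.
apply/eqP; rewrite eq_complex /= !mul0r subr0 addr0 /u /=.
by rewrite [X in _ == X * _]/=; apply/andP; split; apply/eqP; field.
Qed.

(* acos is continuous inside its interval of definition; made constant on each
   side of it, it is measurable on the whole line. *)
Let acos_clip x := if -1 < x < 1 then acos x else if x <= -1 then pi else 0 : R.

Let measurable_acos_clip : measurable_fun setT acos_clip.
Proof.
apply: measurable_fun_if => //.
- by apply: measurable_and; apply: measurable_fun_ltr.
- rewrite setTI (_ : _ @^-1` _ = `]-1, 1[%classic); last first.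
    by apply/seteqP; split => x /=; rewrite in_itv /=.
  apply: open_continuous_measurable_fun; first exact: interval_open.
  by move=> x; rewrite inE /= in_itv /=; exact: continuous_acos.
- apply: measurable_funTS; apply: measurable_fun_ifT => //.
  exact: measurable_fun_ler.
Qed.

Lemma measurable_argc : measurable_fun setT argc.
Proof.
have mu : measurable_fun setT (fun z : R[i] => Re z / normc z).
  (* The inverse of the modulus is written with exp and ln, which are measurable;
     both forms vanish at 0, after multiplication by the real part. *)
  rewrite (_ : (fun z => _) = fun z : R[i] => Re z * expR (- ln (normc z))).
    apply: measurable_funM; first exact: measurable_Re.
    apply: (measurableT_comp (@measurable_expR R)).
    apply: measurableT_comp => //.
    by apply: (measurableT_comp (@measurable_ln R)); exact: measurable_normc.
  apply/funext => z; have [->|z0] := eqVneq z 0; first by rewrite !mul0r.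
  by rewrite expRN lnK // posrE normc_gt0.
have ma : measurable_fun setT (fun z : R[i] => acos (Re z / normc z)).
  rewrite (_ : (fun z => _) = fun z : R[i] => acos_clip (Re z / normc z)).
    exact: (measurableT_comp measurable_acos_clip mu).
  apply/funext => z; rewrite /acos_clip; case: ifPn => // h.
  have /andP[u1 u2] := Re_div_normc z; case: leP => u3.
    by rewrite (_ : _ / _ = -1) ?acosN1 //; apply/le_anti; rewrite u3 u1.
  by rewrite (_ : _ / _ = 1) ?acos1 //; apply/le_anti; move: h; rewrite u2 u3 /= -leNgt.
apply: measurable_fun_ifT => //.
  by apply: measurable_fun_ler => //; exact: measurable_Im.
exact: measurable_funB.
Qed.

(** The [k]-th roots of [t], enumerated by increasing argument so that each is a
measurable function of [t]. *)
Definition croot (k : nat) (j : nat) t : R[i] :=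
  (expR (ln (normc t) / k%:R))%:C%C * cis ((argc t + 2 * pi * j%:R) / k%:R).

Lemma normc_croot k j t : normc (croot k j t) = expR (ln (normc t) / k%:R).
Proof.
rewrite /croot Normc.normcM normc_cis mulr1 /= expr0n addr0 sqrtr_sqr.
by rewrite ger0_norm ?expR_ge0.
Qed.

Lemma croot_expn k j t : (0 < k)%N -> t != 0 -> croot k j t ^+ k = t.
Proof.
move=> k0 t0; have kn : k%:R != 0 :> R by rewrite pnatr_eq0 -lt0n.
rewrite /croot exprMn cis_expn divfK // cis_periodic -rmorphXn /=.
by rewrite -expRM_natr divfK // lnK ?posrE ?normc_gt0 // -polarE.
Qed.

(** The [k] arguments fall one by one in [k] consecutive arcs of equal length,
whatever the argument of [t]; this is what makes sums over the roots Riemann sums. *)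
Lemma croot_angle k j t : (j < k)%N ->
  2 * pi * (j%:R / k%:R) <= (argc t + 2 * pi * j%:R) / k%:R < 2 * pi * (j.+1%:R / k%:R).
Proof.
move=> jk; have k0 : 0 < k%:R :> R by rewrite ltr0n (leq_ltn_trans _ jk).
have /andP[a0 a2] := argc_itv t.
rewrite !mulrA ler_pM2r ?invr_gt0 // ltr_pM2r ?invr_gt0 //.
by rewrite lerDr a0 -[j.+1%:R]natr1 (mulrDr (2 * pi)) mulr1 addrC ltrD2l.
Qed.

Lemma croot_inj k t : t != 0 -> {in [pred j | (j < k)%N] &, injective (fun j => croot k j t)}.
Proof.
move=> t0 i j; rewrite !inE => ik jk E.
have k0 : 0 < k%:R :> R by rewrite ltr0n (leq_ltn_trans _ ik).
have e0 : (expR (ln (normc t) / k%:R))%:C%C != 0 :> R[i].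
  by rewrite fmorph_eq0 gt_eqF // expR_gt0.
have itv l : (l < k)%N -> 0 <= (argc t + 2 * pi * l%:R) / k%:R < 2 * pi.
  move=> lk; have /andP[h1 h2] := croot_angle t lk; have p0 := pi_gt0 R.
  rewrite (le_trans _ h1) ?(lt_le_trans h2) //.
    by rewrite ler_piMr ?mulr_ge0 ?pi_ge0 // ler_pdivrMr // mul1r ler_nat.
  by rewrite mulr_ge0 ?divr_ge0 // mulr_ge0 ?pi_ge0.
have := cis_inj (itv _ ik) (itv _ jk) (mulfI e0 E).
move=> /(mulIf (invr_neq0 (lt0r_neq0 k0))) /addrI.
have p2 : 2 * pi != 0 :> R by rewrite mulf_neq0 // gt_eqF // pi_gt0.
by move=> /(mulfI p2) /eqP; rewrite eqr_nat => /eqP.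
Qed.

Lemma XnsubC_croot k t : (0 < k)%N -> t != 0 ->
  'X^k - t%:P = \prod_(j <- iota 0 k) ('X - (croot k j t)%:P).
Proof.
move=> k0 t0.
rewrite -[RHS](big_map (fun j => croot k j t) xpredT (fun z => 'X - z%:P)).
rewrite [LHS](@all_roots_prod_XsubC _ _ [seq croot k j t | j <- iota 0 k]).
- by rewrite lead_coefDl ?size_polyXn ?size_polyN ?(leq_ltn_trans (size_polyC_leq1 _)) // lead_coefXn scale1r.
- by rewrite size_map size_iota size_XnsubC.
- apply/allP => _ /mapP[j _ ->].
  by rewrite rootE !hornerE croot_expn // subrr.
- rewrite uniq_rootsE map_inj_in_uniq ?iota_uniq // => i j.
  by rewrite !mem_iota /= add0n; exact: croot_inj.
Qed.

Lemma expn_eq_croot k t : (0 < k)%N -> t != 0 ->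
  [set z : R[i] | z ^+ k = t] = [set` [seq croot k j t | j <- iota 0 k]].
Proof.
move=> k0 t0; apply/seteqP; split => z /=; last by move=> /mapP[j _ ->]; rewrite croot_expn.
move=> zk; have : root ('X^k - t%:P) z by rewrite rootE !hornerE zk subrr.
rewrite XnsubC_croot // -(big_map (fun j => croot k j t) xpredT (fun z => 'X - z%:P)).
by rewrite root_prod_XsubC.
Qed.

Lemma measurable_croot k j : measurable_fun setT (croot k j).
Proof.
have me : measurable_fun setT (fun t : R[i] => expR (ln (normc t) / k%:R)).
  apply: (measurableT_comp (@measurable_expR R)).
  apply: measurable_funM => //.
  by apply: (measurableT_comp (@measurable_ln R)); exact: measurable_normc.
have ma : measurable_fun setT (fun t : R[i] => (argc t + 2 * pi * j%:R) / k%:R).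
  apply: measurable_funM => //; apply: measurable_funD => //.
  exact: measurable_argc.
apply: measurable_funMC; first exact: measurable_fun_Complex.
apply: measurable_fun_Complex.
  apply: (measurableT_comp _ ma); apply: continuous_measurable_fun.
  exact: continuous_cos.
apply: (measurableT_comp _ ma); apply: continuous_measurable_fun.
exact: continuous_sin.
Qed.

HB.instance Definition _ k j :=
  isMeasurableFun.Build _ _ _ _ (croot k j) (measurable_croot k j).

End Polar.

(** * Products of independent variables *)

Section RectangleUniqueness.
Local Open Scope ereal_scope.
Context d1 d2 (T1 : measurableType d1) (T2 : measurableType d2) (R : realType).

(** Rectangles form a pi-system that generates the product sigma-algebra. *)
Lemma measure_eq_rectangles (m1 m2 : {measure set (T1 * T2) -> \bar R}) :
  m1 setT < +oo ->
  (forall A B, measurable A -> measurable B -> m1 (A `*` B) = m2 (A `*` B)) ->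
  forall X, measurable X -> m1 X = m2 X.
Proof.
move=> m1oo m12.
pose C : set (set (T1 * T2)) :=
  [set C | exists A, measurable A /\ exists B, measurable B /\ C = A `*` B].
apply: (measure_unique C (fun=> setT)) => //.
- rewrite measurable_prod_measurableType //; congr (<<s _ >>).
  rewrite predeqE; split => [[A mA [B mB <-]]|[A [mA [B [mB ->]]]]].
    by exists A; split => //; exists B.
  by exists A => //; exists B.
- move=> /= _ _ [X1 [mX1 [X2 [mX2 ->]]]] [Y1 [mY1 [Y2 [mY2 ->]]]].
  rewrite -setXI; exists (X1 `&` Y1); split; first exact: measurableI.
  by exists (X2 `&` Y2); split => //; exact: measurableI.
- by move=> _; exists setT; split => //; exists setT; rewrite setXTT.
- by apply: bigcup_const; exists 0%N.
- by move=> A [A1 [mA1 [A2 [mA2 ->]]]]; exact: m12.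
Qed.

End RectangleUniqueness.

Section ImageMeasure.
Local Open Scope ereal_scope.
Context d d' (T : measurableType d) (T' : measurableType d') (R : realType).
Variables (m : {measure set T -> \bar R}) (X : {mfun T >-> T'}).

Definition image_measure : set T' -> \bar R := pushforward m X.

Let image_measure0 : image_measure set0 = 0.
Proof. exact: measure0. Qed.

Let image_measure_ge0 A : 0 <= image_measure A.
Proof. exact: measure_ge0. Qed.

Let image_measure_sigma_additive : semi_sigma_additive image_measure.
Proof. exact: measure_semi_sigma_additive. Qed.

HB.instance Definition _ := isMeasure.Build _ _ _ image_measure
  image_measure0 image_measure_ge0 image_measure_sigma_additive.

End ImageMeasure.

Section ProductLaw.
Variable R : realType.
Local Open Scope ereal_scope.

Definition mulC2 (u : R[i] * R[i]) : R[i] := (u.1 * u.2)%R.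

Lemma measurable_mulC2 : measurable_fun setT mulC2.
Proof. by apply: measurable_funMC. Qed.

HB.instance Definition _ := isMeasurableFun.Build _ _ _ _ mulC2 measurable_mulC2.

Fixpoint product_law (L : probability R[i] R) (k : nat) : probability R[i] R :=
  if k is k'.+1 then
    distribution (L \x product_law L k' : probability (R[i] * R[i])%type R) mulC2
  else dirac (1%R : R[i]).

Context d (Omega : measurableType d) (P : probability Omega R).

(** Independence is given for sigma-algebras indexed by [I], and the product of
the [z i] has to be handled jointly with events of other indices, such as the value
of the permutation or of a Poisson variable.  By induction on [l]: the joint law of
[z j] and of the remaining product, restricted to the event of indices in [s], is
identified with a multiple of the product measure on rectangles, where the
condition on [z j] joins the event. *)
Lemma independent_prod_law (I : choiceType) (D : set I) F (L : probability R[i] R)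
    (z : I -> Omega -> R[i]) :
  independent_systems P D F ->
  forall (l s : seq I) (E : I -> set Omega) A,
    uniq (l ++ s) ->
    (forall i, i \in l -> [/\ D i, measurable_fun setT (z i), has_law P (z i) L &
        forall B, measurable B -> F i (z i @^-1` B)]) ->
    (forall i, i \in s -> [/\ D i, F i (E i) & measurable (E i)]) ->
    measurable A ->
  P (\bigcap_(i in [set i | i \in s]) E i `&` (fun w => \prod_(i <- l) z i w)%R @^-1` A)
  = P (\bigcap_(i in [set i | i \in s]) E i) * product_law L (size l) A.
Proof.
move=> indep; elim=> [|j l IH] s E A /=.
  move=> _ _ _ mA; rewrite /= diracE.
  have [A1|A1] := boolP (1%R \in A).
    rewrite mule1; congr (P _); apply/seteqP; split => w /=; first by case.
    by move=> Ew; split => //; rewrite big_nil; apply/set_mem.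
  rewrite mule0 (_ : _ `&` _ = set0) ?measure0 //.
  rewrite -subset0 => w /= -[_]; rewrite big_nil => /mem_set.
  by rewrite (negbTE A1).
move=> /andP[jls uls] hl hs mA.
have [Dj mzj zjL Fj] := hl j (mem_head _ _).
have hl' i : i \in l -> [/\ D i, measurable_fun setT (z i), has_law P (z i) L &
        forall B, measurable B -> F i (z i @^-1` B)].
  by move=> il; apply: hl; rewrite inE il orbT.
set S := \bigcap_(i in _) E i.
have mS : measurable S.
  apply: fin_bigcap_measurable; first exact: finite_seq.
  by move=> i /hs[].
have PS : P S = \prod_(i <- s) P (E i).
  apply: indep; first by move: uls; rewrite cat_uniq => /and3P[].
  by move=> i /hs[].
have mzl : measurable_fun setT (fun w => \prod_(i <- l) z i w)%R.
  by apply: measurable_prodC => i /hl'[].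
have mX : measurable_fun setT (fun w => (z j w, \prod_(i <- l) z i w)%R).
  exact: measurable_fun_pair.
pose X : {mfun Omega >-> (R[i] * R[i])%type} :=
  HB.pack (fun w => (z j w, \prod_(i <- l) z i w)%R) (isMeasurableFun.Build _ _ _ _ _ mX).
pose m2 : {measure set (R[i] * R[i])%type -> \bar R} :=
  image_measure (mrestr P mS) X.
have PS0 : (0 <= fine (P S))%R by rewrite fine_ge0.
have PSE : (fine (P S))%:E = P S by rewrite fineK // fin_num_measure.
pose m1 : {measure set (R[i] * R[i])%type -> \bar R} :=
  mscale (NngNum PS0) (L \x product_law L (size l)).
have m1E B : m1 B = P S * (L \x product_law L (size l)) B.
  by rewrite /m1 /= /mscale /= PSE.
have m2E B : m2 B = P (X @^-1` B `&` S) by [].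
have m12 : forall B, measurable B -> m1 B = m2 B.
  apply: measure_eq_rectangles.
    by rewrite m1E probability_setT mule1 -PSE ltry.
  move=> A1 A2 mA1 mA2; rewrite m1E m2E product_measure1E //.
  (* The condition on z j is added to the events, at the index j. *)
  pose E' i := if i == j then z j @^-1` A1 else E i.
  have jNs : j \notin s by apply: contra jls => js; rewrite mem_cat js orbT.
  have E's i : i \in s -> E' i = E i.
    by move=> si; rewrite /E' ifN //; apply: contraNneq jNs => <-.
  have E'S : \bigcap_(i in [set i | i \in j :: s]) E' i = z j @^-1` A1 `&` S.
    apply/seteqP; split => w /=.
      move=> Ew; split; first by have := Ew j; rewrite /E' eqxx; apply; rewrite /= mem_head.
      by move=> i /= si; rewrite -E's //; apply: Ew; rewrite /= inE si orbT.
    move=> [w1 Sw] i /=; rewrite inE => /orP[/eqP ->|si]; first by rewrite /E' eqxx.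
    by rewrite E's //; exact: Sw.
  have E'ok i : i \in j :: s -> [/\ D i, F i (E' i) & measurable (E' i)].
    rewrite inE => /orP[/eqP ->|si]; last by rewrite E's //; exact: hs.
    rewrite /E' eqxx; split => //; first exact: Fj.
    by rewrite -[X in measurable X]setTI; exact: mzj.
  have PE' : P (z j @^-1` A1 `&` S) = L A1 * P S.
    rewrite -E'S indep; last first.
    - by move=> i /E'ok[].
    - by rewrite /= jNs; move: uls; rewrite cat_uniq => /and3P[].
    rewrite big_cons {1}/E' eqxx zjL // PS; congr (_ * _).
    by rewrite big_seq [RHS]big_seq; apply: eq_bigr => i /E's ->.
  have -> : X @^-1` (A1 `*` A2) `&` S =
      \bigcap_(i in [set i | i \in j :: s]) E' i `&`
        (fun w => \prod_(i <- l) z i w)%R @^-1` A2.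
    rewrite E'S; apply/seteqP; split => w /=; first by move=> [[]].
    by move=> [[]].
  rewrite (IH (j :: s)) //; last first.
    move: jls uls; rewrite mem_cat !cat_uniq /= jNs.
    by move=> /norP[jl _] /and3P[-> hls ->]; rewrite negb_or jl hls.
  by rewrite E'S PE' muleA [P S * _]muleC.
transitivity (m2 (mulC2 @^-1` A)).
  rewrite m2E; congr (P _); apply/seteqP; split => w /=.
    by move=> [Sw]; rewrite big_cons.
  by move=> [Aw Sw]; split => //; rewrite big_cons.
by rewrite -m12 ?m1E // -[X in measurable X]setTI; exact: measurable_mulC2.
Qed.

End ProductLaw.

(** * The spectral measure of a monomial matrix *)

Section SpectralMeasure.
Variable R : realType.
Local Open Scope ereal_scope.

Lemma spectral_measure_roots N (M : 'M[R[i]]_N) (rs : seq R[i]) (A : set R[i]) :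
  char_poly M = (\prod_(l <- rs) ('X - l%:P))%R ->
  spectral_measure M A = \sum_(l <- rs) (\d_l A : \bar R).
Proof.
move=> cM; rewrite /spectral_measure.
have -> : [set l | eigenvalue M l] = [set` undup rs].
  apply/seteqP; split => l /=; rewrite eigenvalue_root_char cM root_prod_XsubC;
    by rewrite -(mem_undup rs).
rewrite -fsbig_seq ?undup_uniq //.
rewrite -[RHS](@big_undup_iterop_count _ _ _ _ rs xpredT); apply: eq_bigr => l _.
by rewrite cM mu_prod_XsubC mule_natl.
Qed.

(** Since the law [L] does not charge 0, the permutation of the random matrix can
almost surely be read off the positions of its nonzero entries. *)
Definition monomial_support N (t : 'S_N) : set 'M[R[i]]_N :=
  [set M : 'M[R[i]]_N | forall j k, ((M j k != 0) = (j == t k))%R].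

Definition cycle_product N (t : 'S_N) (C : {set 'I_N}) (M : 'M[R[i]]_N) : R[i] :=
  (\prod_(j in C) M j ((t^-1)%g j))%R.

(** Each cycle contributes the roots of [X ^ #|C| - c], where [c] is the product of
the entries carried by the cycle. *)
Lemma spectral_measure_monomial N (t : 'S_N) (M : 'M[R[i]]_N) A :
  monomial_support t M ->
  spectral_measure M A = \sum_(C in porbits t) \sum_(i < #|C|)
    (\d_(croot #|C| i (cycle_product t C M)) A : \bar R).
Proof.
move=> Mt.
have -> : \sum_(C in porbits t) \sum_(i < #|C|)
    (\d_(croot #|C| i (cycle_product t C M)) A : \bar R) =
  \sum_(l <- flatten [seq [seq croot #|C| i (cycle_product t C M) | i <- iota 0 #|C|]
     | C : {set 'I_N} <- enum (porbits t)]) (\d_l A : \bar R).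
  rewrite big_flatten big_map big_enum /=; apply: eq_bigr => C _.
  by rewrite big_map -[X in iota _ X]subn0 big_mkord.
apply: spectral_measure_roots.
have ME : M = \matrix_(j, k) (if j == t k then M j ((t^-1)%g j) else (0 : R[i])%R).
  apply/matrixP => j k; rewrite mxE; case: ifPn => [/eqP ->|jk]; first by rewrite permK.
  by apply/eqP; move: (Mt j k); rewrite (negbTE jk) => /negbFE.
rewrite {1}ME char_poly_monomial big_flatten big_map big_enum /=; apply: eq_bigr => C Ct.
rewrite big_map -XnsubC_croot //.
  by case/imsetP: Ct => x _ ->; rewrite lt0n card_porbit_neq0.
by apply/prodf_neq0 => j _; rewrite Mt permKV.
Qed.

Lemma measurable_matrix_coord N (j k : 'I_N) :
  measurable_fun setT (fun M : 'M[R[i]]_N => M j k).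
Proof.
move=> _ A mA; apply: sub_sigma_algebra; exists (j, k) => //=.
by exists A.
Qed.

Lemma measurable_cycle_product N (t : 'S_N) (C : {set 'I_N}) :
  measurable_fun setT (@cycle_product N t C).
Proof.
rewrite /cycle_product (_ : (fun M => _) =
    fun M : 'M[R[i]]_N => \prod_(j <- enum C) M j ((t^-1)%g j))%R; last first.
  by apply/funext => M; rewrite big_enum.
apply: (@measurable_prodC _ _ _ _ _ (fun j (M : 'M[R[i]]_N) => M j ((t^-1)%g j))) => j _.
exact: measurable_matrix_coord.
Qed.

Lemma measurable_neq0C : measurable [set z : R[i] | (z != 0)%R].
Proof.
rewrite (_ : [set _ | _] = (@normc R) @^-1` `]0%R, +oo[%classic); last first.
  by apply/seteqP; split => z /=; rewrite in_itv /= andbT normc_gt0.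
by rewrite -[X in measurable X]setTI; apply: (@measurable_normc R).
Qed.

Lemma measurable_set0C : measurable [set (0 : R[i])%R].
Proof.
rewrite -[X in measurable X]setCK; apply: measurableC.
rewrite (_ : ~` _ = [set z | (z != 0)%R]); first exact: measurable_neq0C.
by apply/seteqP; split => u /= /eqP.
Qed.

Lemma measurable_monomial_support N (t : 'S_N) : measurable (monomial_support t).
Proof.
rewrite (_ : monomial_support t = \bigcap_(jk in [set: 'I_N * 'I_N])
   ((fun M : 'M[R[i]]_N => M jk.1 jk.2) @^-1`
     (if jk.1 == t jk.2 then [set z : R[i] | (z != 0)%R] else ~` [set z | (z != 0)%R]))); last first.
  apply/seteqP; split => M /=.
    move=> Mt [j k] _ /=; have := Mt j k; case: ifP => _ //= E.
    by rewrite E.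
  move=> Mt j k; have := Mt (j, k) I; rewrite /=; case: ifP => _ //= h.
  by apply/negbTE/negP.
apply: fin_bigcap_measurable; first exact: finite_finset.
move=> [j k] _ /=; rewrite -[X in measurable X]setTI.
apply: (measurable_matrix_coord j k) => //; case: ifP => _; first exact: measurable_neq0C.
by apply: measurableC; exact: measurable_neq0C.
Qed.

Lemma monomial_support_inj N (s t : 'S_N) (M : 'M[R[i]]_N) :
  monomial_support s M -> monomial_support t M -> s = t.
Proof.
move=> sM tM; apply/permP => k; apply/eqP.
by rewrite -(tM (s k) k) (sM (s k) k).
Qed.

End SpectralMeasure.

Section NonmeasurableIntegral.
Import HBNNSimple.
Local Open Scope ereal_scope.
Context d (T : measurableType d) (R : realType) (mu : {measure set T -> \bar R}).

(** The integral of a nonnegative function is a supremum over simple functions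
below it, and such a simple function can be put to 0 on [N] without changing its
integral.  The functions [f] and [g] need not be measurable, which is
essential as nothing is known on the spectral measure of a non-monomial matrix. *)
Lemma ge0_integral_eq_off (N : set T) (f g : T -> \bar R) :
  measurable N -> mu N = 0 -> (forall x, 0 <= f x) -> (forall x, 0 <= g x) ->
  (forall x, ~ N x -> f x = g x) -> \int[mu]_x f x = \int[mu]_x g x.
Proof.
move=> mN N0.
suff le u v : (forall x, 0 <= u x) -> (forall x, 0 <= v x) ->
    (forall x, ~ N x -> u x = v x) -> \int[mu]_x u x <= \int[mu]_x v x.
  by move=> f0 g0 fg; apply/le_anti; rewrite !le // => x /fg.
move: u v => {}f {}g f0 g0 fg; rewrite ge0_integralTE //.
apply: ge_ereal_sup => _ [h hf <-].
have mNc : measurable (~` N) by exact: measurableC.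
rewrite -integralT_nnsfun.
have -> : \int[mu]_x (h x)%:E = \int[mu]_x (proj_nnsfun h mNc x)%:E.
  apply: ge0_ae_eq_integral => //.
  - by apply/measurable_EFinP.
  - by apply/measurable_EFinP.
  - by move=> x _; rewrite lee_fin.
  - by move=> x _; rewrite lee_fin.
  exists N; split => // x /= /not_implyP[_] hx; apply: contrapT => Nx; apply: hx.
  by rewrite mindicE mem_set // mulr1.
rewrite integralT_nnsfun ge0_integralTE //; apply: ereal_sup_ubound.
exists (proj_nnsfun h mNc) => // x /=.
rewrite mindicE; have [/set_mem xN|_] := boolP (x \in ~` N).
  by rewrite mulr1 -fg.
by rewrite mulr0.
Qed.

End NonmeasurableIntegral.

(** * The mean spectral measure *)

Section SumIntegral.
Local Open Scope ereal_scope.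
Context d (T : measurableType d) (R : realType) (mu : {measure set T -> \bar R}).

Lemma emeasurable_sum_cond (I : Type) (s : seq I) (p : pred I) (f : I -> T -> \bar R) :
  (forall i, p i -> measurable_fun setT (f i)) ->
  measurable_fun setT (fun x => \sum_(i <- s | p i) f i x).
Proof.
move=> mf; rewrite (_ : (fun x => _) =
    fun x => \sum_(i <- s) (if p i then f i else cst 0) x).
  by apply: emeasurable_sum => i; case: ifPn => // /mf.
by apply/funext => x; rewrite big_mkcond; apply: eq_bigr => i _; case: ifP.
Qed.

Lemma ge0_integral_sum_cond (I : Type) (s : seq I) (p : pred I) (f : I -> T -> \bar R) :
  (forall i, p i -> measurable_fun setT (f i)) ->
  (forall i x, p i -> 0 <= f i x) ->
  \int[mu]_x (\sum_(i <- s | p i) f i x) = \sum_(i <- s | p i) \int[mu]_x f i x.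
Proof.
move=> mf f0; pose g i := if p i then f i else cst 0.
under eq_integral do rewrite big_mkcond /=.
rewrite [RHS]big_mkcond /=.
transitivity (\sum_(i <- s) \int[mu]_x g i x); last first.
  by apply: eq_bigr => i _; rewrite /g; case: ifP => // _; rewrite integral0.
rewrite -ge0_integral_sum //.
- by apply: eq_integral => x _; apply: eq_bigr => i _; rewrite /g; case: ifP.
- by move=> i; rewrite /g; case: ifPn => // pi; exact: mf.
- by move=> i x _; rewrite /g; case: ifPn => // pi; exact: f0.
Qed.

End SumIntegral.

Section RootMeasure.
Local Open Scope ereal_scope.
Variables (R : realType) (L : probability R[i] R).

(** The expected number of [k]-th roots of a product of [k] independent variables
of law [L] in a set. *)
Definition root_measure (k : nat) : {measure set R[i] -> \bar R} :=
  msum (fun j => distribution (product_law L k) (@croot R k j)) k.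

Lemma root_measureE k A :
  root_measure k A = \sum_(j < k) product_law L k (@croot R k j @^-1` A).
Proof. by []. Qed.

Lemma root_measureT k : root_measure k setT = k%:R%:E.
Proof.
rewrite root_measureE; under eq_bigr do rewrite preimage_setT probability_setT.
by rewrite sumEFin sumr_const card_ord.
Qed.

Lemma root_measure_fin_num k A : measurable A -> root_measure k A \is a fin_num.
Proof.
move=> mA; rewrite ge0_fin_numE ?measure_ge0 //.
apply: (@le_lt_trans _ _ (root_measure k setT)); last by rewrite root_measureT ltry.
by apply: le_measure; rewrite ?inE.
Qed.

End RootMeasure.

Section MeanSpectralMeasure.
Local Open Scope ereal_scope.
Variables (R : realType) (theta : R) (L : probability R[i] R).
Hypothesis L0 : L [set 0%R] = 0.

Section Monomial.
Context d' (Omega' : measurableType d') (P' : probability Omega' R) (N : nat).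
Variables (s : Omega' -> 'S_N) (z : 'I_N -> {RV P' >-> R[i]}).
Hypothesis hs : forall t, measurable (s @^-1` [set t]) /\
                P' (s @^-1` [set t]) = (ewens theta t)%:E.
Hypothesis hz : forall j, has_law P' (z j) L.
Hypothesis hind : independent_systems P' setT (ensemble_system s (fun j => z j)).

Let X w : 'M[R[i]]_N := monomial_mx (s w) (fun j => z j w).

Lemma measurable_monomial_fixed t :
  measurable_fun setT (fun w => monomial_mx t (fun j => z j w) : 'M[R[i]]_N).
Proof.
apply: (measurability (@mx_cylinders R N)) => // _ [_ [[j k] _ [A mA <-]] <-].
rewrite !setTI /=.
rewrite (_ : _ @^-1` _ = (fun w => if j == t k then z j w else (0 : R[i])%R) @^-1` A).
  case: (j == t k); last by rewrite -[X in measurable X]setTI; exact: measurable_cst.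
  by rewrite -[X in measurable X]setTI; exact: measurable_funP.
by apply/seteqP; split => w /=; rewrite mxE.
Qed.

(** The permutation takes finitely many values, so it is enough to cut along it. *)
Lemma measurable_monomial : measurable_fun setT (X : Omega' -> 'M[R[i]]_N).
Proof.
move=> _ B mB; rewrite setTI.
rewrite (_ : _ @^-1` _ = \bigcup_(t in [set: 'S_N]) (s @^-1` [set t] `&`
   (fun w => monomial_mx t (fun j => z j w) : 'M[R[i]]_N) @^-1` B)).
  apply: fin_bigcup_measurable; first exact: finite_finset.
  move=> t _; apply: measurableI; first by have [] := hs t.
  by rewrite -[X in measurable X]setTI; exact: measurable_monomial_fixed.
apply/seteqP; split => w /=; first by exists (s w).
by case=> t _ [/= <-].
Qed.

(* Almost sure, since L does not charge 0. *)
Let Nz := [set w | forall j, (z j w != 0)%R].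

Let mNz : measurable Nz.
Proof.
rewrite (_ : Nz = \bigcap_(j in [set: 'I_N]) (z j @^-1` [set z | (z != 0)%R])).
  apply: fin_bigcap_measurable; first exact: finite_finset.
  move=> j _; rewrite -[X in measurable X]setTI; apply: measurable_funP => //.
  exact: measurable_neq0C.
by apply/seteqP; split => w /= h j; [move=> _|]; exact: h.
Qed.

Let P'NzC : P' (~` Nz) = 0.
Proof.
rewrite (_ : ~` Nz = \bigcup_(j in [set: 'I_N]) (z j @^-1` [set 0%R])); last first.
  apply/seteqP; split => w /=.
    by move=> /existsNP[j /negP]; rewrite negbK => /eqP; exists j.
  by case=> j _ /= zj h; have := h j; rewrite zj eqxx.
have m0C := @measurable_set0C R.
have m0 j : measurable (z j @^-1` [set 0%R]).
  by rewrite -[X in measurable X]setTI; apply: measurable_funP.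
(* A finite union is written as a sequence to apply countable subadditivity. *)
pose F n := if insub n is Some j then z j @^-1` [set 0%R] else set0.
have NE : \bigcup_(j in [set: 'I_N]) (z j @^-1` [set 0%R]) = \bigcup_n F n.
  apply/seteqP; split => w [j _]; first by exists (val j) => //; rewrite /F valK.
  by rewrite /F; case: insubP => // i _ _ zi; exists i.
rewrite NE; apply/negligibleP.
  apply: bigcupT_measurable => n; rewrite /F; case: insub => // j; exact: m0.
apply: negligible_bigcup => n; rewrite /F; case: insub => [j|]; last exact: negligible_set0.
by apply/negligibleP; [exact: m0|exact: etrans (hz j m0C) L0].
Qed.

Let P'Nz A : measurable A -> P' A = P' (A `&` Nz).
Proof.
move=> mA; rewrite (@measureDI _ _ _ P' A Nz) // [X in X + _](_ : _ = 0) ?add0e //.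
by apply: (subset_measure0 _ _ _ P'NzC); [exact: measurableD|exact: measurableC|move=> w []].
Qed.

(** Almost surely the event says that the permutation is [t] and that the product
of the variables carried by [C] is in [A]. *)
Lemma monomial_cycle_event t (C : {set 'I_N}) A : measurable A ->
  P' (X @^-1` (monomial_support t `&` (@cycle_product R N t C) @^-1` A))
  = (ewens theta t)%:E * product_law L #|C| A.
Proof.
move=> mA.
have mB : measurable (monomial_support t `&` (@cycle_product R N t C) @^-1` A).
  apply: measurableI; first exact: measurable_monomial_support.
  by rewrite -[X in measurable X]setTI; exact: measurable_cycle_product.
have mst : measurable (s @^-1` [set t]) by have [] := hs t.
pose Q w := (\prod_(j in C) z j w)%R.
have mQ : measurable_fun setT Q.
  rewrite (_ : Q = fun w => \prod_(j <- enum C) z j w)%R.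
    exact: measurable_prodC.
  by apply/funext => w; rewrite big_enum.
have -> : P' (X @^-1` (monomial_support t `&` (@cycle_product R N t C) @^-1` A)) =
    P' (s @^-1` [set t] `&` Q @^-1` A).
  rewrite P'Nz; last by rewrite -[X in measurable X]setTI; exact: measurable_monomial.
  rewrite [RHS]P'Nz; last first.
    by apply: measurableI => //; rewrite -[X in measurable X]setTI; exact: mQ.
  have supp w : Nz w -> monomial_support (s w) (X w).
    by move=> Nw j k; rewrite mxE; case: ifP => //; rewrite ?eqxx // => _; exact: Nw.
  have cp w : s w = t -> cycle_product t C (X w) = Q w.
    by move=> swt; apply: eq_bigr => j _; rewrite mxE swt permKV eqxx.
  congr (P' _); apply/seteqP; split => w /= [[h1 h2] Nw]; split => //; split => //.
  - by apply: monomial_support_inj (supp w Nw) h1.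
  - by rewrite /= -cp //; apply: monomial_support_inj (supp w Nw) h1.
  - by rewrite -h1; exact: supp.
  - by rewrite /= cp.
(* The permutation has index None; its event is kept aside while the product runs
   over the indices Some j. *)
pose z' (o : option 'I_N) := if o is Some j then z j : Omega' -> R[i] else cst 0%R.
have := @independent_prod_law R _ _ P' (option 'I_N) setT _ L z' hind
  [seq Some j | j <- enum C] [:: None] (fun=> s @^-1` [set t]) A.
rewrite size_map -cardE.
have -> : \bigcap_(i in [set i | i \in [:: None : option 'I_N]]) s @^-1` [set t] = s @^-1` [set t].
  by apply/seteqP; split => w /=; [move=> /(_ None); apply; rewrite /= inE | move=> ? ? _].
have -> : (fun w => \prod_(i <- [seq Some j | j <- enum C]) z' i w)%R = Q.
  by apply/funext => w; rewrite big_map big_enum.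
move=> -> //; first by congr (_ * _); have [] := hs t.
- rewrite cat_uniq map_inj_uniq ?enum_uniq /= ?andbT ?orbF; last by move=> ? ? [].
  by apply/mapP => -[].
- move=> _ /mapP[j _ ->]; split => //=.
  by move=> B mB'; exists B => //; rewrite setTI.
- move=> i; rewrite inE => /eqP -> /=; split => //.
  by exists [set t] => //; rewrite setTI.
Qed.

Lemma monomial_support_event :
  P' (X @^-1` (~` \bigcup_(t in [set: 'S_N]) monomial_support t)) = 0.
Proof.
apply: (subset_measure0 _ _ _ P'NzC).
- rewrite -[X in measurable X]setTI; apply: measurable_monomial => //.
  apply: measurableC; apply: fin_bigcup_measurable; first exact: finite_finset.
  by move=> t _; exact: measurable_monomial_support.
- exact: measurableC.
- move=> w /= h Nw; apply: h; exists (s w) => // j k.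
  by rewrite mxE; case: ifP => //; rewrite ?eqxx // => _; exact: Nw.
Qed.

End Monomial.

(** Off a null event the spectral measure of [A] is the sum, over the permutations
[t], the cycles [C] of [t] and the roots, of the indicators of the events that the
matrix is supported by [t] and that the root is in [A].  Those events only involve
the law of the matrix, which is that of the monomial model. *)
Lemma mean_spectral_measure N d (Omega : measurableType d) (P : probability Omega R)
    (M : {RV P >-> 'M[R[i]]_N}) A :
  follows_ensemble theta L P M -> measurable A ->
  mean_measure P (fun w => spectral_measure (M w)) A =
  \sum_(t : 'S_N) (ewens theta t)%:E * \sum_(C in porbits t) root_measure L #|C| A.
Proof.
case=> dd [OO [PP [s [z [hs hz hind hM]]]]] mA; rewrite /mean_measure.
pose B t (C : {set 'I_N}) i : set 'M[R[i]]_N := monomial_support t `&`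
   (@cycle_product R N t C) @^-1` (croot #|C| i @^-1` A).
have mr k i : measurable (@croot R k i @^-1` A).
  by rewrite -[X in measurable X]setTI; exact: measurable_croot.
have mB t C i : measurable (B t C i).
  apply: measurableI; first exact: measurable_monomial_support.
  by rewrite -[X in measurable X]setTI; exact: measurable_cycle_product.
have mMB t C i : measurable (M @^-1` B t C i).
  by rewrite -[X in measurable X]setTI; exact: measurable_funP.
pose U := \bigcup_(t in [set: 'S_N]) monomial_support t : set 'M[R[i]]_N.
have mU : measurable (~` U).
  apply: measurableC; apply: fin_bigcup_measurable; first exact: finite_finset.
  by move=> t _; exact: measurable_monomial_support.
rewrite (@ge0_integral_eq_off _ _ _ P (M @^-1` (~` U)) _ (fun w =>
  \sum_(t : 'S_N) \sum_(C in porbits t) \sum_(i < #|C|) (\1_(M @^-1` B t C i) w)%:E)).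
- rewrite ge0_integral_sum_cond; last 2 first.
  + move=> t _; apply: emeasurable_sum_cond => C _; apply: emeasurable_sum_cond => i _.
    by apply/measurable_EFinP; exact: measurable_indic.
  + by move=> t x _; apply: sume_ge0 => C _; apply: sume_ge0 => i _; rewrite lee_fin.
  apply: eq_bigr => t _.
  rewrite ge0_integral_sum_cond; last 2 first.
  + move=> C _; apply: emeasurable_sum_cond => i _.
    by apply/measurable_EFinP; exact: measurable_indic.
  + by move=> C x _; apply: sume_ge0 => i _; rewrite lee_fin.
  rewrite ge0_sume_distrr; last by move=> C _; exact: measure_ge0.
  apply: eq_bigr => C _.
  rewrite ge0_integral_sum_cond; last 2 first.
  + by move=> i _; apply/measurable_EFinP; exact: measurable_indic.
  + by move=> i x _; rewrite lee_fin.
  rewrite root_measureE ge0_sume_distrr; last by move=> i _; exact: measure_ge0.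
  apply: eq_bigr => i _.
  rewrite integral_indic // setIT; apply: etrans (hM _ (mB t C i)) _.
  exact: (monomial_cycle_event hs hz hind t C (mr _ _)).
- by rewrite -[X in measurable X]setTI; exact: measurable_funP.
- by apply: etrans (hM _ mU) _; exact: (monomial_support_event hs hz).
- move=> w; rewrite /spectral_measure; apply: fsume_ge0 => l _.
  by rewrite mule_ge0 // lee_fin.
- by move=> w; apply: sume_ge0 => t _; apply: sume_ge0 => C _; apply: sume_ge0 => i _; rewrite lee_fin.
- move=> w /= /contrapT[t _ Mt].
  rewrite (spectral_measure_monomial _ Mt) (bigD1 t) //= [X in _ + X]big1 ?adde0.
    apply: eq_bigr => C Ct; apply: eq_bigr => i _.
    rewrite diracE indicE; congr (_%:R%:E); congr nat_of_bool.
    apply/idP/idP => /set_mem h; apply/mem_set; first by split.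
    by case: h.
  move=> t' t't; apply: big1 => C _; apply: big1 => i _.
  rewrite indicE memNset // => -[Mt' _]; move/eqP: t't; apply.
  exact: monomial_support_inj Mt' Mt.
Qed.

End MeanSpectralMeasure.

(** * The mean limit measure *)

Section PoissonMean.
Local Open Scope ereal_scope.
Variable R : realType.

Lemma nneseries_ltn (c : \bar R) n : 0 <= c ->
  \sum_(p <oo) (if (p < n)%N then c else 0) = n%:R%:E * c.
Proof.
move=> c0; rewrite (@nneseries_split _ _ 0 n); last by move=> p _; case: ifP.
rewrite add0n [X in _ + X]eseries0 ?adde0; last first.
  by move=> p np _; rewrite ltnNge np.
rewrite big_mkord (eq_bigr (fun=> c)) ?sumr_const ?card_ord ?mule_natl //.
by move=> p _; rewrite ltn_ord.
Qed.

(** The mean of a variable with values in the natural numbers is the sum of its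
tail probabilities; this is the form in which a random number of terms is averaged
below. *)
Lemma poisson_tail_sum (rate : R) i : (0 < rate)%R ->
  \sum_(p <oo) poisson_prob rate i [set n | (p < n)%N] = rate%:E.
Proof.
move=> r0.
have pmf0 n : 0 <= (poisson_pmf rate n)%:E by rewrite lee_fin poisson_pmf_ge0.
have tail p : poisson_prob rate i [set n | (p < n)%N] =
    \sum_(n <oo) if (p < n)%N then (poisson_pmf rate n)%:E else 0.
  by rewrite /poisson_prob r0 -nneseries_esum // eseries_mkcond.
under eq_eseriesr do rewrite tail.
rewrite (@nneseries_interchange _ (fun p n => if (p < n)%N then (poisson_pmf rate n)%:E else 0) xpredT xpredT); last first.
  by move=> p n; case: ifP.
under eq_eseriesr do rewrite nneseries_ltn //.
rewrite (@nneseries_split _ _ 0 1); last by move=> n _; rewrite mule_ge0 // lee_fin.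
rewrite big_nat1 mul0e add0e -nneseries_addn; last by move=> n; rewrite mule_ge0 // lee_fin.
transitivity (\sum_(n <oo) rate%:E * (poisson_pmf rate n)%:E).
  apply: eq_eseriesr => n _; rewrite -!EFinM; congr (_%:E).
  rewrite /poisson_pmf r0 !addn1 factS natrM exprS.
  have f0 : (n`!%:R != 0 :> R)%R by rewrite pnatr_eq0 -lt0n fact_gt0.
  have n0 : (1 + n%:R != 0 :> R)%R by rewrite addrC natr1 pnatr_eq0.
  by rewrite -natr1 addrC; field; rewrite f0 n0.
rewrite nneseriesZl; last by move=> n _; exact: pmf0.
have <- : poisson_prob rate i setT = \sum_(n <oo) (poisson_pmf rate n)%:E.
  by rewrite /poisson_prob r0 nneseries_esumT.
by rewrite probability_setT mule1.
Qed.

End PoissonMean.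

Section LimitMeasure.
Local Open Scope ereal_scope.
Variables (R : realType) (theta : R) (L : probability R[i] R).
Hypothesis theta_gt0 : (0 < theta)%R.
Hypothesis L0 : L [set 0%R] = 0.

Lemma product_law_0 k : product_law L k [set 0%R] = 0.
Proof.
have m0 := @measurable_set0C R.
elim: k => [|k IH] /=; first by rewrite diracE memNset //= => /eqP; rewrite oner_eq0.
rewrite /distribution /pushforward.
have -> : @mulC2 R @^-1` [set 0%R] = ([set 0%R] `*` setT) `|` (setT `*` [set 0%R]).
  apply/seteqP; split => -[u v] /=; rewrite /mulC2 /=.
    by move=> /eqP; rewrite mulf_eq0 => /orP[] /eqP ->; [left|right].
  by move=> [] [] /=; [move=> -> _; rewrite mul0r|move=> _ ->; rewrite mulr0].
have m1 : measurable ([set (0 : R[i])%R] `*` [set: R[i]]) by exact: measurableX.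
have m2 : measurable ([set: R[i]] `*` [set (0 : R[i])%R]) by exact: measurableX.
have p1 : (L \x product_law L k) ([set (0 : R[i])%R] `*` [set: R[i]]) = 0.
  by rewrite product_measure1E // [X in X * _](_ : _ = 0) ?mul0e //; exact: L0.
have p2 : (L \x product_law L k) ([set: R[i]] `*` [set (0 : R[i])%R]) = 0.
  by rewrite product_measure1E // [X in _ * X](_ : _ = 0) ?mule0 //; exact: IH.
by rewrite measureU0.
Qed.

Lemma is_product_lawE k nu A : is_product_law k L nu -> measurable A ->
  nu A = product_law L k A.
Proof.
case=> dd [OO [PP [z [hz ind hnu]]]] mA; rewrite -hnu //.
have := @independent_prod_law R _ _ PP _ setT _ L (fun i => z i) ind
  (enum 'I_k) [::] (fun=> setT) A.
rewrite cats0 enum_uniq size_enum_ord.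
rewrite (_ : \bigcap_(i in _) _ = setT) ?probability_setT ?setTI ?mul1e; last first.
  by apply/seteqP; split.
rewrite (_ : (fun w => \prod_(i <- enum 'I_k) z i w)%R = fun w => (\prod_(i < k) z i w)%R).
  apply=> // i _; split => //.
  by move=> B mB; exists B => //; rewrite setTI.
by apply/funext => w; rewrite big_enum.
Qed.

Context d (Omega : measurableType d) (P : probability Omega R).
Variables (a : nat -> {RV P >-> nat}) (T : nat -> nat -> {RV P >-> R[i]}).
Hypothesis haT : limit_variables theta L a T.

Lemma law_T k p A : (0 < k)%N -> (0 < p)%N -> measurable A ->
  P (T k p @^-1` A) = product_law L k A.
Proof.
by move=> k0 p0 mA; case: haT => _ h _; rewrite -(is_product_lawE (h _ _ k0 p0) mA).
Qed.

Lemma independent_a_T k p (B : set nat) A : (0 < k)%N -> (0 < p)%N -> measurable A ->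
  P (a k @^-1` B `&` T k p @^-1` A) =
  poisson_prob (theta / k%:R) 0 B * product_law L k A.
Proof.
move=> k0 p0 mA; have [ha hT ind] := haT.
pose E (i : nat + nat * nat) := if i is inl _ then a k @^-1` B else T k p @^-1` A.
have := ind [:: inl k; inr (k, p)] E.
rewrite !big_cons big_nil mule1 /= ha // law_T // => <- //.
  congr (P _); apply/seteqP; split => w /=.
    by move=> [h1 h2] i /=; rewrite !inE => /orP[] /eqP ->.
  move=> h; split; first by have := h (inl k); apply; rewrite /= inE eqxx.
  by have := h (inr (k, p)); apply; rewrite /= !inE eqxx orbT.
move=> i; rewrite !inE => /orP[] /eqP -> /=; split => //.
  by exists B => //; rewrite setTI.
by exists A => //; rewrite setTI.
Qed.

(** The term of index [p] in the random sum over [p <= a k] is present when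
[p <= a k], an event independent of [T k p]; the sum over [p] of its probabilities
is the mean [theta / k] of [a k].  The roots of [T k p] are enumerated by [croot]
off the null event that some [T k p] is 0. *)
Lemma mean_limit_measure A : measurable A ->
  mean_measure P (limit_measure (fun k => a k) (fun k p => T k p)) A =
  \sum_(k <oo) (theta / k.+1%:R)%:E * root_measure L k.+1 A.
Proof.
move=> mA; rewrite /mean_measure.
pose S k p j := a k.+1 @^-1` [set n | (p < n)%N] `&` T k.+1 p.+1 @^-1` (@croot R k.+1 j @^-1` A).
have mr k i : measurable (@croot R k i @^-1` A).
  by rewrite -[X in measurable X]setTI; exact: measurable_croot.
have mS k p j : measurable (S k p j).
  by apply: measurableI; rewrite -[X in measurable X]setTI; exact: measurable_funP.
pose N := \bigcup_k \bigcup_p (T k.+1 p.+1 @^-1` [set 0%R]).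
have mN1 k p : measurable (T k.+1 p.+1 @^-1` [set 0%R]).
  rewrite -[X in measurable X]setTI; apply: measurable_funP => //.
  exact: measurable_set0C.
have mN : measurable N by do 2!apply: bigcupT_measurable => ?.
have N0 : P N = 0.
  apply/negligibleP => //; apply: negligible_bigcup => k; apply: negligible_bigcup => p.
  apply/negligibleP => //; apply: etrans (law_T _ _ (@measurable_set0C R)) _ => //.
  exact: product_law_0.
rewrite (@ge0_integral_eq_off _ _ _ P N _ (fun w =>
  \sum_(k <oo) \sum_(p <oo) \sum_(j < k.+1) (\1_(S k p j) w)%:E)) //.
- have s0 k p w : 0 <= \sum_(j < k.+1) (\1_(S k p j) w)%:E :> \bar R.
    by apply: sume_ge0 => j _; rewrite lee_fin.
  have ms k p : measurable_fun setT (fun w => \sum_(j < k.+1) (\1_(S k p j) w)%:E : \bar R).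
    by apply: emeasurable_sum => j; apply/measurable_EFinP; exact: measurable_indic.
  rewrite integral_nneseries //; last 2 first.
  + by move=> k; apply: ge0_emeasurable_sum => *.
  + by move=> k w _; apply: nneseries_ge0 => *.
  apply: eq_eseriesr => k _; rewrite integral_nneseries //.
  rewrite -(@poisson_tail_sum R (theta / k.+1%:R) 0) ?divr_gt0 // muleC.
  have -> : root_measure L k.+1 A = (fine (root_measure L k.+1 A))%:E.
    by rewrite fineK // root_measure_fin_num.
  rewrite -nneseriesZl; last by move=> p _; exact: measure_ge0.
  rewrite fineK ?root_measure_fin_num //.
  apply: eq_eseriesr => p _.
  rewrite ge0_integral_sum //; last by move=> j; apply/measurable_EFinP; exact: measurable_indic.
  rewrite muleC root_measureE ge0_sume_distrr; last by move=> i _; exact: measure_ge0.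
  apply: eq_bigr => j _; rewrite integral_indic // setIT.
  exact: independent_a_T.
- move=> w; apply: nneseries_ge0 => k _ _; apply: sume_ge0 => p _.
  by apply: fsume_ge0 => z _.
- move=> w; apply: nneseries_ge0 => k _ _; apply: nneseries_ge0 => p _ _.
  by apply: sume_ge0 => j _; rewrite lee_fin.
move=> w Nw; rewrite /limit_measure.
rewrite -(@nneseries_addn _ (fun k => \sum_(1 <= p < (a k w).+1)
    \sum_(z \in [set z : R[i] | (z ^+ k = T k p w)%R]) (\d_z A : \bar R)) 1); last first.
  by move=> k; apply: sume_ge0 => p _; apply: fsume_ge0.
apply: eq_eseriesr => k _; rewrite !addn1 big_add1 /=.
rewrite (@nneseries_split _ _ 0 (a k.+1 w)); last first.
  by move=> p _; apply: sume_ge0 => j _; rewrite lee_fin.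
rewrite add0n [X in _ = _ + X]eseries0 ?adde0; last first.
  move=> p ap _; apply: big1 => j _; rewrite indicE memNset // => -[/=].
  by rewrite ltnNge ap.
rewrite !big_mkord; apply: eq_bigr => -[p pa] _ /=.
have T0 : (T k.+1 p.+1 w != 0)%R.
  by apply/eqP => T0; apply: Nw; exists k => //; exists p.
rewrite expn_eq_croot // -fsbig_seq; last first.
  rewrite map_inj_in_uniq ?iota_uniq // => i j.
  by rewrite !mem_iota /= add0n; exact: croot_inj.
rewrite big_map -val_enum_ord big_map big_enum /=; apply: eq_bigr => j _.
rewrite diracE indicE; congr (_%:R%:E); congr nat_of_bool.
by apply/idP/idP => /set_mem h; apply/mem_set; [split|case: h].
Qed.

End LimitMeasure.

(** * The weak law of large numbers *)

Lemma bounded_integrable d (T : measurableType d) (R : realType)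
    (mu : {finite_measure set T -> \bar R}) (f : T -> R) (K : R) :
  measurable_fun setT f -> (forall x, `|f x| <= K) -> mu.-integrable setT (EFin \o f).
Proof.
move=> mf fK; apply: measurable_bounded_integrable => //.
  by rewrite ltey_eq fin_num_measure.
exists K; split; first exact: num_real.
by move=> x Kx y _ /=; apply: le_trans (fK y) (ltW Kx).
Qed.

Section WeakLawOfLargeNumbers.
Import HBSimple.
Local Open Scope ereal_scope.
Context d (Omega : measurableType d) (R : realType) (P : probability Omega R).
Context d' (T : measurableType d') (L : probability T R).

Variable Y : nat -> {RV P >-> T}.
Hypothesis lawY : forall i, has_law P (Y i) L.
Hypothesis pairY : forall i j, i != j -> forall A B, measurable A -> measurable B ->
  P (Y i @^-1` A `&` Y j @^-1` B) = L A * L B.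

Lemma integral_law_ge0 i (f : T -> \bar R) : measurable_fun setT f -> (forall x, 0 <= f x) ->
  \int[P]_w f (Y i w) = \int[L]_x f x.
Proof.
move=> mf f0; rewrite -(@ge0_integral_distribution _ _ _ _ _ P (Y i) f) //.
by apply: eq_measure_integral => A mA _; exact: lawY.
Qed.

Lemma integral_pair i j (u : T -> R) (K : R) : i != j -> measurable_fun setT u ->
  (forall x, `|u x| <= K)%R -> \int[L]_x (u x)%:E = 0 ->
  \int[P]_w (u (Y i w) * u (Y j w))%:E = 0.
Proof.
move=> ij mu uK u0.
have K0 : (0 <= K)%R by apply: le_trans (uK (Y 0%N point)).
have mW : measurable_fun setT (fun w => (Y i w, Y j w)) by exact: measurable_fun_pair.
pose W : {mfun Omega >-> (T * T)%type} := HB.pack (fun w => (Y i w, Y j w))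
   (isMeasurableFun.Build _ _ _ _ _ mW).
pose f (x : T * T) := (u x.1 * u x.2)%R.
have mf : measurable_fun setT f.
  by apply: measurable_funM; apply: measurableT_comp.
have fK x : (`|f x| <= K * K)%R by rewrite normrM ler_pM.
have lawW A : measurable A -> (L \x L) A = distribution P W A.
  apply: product_measure_unique => A1 A2 mA1 mA2.
  by rewrite -(pairY ij).
transitivity (\int[distribution P W]_x (f x)%:E).
  rewrite integral_distribution //; first exact/measurable_EFinP.
  apply: (@bounded_integrable _ _ _ P _ (K * K)%R) => [|w]; last exact: fK.
  exact: (measurableT_comp mf mW).
transitivity (\int[L \x L]_x (f x)%:E).
  by apply: eq_measure_integral => A mA _; exact: esym (lawW A mA).
pose LL : probability (T * T)%type R := (L \x L).
rewrite -fubini1; last exact: (@bounded_integrable _ _ _ LL f (K * K)%R).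
rewrite integral0_eq // => x _; rewrite /fubini_F /f /=.
under eq_integral do rewrite EFinM.
by rewrite integralZl ?u0 ?mule0 //; exact: (@bounded_integrable _ _ _ L u K).
Qed.

(** The products of two distinct terms have mean 0, so that only the [n] squares
remain. *)
Lemma second_moment_sum n (u : T -> R) (K : R) : measurable_fun setT u ->
  (forall x, `|u x| <= K)%R -> \int[L]_x (u x)%:E = 0 ->
  \int[P]_w (((\sum_(i < n) u (Y i w)) ^+ 2)%R)%:E <= (n%:R * K ^+ 2)%:E.
Proof.
move=> mu uK u0.
have muY i : measurable_fun setT (fun w => u (Y i w)).
  by apply: (measurableT_comp mu).
have K0 : (0 <= K)%R by apply: le_trans (uK (Y 0%N point)).
have uuK i j w : (`|u (Y i w) * u (Y j w)| <= K * K)%R by rewrite normrM ler_pM.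
have iuu i j : P.-integrable setT (EFin \o (fun w => u (Y i w) * u (Y j w))%R).
  by apply: (@bounded_integrable _ _ _ P _ (K * K)%R) => //; exact: measurable_funM.
have -> : \int[P]_w (((\sum_(i < n) u (Y i w)) ^+ 2)%R)%:E =
    \sum_(i < n) \sum_(j < n) \int[P]_w (u (Y i w) * u (Y j w))%:E.
  transitivity (\int[P]_w \sum_(i < n) \sum_(j < n) (u (Y i w) * u (Y j w))%:E).
    apply: eq_integral => w _; rewrite expr2 big_distrlr /= -sumEFin.
    by apply: eq_bigr => i _; rewrite sumEFin.
  rewrite integral_sum //.
    apply: eq_bigr => i _; rewrite integral_sum // => j; exact: iuu.
  move=> i; apply: (@integrable_sum _ _ _ P _ measurableT _ _ _
    (fun (j : 'I_n) w => (u (Y i w) * u (Y j w))%:E)) => j _; exact: iuu.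
have -> : (n%:R * K ^+ 2)%:E = \sum_(i < n) (K ^+ 2)%:E.
  by rewrite sumEFin sumr_const card_ord mulr_natl.
apply: lee_sum => i _; rewrite (bigD1 i) //= [X in _ + X]big1 ?adde0; last first.
  by move=> j ji; apply: (@integral_pair _ _ _ K) => //; rewrite eq_sym.
apply: (@le_trans _ _ (\int[P]_w (cst (K ^+ 2)%:E w))).
  apply: le_integral => //; first exact: iuu.
    by apply: (@bounded_integrable _ _ _ P (cst (K ^+ 2)%R) `|K ^+ 2|%R).
  move=> w _; rewrite lee_fin; apply: le_trans (ler_norm _) _.
  by rewrite normrM expr2 ler_pM.
by rewrite integral_cst // [X in _ * X](_ : _ = 1) ?mule1 //; exact: probability_setT.
Qed.

(** With pairwise independence the second moment method requires square
integrability, so [phi] is approximated in mean by a bounded [g].  The deviation of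
the mean is at most the sum of the mean of [|phi - g|], controlled by its
expectation, of the deviation for [g], controlled by its second moment, and of the
difference of the expectations.  If the whole is at least [e], one of the first two
is at least [e / 3]. *)
Lemma weak_law_of_large_numbers (phi : T -> R) :
  measurable_fun setT phi -> L.-integrable setT (EFin \o phi) ->
  forall e eta : R, (0 < e)%R -> (0 < eta)%R -> exists N : nat, forall n, (N <= n)%N ->
  P [set w | (e <= `|n%:R^-1 * (\sum_(i < n) phi (Y i w)) - fine (\int[L]_x (phi x)%:E)|)%R]
    <= eta%:E.
Proof.
move=> mphi iphi e eta e0 eta0; set m := fine _.
pose del := Num.min (e / 3 / 2)%R (e * eta / 6)%R.
have del0 : (0 < del)%R by rewrite lt_min !(divr_gt0, mulr_gt0).
have [g_ [ig _ cg]] := approximation_sfun_integrable measurableT iphi.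
have [g [intg gdel]] : exists g : {sfun T >-> R},
    L.-integrable setT (EFin \o g) /\ \int[L]_x `|phi x - g x|%:E <= del%:E.
  move/fine_fcvg/cvg_ballP/(_ del del0) : cg => -[] // n _ Nb; exists (g_ n).
  split; first exact: ig.
  have := Nb _ (leqnn n); rewrite /ball/= sub0r normrN => /ltW.
  have fn : \int[L]_x `|(EFin \o phi) x - (g_ n x)%:E| \is a fin_num.
    apply: integrable_fin_num => //; apply: integrable_abse.
    by apply: integrableB => //; exact: ig.
  by rewrite -lee_fin -fine_abse // ?fineK ?abse_fin_num // => /(le_trans (lee_abs _)).
have mg : measurable_fun setT g by exact: measurable_funP.
have [K K0 gK] : exists2 K : R, (0 <= K)%R & forall x, (`|g x| <= K)%R.
  have [M [_ /= bdM]] := simple_bounded g.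
  exists (`|M| + 1)%R; first by rewrite addr_ge0.
  by move=> x; rewrite bdM// ltr_pwDr// ler_norm.
pose c := fine (\int[L]_x (g x)%:E).
have cE : c%:E = \int[L]_x (g x)%:E by rewrite fineK //; apply: integrable_fin_num.
have mE : m%:E = \int[L]_x (phi x)%:E by rewrite fineK //; apply: integrable_fin_num.
have cm : (`|c - m| <= del)%R.
  rewrite -lee_fin -abse_EFin EFinB cE mE -integralB //.
  apply: le_trans gdel; apply: le_trans (le_abse_integral _ _ _) _ => //.
    by apply: emeasurable_funB; exact/measurable_EFinP.
  rewrite (eq_integral (fun x => `|phi x - g x|%:E)) // => x _.
  by rewrite /= ?abse_EFin distrC.
pose u x := (g x - c)%R; pose K' := (K + `|c|)%R.
have K'0 : (0 <= K')%R by rewrite addr_ge0.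
have mu : measurable_fun setT u by exact: measurable_funB.
have uK x : (`|u x| <= K')%R by apply: le_trans (ler_normB _ _) _; rewrite lerD2r.
have u0 : \int[L]_x (u x)%:E = 0.
  under eq_integral do rewrite EFinB.
  rewrite integralB //; last exact: (@bounded_integrable _ _ _ L (cst c) `|c|%R).
  rewrite -cE integral_cst // [X in _ * X](_ : _ = 1) ?mule1 ?subee //.
  exact: probability_setT.
(* Beyond C, the second moment term below is at most eta / 8. *)
pose C := (72 * K' ^+ 2 / (e ^+ 2 * eta))%R.
have C0 : (0 <= C)%R by rewrite divr_ge0 ?mulr_ge0 ?sqr_ge0 // ltW.
exists (Num.bound C).+1 => n nN.
have n0 : (0 < n%:R :> R)%R by rewrite ltr0n (leq_trans _ nN).
have Cn : (C <= n%:R)%R.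
  apply: ltW; apply: lt_le_trans (archi_boundP C0) _; rewrite ler_nat.
  exact: leq_trans (leqnSn _) nN.
set Ev := [set w | _].
have mphiY i : measurable_fun setT (fun w => phi (Y i w)) by exact: (measurableT_comp mphi).
have muY i : measurable_fun setT (fun w => u (Y i w)) by exact: (measurableT_comp mu).
pose A w := (\sum_(i < n) u (Y i w))%R.
pose D w := (\sum_(i < n) `|phi (Y i w) - g (Y i w)|)%R.
have mA : measurable_fun setT A by exact: measurable_sum.
have mdist : measurable_fun setT (fun x => `|phi x - g x|%R).
  by apply: measurableT_comp => //; exact: measurable_funB.
have mD : measurable_fun setT D.
  by apply: measurable_sum => i; apply: (measurableT_comp mdist).
have mEv : measurable Ev.
  rewrite -[X in measurable X]setTI.
  apply: (@measurable_fun_ler _ _ _ _ (cst e) (fun w => `|n%:R^-1 * (\sum_(i < n) phi (Y i w)) - m|%R)) => //.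
  apply: measurableT_comp => //; apply: measurable_funB => //.
  by apply: measurable_funM => //; exact: measurable_sum.
(* Markov bounds: c1 A^2 = (|A| / n)^2 / (e / 3)^2 and c2 D = (D / n) / (e / 3). *)
pose c1 := (9 / e ^+ 2 / n%:R ^+ 2)%R; pose c2 := (3 / e / n%:R)%R.
have c10 : (0 <= c1)%R by rewrite !divr_ge0 // ?sqr_ge0.
have c20 : (0 <= c2)%R by rewrite !divr_ge0 // ltW.
have D0 w : (0 <= D w)%R by exact: sumr_ge0.
have ninv : (0 <= n%:R^-1 :> R)%R by rewrite invr_ge0 ltW.
have e30 : (0 < e / 3)%R by rewrite divr_gt0.
have key w : Ev w -> (1 <= c1 * A w ^+ 2 + c2 * D w)%R.
  move=> /= Ew.
  have split3 : (n%:R^-1 * (\sum_(i < n) phi (Y i w)) - m =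
     n%:R^-1 * (\sum_(i < n) (phi (Y i w) - g (Y i w))) + n%:R^-1 * A w + (c - m))%R.
    rewrite /A /u !big_split /= !sumrN sumr_const card_ord -mulr_natr.
    by field; rewrite gt_eqF.
  have De : (`|n%:R^-1 * (\sum_(i < n) (phi (Y i w) - g (Y i w)))| <= D w / n%:R)%R.
    rewrite normrM (ger0_norm ninv) mulrC ler_pM2r ?invr_gt0 //.
    exact: ler_norm_sum.
  have cm3 : (`|c - m| <= e / 3)%R.
    apply: (le_trans cm); rewrite /del ge_min; apply/orP; left; lra.
  have tri : (e <= D w / n%:R + `|A w| / n%:R + e / 3)%R.
    apply: (le_trans Ew); rewrite split3.
    apply: le_trans (ler_normD _ _) _; apply: lerD cm3.
    apply: le_trans (ler_normD _ _) _; apply: lerD De _.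
    by rewrite normrM (ger0_norm ninv) mulrC.
  have [Db|Db] := leP (e / 3)%R (D w / n%:R)%R.
    have : (1 <= c2 * D w)%R.
      have -> : (c2 * D w = (D w / n%:R) / (e / 3))%R by rewrite /c2; field; rewrite ?gt_eqF.
      by rewrite ler_pdivlMr ?mul1r // divr_gt0.
    have : (0 <= c1 * A w ^+ 2)%R by rewrite mulr_ge0 ?sqr_ge0.
    by move=> p1 p2; rewrite -[leLHS]add0r lerD.
  have Ab : (e / 3 <= `|A w| / n%:R)%R by lra.
  have : (1 <= c1 * A w ^+ 2)%R.
    have -> : (c1 * A w ^+ 2 = ((`|A w| / n%:R) / (e / 3)) ^+ 2)%R.
      rewrite /c1 !expr_div_n real_normK ?num_real //.
      by field; rewrite ?gt_eqF.
  have x0 : (0 <= `|A w| / n%:R / (e / 3))%R.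
      by rewrite divr_ge0 ?(ltW e30) // mulr_ge0.
    by rewrite expr_ge1 // ler_pdivlMr // mul1r.
  have : (0 <= c2 * D w)%R by rewrite mulr_ge0.
  by move=> p1 p2; rewrite -[leLHS]addr0 lerD.
have intA : \int[P]_w ((A w ^+ 2)%R)%:E <= (n%:R * K' ^+ 2)%:E.
  exact: second_moment_sum.
have intD : \int[P]_w (D w)%:E <= (n%:R * del)%:E.
  have -> : \int[P]_w (D w)%:E = \int[P]_w (\sum_(i < n) `|phi (Y i w) - g (Y i w)|%:E).
    by apply: eq_integral => w _; rewrite sumEFin.
  rewrite ge0_integral_sum //; last by move=> i; apply/measurable_EFinP; apply: (measurableT_comp mdist).
  have -> : (n%:R * del)%:E = \sum_(i < n) del%:E.
    by rewrite sumEFin sumr_const card_ord mulr_natl.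
  apply: lee_sum => i _.
  rewrite (@integral_law_ge0 i (fun x => `|phi x - g x|%:E)) //.
  exact/measurable_EFinP.
have mA2 : measurable_fun setT (fun w => ((A w ^+ 2)%R)%:E).
  by apply/measurable_EFinP; exact: measurable_funX.
have mDE : measurable_fun setT (fun w => (D w)%:E) by exact/measurable_EFinP.
apply: (@le_trans _ _ (\int[P]_w (c1%:E * ((A w ^+ 2)%R)%:E + c2%:E * (D w)%:E))).
  rewrite -[X in P X]setIT -integral_indic //; apply: ge0_le_integral => //.
  - by apply/measurable_EFinP; exact: measurable_indic.
  - by apply: emeasurable_funD; exact: measurable_funeM.
  - move=> w _; rewrite -!EFinM -EFinD lee_fin indicE.
    have [/set_mem Ew|_] := boolP (w \in Ev); first exact: key.
    by rewrite addr_ge0 // mulr_ge0 ?sqr_ge0.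
rewrite ge0_integralD //; last 4 first.
- by move=> w _; rewrite -EFinM lee_fin mulr_ge0 ?sqr_ge0.
- exact: measurable_funeM.
- by move=> w _; rewrite -EFinM lee_fin mulr_ge0.
- exact: measurable_funeM.
rewrite !ge0_integralZl_EFin //; last 2 first.
- by move=> w _; rewrite lee_fin D0.
- by move=> w _; rewrite lee_fin sqr_ge0.
apply: (@le_trans _ _ (c1%:E * (n%:R * K' ^+ 2)%:E + c2%:E * (n%:R * del)%:E)).
  by apply: leeD; apply: lee_wpmul2l; rewrite ?lee_fin.
rewrite -!EFinM -EFinD lee_fin.
have -> : (c1 * (n%:R * K' ^+ 2) = (72 * K' ^+ 2 / (e ^+ 2 * eta)) * (eta / 8) / n%:R)%R.
  by rewrite /c1; field; rewrite ?gt_eqF.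
have -> : (c2 * (n%:R * del) = 3 / e * del)%R by rewrite /c2; field; rewrite ?gt_eqF.
have h1 : (C * (eta / 8) / n%:R <= eta / 8)%R.
  by rewrite ler_pdivrMr // mulrC ler_pM2l ?divr_gt0.
have h2 : (3 / e * del <= eta / 2)%R.
  have -> : (eta / 2 = 3 / e * (e * eta / 6))%R by field; rewrite gt_eqF.
  rewrite ler_pM2l ?divr_gt0 // /del ge_min lexx orbT //.
by rewrite -/C; lra.
Qed.

End WeakLawOfLargeNumbers.

(** * Riemann sums on a circle *)

Section RiemannSum.
Variable R : realType.
Notation mu := (@lebesgue_measure R).

(** The mean value theorem on each interval of the subdivision makes the Riemann
sum equal to the integral for a suitable choice of the points. *)
Lemma riemann_mean_value (g : R -> R) (T : R) (k : nat) :
  continuous g -> 0 < T -> (0 < k)%N -> exists xi : nat -> R,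
  (forall j, (j < k)%N -> T * (j%:R / k%:R) <= xi j <= T * (j.+1%:R / k%:R)) /\
  (\int[mu]_(t in `[0, T]) g t)%R = T / k%:R * \sum_(j < k) g (xi j).
Proof.
move=> cg T0 k0; have k0R : 0 < k%:R :> R by rewrite ltr0n.
pose x j : R := T * (j%:R / k%:R).
pose G y := (\int[mu]_(t in `[0, y]) g t)%R.
have cgu y : {within `[0, y], continuous g} by exact: continuous_subspaceT.
have ig y : mu.-integrable `[0, y] (EFin \o g).
  by apply: continuous_compact_integrable; [exact: segment_compact|exact: cgu].
have dG (y : R) : 0 < y -> is_derive y 1 G (g y).
  move=> y0; have yy : y < y + 1 by rewrite ltrDl.
  have [d1 d2] := continuous_FTC1_closed yy (ig _) y0 (cg y).
  by apply: DeriveDef => //; rewrite -derive1E.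
have cG : {within `[0, T], continuous G}.
  exact: (parameterized_integral_continuous (ltW T0) (ig T)).
have x0 j : 0 <= x j by rewrite mulr_ge0 ?divr_ge0 // ltW.
have xS j : x j <= x j.+1.
  by rewrite ler_pM2l // ler_pM2r ?invr_gt0 // ler_nat.
have xT j : (j <= k)%N -> x j <= T.
  by move=> jk; rewrite ler_piMr ?(ltW T0) // ler_pdivrMr // mul1r ler_nat.
have /choice[xi hxi] (j : nat) : exists y, (j < k)%N -> x j <= y <= x j.+1 /\
    G (x j.+1) - G (x j) = g y * (x j.+1 - x j).
  have [jk|jk] := boolP (j < k)%N; last by exists 0.
  have [||y yj E] := @MVT_segment R G g (x j) (x j.+1) (xS j).
  - move=> y; rewrite in_itv /= => /andP[h1 _]; apply: dG.
    exact: le_lt_trans (x0 j) h1.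
  - apply: continuous_subspaceW cG; apply: subset_itv => /=; rewrite bnd_simp //.
    exact: xT.
  by exists y => _; split => //; move: yj; rewrite in_itv.
exists xi; split=> [j jk|]; first by have [] := hxi j jk.
have G0 : G 0 = 0 by rewrite /G set_itv1 Rintegral_set1.
have xk : x k = T by rewrite /x divff ?mulr1 // gt_eqF.
have x00 : x 0%N = 0 by rewrite /x mul0r mulr0.
transitivity (G (x k) - G (x 0%N)); first by rewrite x00 G0 subr0 xk.
rewrite -(telescope_sumr (fun j => G (x j)) (leq0n k)) big_mkord mulr_sumr; apply: eq_bigr => j _.
have [_ ->] := hxi j (ltn_ord j); rewrite mulrC; congr (_ * _).
by rewrite /x -mulrBr -mulrBl -[j.+1%:R]natr1 [_ + 1]addrC addrK mul1r.
Qed.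

Lemma cos_lipschitz (x y : R) : `|cos x - cos y| <= `|x - y|.
Proof.
wlog yx : x y / y <= x.
  by move=> H; case: (leP y x) => [|/ltW] h; [exact: H|rewrite distrC (distrC x); exact: H].
have [|c _ ->] := @MVT_segment R cos (fun x => - sin x) y x yx (fun z _ => is_derive_cos z).
  by apply: continuous_subspaceT; exact: continuous_cos.
by rewrite normrM normrN ler_piMl // ?sin_max.
Qed.

Lemma sin_lipschitz (x y : R) : `|sin x - sin y| <= `|x - y|.
Proof.
wlog yx : x y / y <= x.
  by move=> H; case: (leP y x) => [|/ltW] h; [exact: H|rewrite distrC (distrC x); exact: H].
have [|c _ ->] := @MVT_segment R sin cos y x yx (fun z _ => is_derive_sin z).
  by apply: continuous_subspaceT; exact: continuous_sin.
by rewrite normrM ler_piMl // ?cos_max.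
Qed.

Lemma cis_lipschitz (x y : R) : normc (cis x - cis y) <= 2 * `|x - y|.
Proof.
apply: le_trans (normc_le_ReIm _) _.
by rewrite mulr_natl mulr2n lerD // ?cos_lipschitz ?sin_lipschitz.
Qed.

Lemma normc_real (r : R) : 0 <= r -> normc (r%:C)%C = r.
Proof. by move=> r0; rewrite /= expr0n addr0 sqrtr_sqr ger0_norm. Qed.

Definition circle (r x : R) : R[i] := (r%:C)%C * cis x.

Lemma circleE r x : circle r x = Complex (r * cos x) (r * sin x).
Proof. by rewrite /circle; apply/eqP; rewrite eq_complex /= !mul0r subr0 addr0 !eqxx. Qed.

Lemma circle_dist r s x y : 0 <= r ->
  normc (circle s x - circle r y) <= `|s - r| + r * (2 * `|x - y|).
Proof.
move=> r0; apply: le_trans (normc_distD _ (circle r x) _) _; apply: lerD.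
  rewrite /circle -mulrBl Normc.normcM normc_cis mulr1 -rmorphB /=.
  by rewrite expr0n addr0 sqrtr_sqr.
rewrite /circle -mulrBr Normc.normcM normc_real //.
by rewrite ler_wpM2l // cis_lipschitz.
Qed.

Lemma continuous_circle r : 0 <= r -> continuous (circle r).
Proof.
move=> r0 x A /nbhs_normcP[e e0 eA].
have s0 : 0 < 2 * r + 1 by rewrite ltr_wpDl // mulr_ge0.
apply/nbhs_ballP; exists (e / (2 * r + 1)) => /=; first by rewrite divr_gt0.
move=> y; rewrite /ball /= => xy; apply: eA.
apply: le_lt_trans (circle_dist _ _ _ r0) _; rewrite subrr normr0 add0r.
move: xy; rewrite ltr_pdivlMr //; apply: le_lt_trans.
rewrite mulrA [leRHS]mulrC ler_wpM2r //; lra.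
Qed.

(** Compactness of the range of angles makes the modulus of continuity of [f]
uniform along the circle, with the second point allowed to be off the circle. *)
Lemma circle_uniform_continuity (f : R[i] -> R) r : 0 <= r -> continuous f ->
  forall eta, 0 < eta -> exists2 del, 0 < del &
  forall x w, 0 <= x <= 2 * pi -> normc (circle r x - w) < del ->
    `|f (circle r x) - f w| <= eta.
Proof.
move=> r0 cf eta eta0.
have /compact_near_coveringP := @segment_compact R 0 (2 * pi).
move=> /(_ R (0 : R)^'+ (fun del x => forall w, normc (circle r x - w) < del ->
    `|f (circle r x) - f w| <= eta) _).
have H : forall x : R, `[0, 2 * pi]%classic x -> \forall x' \near x & i \near 0^'+,
    forall w, normc (circle r x' - w) < i -> `|f (circle r x') - f w| <= eta.
  move=> x _.
  have : nbhs (circle r x) [set w | `|f (circle r x) - f w| < eta / 2].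
    apply: (cf (circle r x) [set v | `|f (circle r x) - v| < eta / 2]); apply/nbhs_ballP; exists (eta / 2) => //=; exact: divr_gt0.
  move=> /nbhs_normcP[e e0 eA].
  have e20 : 0 < e / 2 by rewrite divr_gt0.
  have cc : nbhs x [set x' | normc (circle r x - circle r x') < e / 2].
    by apply: (@continuous_circle r r0 x [set w | normc (circle r x - w) < e / 2]); apply/nbhs_normcP; exists (e / 2).
  near=> x' i => /= w wi.
  have h1 : normc (circle r x - circle r x') < e / 2 by near: x'.
  have ie : i < e / 2 by near: i; exact: nbhs_right_lt.
  have h2 : `|f (circle r x) - f (circle r x')| < eta / 2 by apply: eA; lra.
  have h3 : `|f (circle r x) - f w| < eta / 2.
    apply: eA; apply: le_lt_trans (normc_distD _ (circle r x') _) _; by rewrite [e]splitr ltrD // (lt_trans wi).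
  apply: le_trans (ler_distD (f (circle r x)) _ _) _.
  by rewrite [eta]splitr lerD // ltW // distrC.
move=> /(_ H) [del /= del0 hdel].
exists (del / 2); first by rewrite divr_gt0.
move=> x w x2 wd; apply: (hdel (del / 2)) => //=.
- by rewrite sub0r normrN gtr0_norm ?divr_gt0 //; lra.
- by rewrite divr_gt0.
Unshelve. all: by end_near.
Qed.

End RiemannSum.

(** * Roots of long products accumulate on the circle *)

Section LogMean.
Local Open Scope ereal_scope.
Variables (R : realType) (theta : R) (L : probability R[i] R).
Hypothesis L0 : L [set 0%R] = 0.
Context d (Omega : measurableType d) (P : probability Omega R).
Variables (a : nat -> {RV P >-> nat}) (T : nat -> nat -> {RV P >-> R[i]}).
Hypothesis haT : limit_variables theta L a T.

(* The independent sequence of law L provided by the variables of index k = 1. *)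
Let Y i : {RV P >-> R[i]} := T 1%N i.+1.

Lemma law_T1 i : has_law P (Y i) L.
Proof.
have [_ hT _] := haT.
have [dd [OO [PP [z [hz _ hP]]]]] := hT 1%N i.+1 isT isT.
move=> A mA; rewrite -(hz ord0 A mA).
rewrite -[LHS]/(distribution P (T 1%N i.+1) A) -hP //; congr (PP _).
by apply/funext => w /=; rewrite big_ord1.
Qed.

Lemma independent_T1 :
  independent_rvs P (fun i => Y i : Omega -> R[i]).
Proof.
have [_ _ ind] := haT.
move=> s E us hs.
pose E' (i : nat + nat * nat) := if i is inr (_, p.+1) then E p else setT.
have := ind [seq inr (1%N, p.+1) | p <- s] E'.
rewrite big_map /= map_inj_uniq //; last by move=> ? ? [].
have -> : \bigcap_(i in [set i | i \in [seq inr (1%N, p.+1) | p <- s]]) E' i =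
    \bigcap_(i in [set i | i \in s]) E i.
  apply/seteqP; split => w h i /=.
    by move=> si; apply: (h (inr (1%N, i.+1))); apply/mapP; exists i.
  by move=> /mapP[p ps ->] /=; exact: h.
apply=> // _ /mapP[p ps ->] /=; split => //.
by have [] := hs p ps.
Qed.

Lemma pairwise_independent_T1 i j : i != j -> forall A B, measurable A -> measurable B ->
  P (Y i @^-1` A `&` Y j @^-1` B) = L A * L B.
Proof.
move=> ij A B mA mB.
pose E k := if k == i then Y i @^-1` A else Y j @^-1` B.
have := @independent_T1 [:: i; j] E.
rewrite !big_cons big_nil mule1 /= inE andbT /E eqxx (eq_sym j) (negbTE ij).
rewrite !law_T1 // => <- //; last first.
  move=> k; rewrite !inE => /orP[] /eqP ->; rewrite ?eqxx; split => //.
    by exists A => //; rewrite setTI.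
  by rewrite (eq_sym j) (negbTE ij); exists B => //; rewrite setTI.
congr (P _); apply/seteqP; split => w /=.
  by move=> [h1 h2] k /=; rewrite !inE => /orP[] /eqP ->; rewrite ?eqxx // (eq_sym j) (negbTE ij).
move=> h; split; first by have := h i; rewrite eqxx; apply; rewrite /= mem_head.
by have := h j; rewrite (eq_sym j) (negbTE ij); apply; rewrite /= !inE eqxx orbT.
Qed.

Lemma product_law_T1 k A : measurable A ->
  P ((fun w => \prod_(i < k) Y i w)%R @^-1` A) = product_law L k A.
Proof.
move=> mA.
have := @independent_prod_law R _ _ P nat setT _ L (fun i => Y i) independent_T1
  (iota 0 k) [::] (fun=> setT) A.
rewrite cats0 iota_uniq size_iota.
rewrite (_ : \bigcap_(i in _) _ = setT) ?probability_setT ?setTI ?mul1e; last first.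
  by apply/seteqP; split.
rewrite (_ : (fun w => \prod_(i <- iota 0 k) Y i w)%R = fun w => (\prod_(i < k) Y i w)%R).
  apply=> // i _; split => //; first exact: law_T1.
  by move=> B mB; exists B => //; rewrite setTI.
by apply/funext => w; rewrite -[X in iota _ X]subn0 big_mkord.
Qed.

Lemma ln_normc_prod (I : Type) (s : seq I) (z : I -> R[i]) :
  (\prod_(i <- s) z i != 0)%R ->
  (ln (normc (\prod_(i <- s) z i)) = \sum_(i <- s) ln (normc (z i)))%R.
Proof.
elim: s => [|i s IH]; first by rewrite !big_nil Normc.normc1 ln1.
rewrite !big_cons mulf_eq0 negb_or => /andP[zi zs].
by rewrite Normc.normcM lnM ?posrE ?normc_gt0 // IH.
Qed.

Lemma measurable_ln_normc : measurable_fun setT (fun t : R[i] => ln (normc t)).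
Proof. by apply: (measurableT_comp (@measurable_ln R)); exact: measurable_normc. Qed.

Lemma measurable_log_mean_event k (e m : R) :
  measurable [set t : R[i] | (e <= `|ln (normc t) / k%:R - m|)%R].
Proof.
rewrite -[X in measurable X]setTI.
apply: (@measurable_fun_ler _ _ _ _ (cst e) (fun t : R[i] => `|ln (normc t) / k%:R - m|%R)) => //.
apply: measurableT_comp => //; apply: measurable_funB => //.
by apply: measurable_funM => //; exact: measurable_ln_normc.
Qed.

(** Since [product_law L k] is the law of the product of the first [k] terms of
the sequence, deviations of [ln (normc t) / k] under it are deviations of an
empirical mean.  Products equal to 0, for which [ln] is not additive, are null. *)
Lemma product_law_log_mean k (e m : R) :
  product_law L k [set t | (e <= `|ln (normc t) / k%:R - m|)%R] <=
  P [set w | (e <= `|k%:R^-1 * (\sum_(i < k) ln (normc (Y i w))) - m|)%R].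
Proof.
have mB := measurable_log_mean_event k e m; set B := [set t | _] in mB *.
have mB' : measurable (B `&` [set z : R[i] | (z != 0)%R]).
  by apply: measurableI => //; exact: measurable_neq0C.
have -> : product_law L k B = product_law L k (B `&` [set z : R[i] | (z != 0)%R]).
  rewrite (measureDI _ mB (@measurable_neq0C R)) [X in X + _](_ : _ = 0) ?add0e //.
  apply: (subset_measure0 _ _ _ (product_law_0 L0 k)).
  - by apply: measurableD => //; exact: measurable_neq0C.
  - exact: measurable_set0C.
  - by move=> z /= [_ /negP]; rewrite negbK => /eqP.
rewrite -product_law_T1 //; apply: le_measure; rewrite ?inE //.
- rewrite -[X in measurable X]setTI; apply: (@measurable_prodC R _ _ _ (index_enum _) (fun i : 'I_k => Y i)) => //.
- rewrite -[X in measurable X]setTI.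
  apply: (@measurable_fun_ler _ _ _ _ (cst e) (fun w => `|k%:R^-1 * (\sum_(i < k) ln (normc (Y i w))) - m|%R)) => //.
  apply: measurableT_comp => //; apply: measurable_funB => //.
  apply: measurable_funM => //; apply: measurable_sum => i.
  by apply: (measurableT_comp measurable_ln_normc).
- by move=> w /= [h1 h2]; rewrite mulrC -ln_normc_prod.
Qed.

Lemma product_law_lln : L.-integrable setT (EFin \o (fun t => ln (normc t))) ->
  forall e eta : R, (0 < e)%R -> (0 < eta)%R -> exists N : nat, forall k, (N <= k)%N ->
  product_law L k [set t | (e <= `|ln (normc t) / k%:R - fine (\int[L]_x (ln (normc x))%:E)|)%R]
    <= eta%:E.
Proof.
move=> iL e eta e0 eta0.
have [N hN] := weak_law_of_large_numbers law_T1 pairwise_independent_T1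
  measurable_ln_normc iL e0 eta0.
by exists N => k /hN; apply: le_trans; exact: product_law_log_mean.
Qed.

End LogMean.

Section RootAverage.
Variables (R : realType) (f : R[i] -> R) (K m : R).
Hypothesis cf : continuous f.
Hypothesis f0 : forall z, 0 <= f z.
Hypothesis fK : forall z, f z <= K.
Notation mu := (@lebesgue_measure R).
Let r := expR m.

Definition circle_average : R :=
  (2 * pi)^-1 * (\int[mu]_(x in `[0%R, 2 * pi]) f (circle r x))%R.

Definition root_average k t : R := k%:R^-1 * \sum_(j < k) f (croot k j t).

(** The [j]-th root is compared with the point of the circle at the [j]-th angle of
an exact Riemann sum: the radii are close by the hypothesis on [ln (normc t) / k],
and the angles are in the same arc of length [2 pi / k]. *)
Lemma root_average_near eta : 0 < eta -> exists2 del, 0 < del &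
  exists k0 : nat, forall k t, (k0 <= k)%N -> `|ln (normc t) / k%:R - m| < del ->
   `|root_average k t - circle_average| <= eta.
Proof.
move=> eta0; have r0 : 0 < r by exact: expR_gt0.
have p0 := pi_gt0 R.
have [del del0 hdel] := circle_uniform_continuity (ltW r0) cf eta0.
have : nbhs m [set x | `|expR m - expR x| < del / 2].
  apply: (@continuous_expR R m [set v | `|expR m - v| < del / 2]); apply/nbhs_ballP.
  by exists (del / 2) => //=; exact: divr_gt0.
move=> /nbhs_ballP[e /= e0 he]; exists e => //.
(* For k > c the angular displacement moves the point by less than del / 2. *)
pose c := r * (2 * (2 * pi)) / (del / 2).
have c0 : 0 <= c by rewrite divr_ge0 ?mulr_ge0 // ltW.
exists (Num.bound c).+1 => k t k0 kt.
have k1 : (0 < k)%N by apply: leq_trans k0.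
have kR : 0 < k%:R :> R by rewrite ltr0n.
have ck : c < k%:R.
  by apply: lt_le_trans (archi_boundP c0) _; rewrite ler_nat (leq_trans _ k0).
have cg : continuous (fun x => f (circle r x)).
  move=> x; apply: continuous_comp; last exact: cf.
  exact: (continuous_circle (ltW r0)).
have T0 : 0 < 2 * pi :> R by rewrite mulr_gt0.
have [xi [hxi E]] := riemann_mean_value cg T0 k1.
have -> : circle_average = k%:R^-1 * \sum_(j < k) f (circle r (xi j)).
  by rewrite /circle_average E -(mulrA (2 * pi)) mulKf // gt_eqF.
rewrite /root_average -mulrBr -sumrB normrM ger0_norm ?invr_ge0 ?(ltW kR) //.
rewrite ler_pdivrMl // (le_trans (ler_norm_sum _ _ _)) //.
have -> : k%:R * eta = \sum_(j < k) eta by rewrite sumr_const card_ord mulr_natl.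
apply: ler_sum => j _; rewrite distrC; apply: hdel.
  have /andP[h1 h2] := hxi j (ltn_ord j); apply/andP; split.
    by apply: le_trans h1; rewrite mulr_ge0 ?divr_ge0 // ltW.
  apply: (le_trans h2); rewrite ler_piMr ?(ltW T0) // ler_pdivrMr // mul1r ler_nat.
  exact: ltn_ord.
rewrite normc_distC; apply: le_lt_trans (circle_dist _ _ _ (ltW r0)) _.
rewrite [del]splitr; apply: ltrD.
  by rewrite distrC; apply: he; rewrite /ball /= distrC.
have /andP[h1 h2] := hxi j (ltn_ord j).
have /andP[h3 h4] := croot_angle t (ltn_ord j).
apply: (@le_lt_trans _ _ (r * (2 * (2 * pi / k%:R)))).
  rewrite ler_pM2l // ler_pM2l //.
  have E2 : 2 * pi * (j.+1%:R / k%:R) = 2 * pi * (j%:R / k%:R) + 2 * pi / k%:R :> R.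
    by rewrite -[j.+1%:R]natr1; field; rewrite gt_eqF.
  by rewrite ler_distl; apply/andP; split; lra.
have -> : r * (2 * (2 * pi / k%:R)) = c * (del / 2) / k%:R.
  by rewrite /c divfK ?gt_eqF ?divr_gt0 // !mulrA.
by rewrite ltr_pdivrMr // mulrC ltr_pM2l // divr_gt0.
Qed.

Lemma root_average_ge0 k t : 0 <= root_average k t.
Proof. by rewrite mulr_ge0 ?invr_ge0 // sumr_ge0. Qed.

Lemma root_average_le k t : root_average k t <= K.
Proof.
have K0 : 0 <= K by apply: le_trans (f0 0) (fK 0).
case: k => [|k]; first by rewrite /root_average invr0 mul0r.
rewrite /root_average ler_pdivrMl ?ltr0n // mulr_natl.
rewrite -[X in K *+ X]card_ord -sumr_const; exact: ler_sum.
Qed.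

Lemma measurable_root_average k : measurable_fun setT (root_average k).
Proof.
apply: measurable_funM => //; apply: measurable_sum => j.
apply: (measurableT_comp (continuous_measurableC cf)); exact: measurable_croot.
Qed.

Variable L : probability R[i] R.
Hypothesis lln : forall e eta : R, 0 < e -> 0 < eta -> exists N : nat, forall k, (N <= k)%N ->
  (product_law L k [set t | (e <= `|ln (normc t) / k%:R - m|)%R] <= eta%:E)%E.

Lemma integral_root_measure k :
  (\int[root_measure L k]_z (f z)%:E =
   (k%:R * fine (\int[product_law L k]_t (root_average k t)%:E))%:E)%E.
Proof.
have mf : measurable_fun setT (EFin \o f).
  by apply/measurable_EFinP; exact: continuous_measurableC.
rewrite ge0_integral_measure_sum //; last by move=> x _; rewrite lee_fin.
have iavg : (product_law L k).-integrable setT (EFin \o root_average k).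
  apply: (@bounded_integrable _ _ _ (product_law L k) _ K); first exact: measurable_root_average.
  by move=> x; rewrite ger0_norm ?root_average_ge0 ?root_average_le.
rewrite EFinM fineK; last exact: integrable_fin_num.
rewrite -integralZl //.
transitivity (\int[product_law L k]_t \sum_(j < k) (f (croot k j t))%:E)%E; last first.
  apply: eq_integral => t _; rewrite sumEFin -EFinM; congr (_%:E).
  case: k {iavg} => [|k] in t *; first by rewrite big_ord0 mul0r.
  by rewrite /root_average mulVKf // pnatr_eq0.
have mfj (j : 'I_k) : measurable_fun setT (fun t => (f (croot k j t))%:E).
  exact: (measurableT_comp mf (@measurable_croot R k j)).
have fj0 (j : 'I_k) t : [set: R[i]] t -> (0 <= (f (croot k j t))%:E)%E.
  by rewrite lee_fin.
rewrite ge0_integral_sum //.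
apply: eq_bigr => j _; rewrite ge0_integral_distribution //.
Qed.

(** The root average is close to the circle average except on an event of small
probability, where their distance is bounded by [2 * K]. *)
Lemma root_measure_average_cvg :
  (fun k => fine (\int[root_measure L k.+1]_z (f z)%:E) / k.+1%:R) @ \oo --> circle_average.
Proof.
apply/cvgrPdist_le => /= eta eta0.
have K0 : 0 <= K by apply: le_trans (f0 0) (fK 0).
have eta20 : 0 < eta / 2 by rewrite divr_gt0.
have [del del0 [k0 hk0]] := root_average_near eta20.
have b0 : 0 < eta / 2 / (2 * K + 1) by rewrite divr_gt0 // ltr_wpDl // mulr_ge0.
have [N hN] := lln del0 b0.
have I0 : 0 <= circle_average.
  rewrite mulr_ge0 ?invr_ge0 ?mulr_ge0 ?pi_ge0 //; exact: Rintegral_ge0.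
have IK : circle_average <= K.
  have cg : continuous (fun x => f (circle r x)).
    by move=> x; apply: continuous_comp; [exact: (continuous_circle (expR_ge0 m))|exact: cf].
  have T0 : 0 < 2 * pi :> R by rewrite mulr_gt0 // pi_gt0.
  have [xi [_ E]] := riemann_mean_value cg T0 (ltn0Sn 0).
  by rewrite /circle_average E divr1 big_ord1 mulKf // gt_eqF.
exists (maxn k0 N) => // k /=; rewrite geq_max => /andP[kk0 kN].
rewrite integral_root_measure /= mulrAC divff ?mul1r ?pnatr_eq0 //.
set nu := product_law L k.+1.
have mavg := measurable_root_average k.+1.
have avgK t : `|root_average k.+1 t - circle_average| <= 2 * K.
  have := root_average_ge0 k.+1 t; have := root_average_le k.+1 t => h1 h2.
  by rewrite ler_distl; apply/andP; split; lra.
have iavg : nu.-integrable setT (EFin \o root_average k.+1).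
  apply: (@bounded_integrable _ _ _ nu _ K) => // x.
  by rewrite ger0_norm ?root_average_ge0 ?root_average_le.
have icst : nu.-integrable setT (EFin \o cst circle_average).
  exact: (@bounded_integrable _ _ _ nu _ `|circle_average|).
have nuT : nu setT = 1%E by exact: probability_setT.
pose B := [set t : R[i] | del <= `|ln (normc t) / k.+1%:R - m|].
have mB : measurable B by exact: measurable_log_mean_event.
have -> : circle_average - fine (\int[nu]_t (root_average k.+1 t)%:E) =
   - fine (\int[nu]_t (root_average k.+1 t - circle_average)%:E).
  under [X in _ = - fine X]eq_integral do rewrite EFinB.
  rewrite integralB // integral_cst // [X in (_ - _ * X)%E](_ : _ = 1%E) // mule1.
  by rewrite [X in _ = - X]fineB ?integrable_fin_num // opprB.
have mdist : measurable_fun setT (fun t => root_average k.+1 t - circle_average).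
  exact: measurable_funB.
rewrite normrN -lee_fin -fine_abse; last first.
  by apply: integrable_fin_num => //; apply: (@bounded_integrable _ _ _ nu _ (2 * K)).
rewrite fineK; last first.
  rewrite abse_fin_num; apply: integrable_fin_num => //.
  by apply: (@bounded_integrable _ _ _ nu _ (2 * K)).
apply: le_trans (le_abse_integral _ _ _) _ => //; first exact/measurable_EFinP.
apply: (@le_trans _ _ (\int[nu]_t ((eta / 2)%:E + (2 * K)%:E * (\1_B t)%:E))%E).
  apply: ge0_le_integral => //.
  - by apply: measurableT_comp => //; exact/measurable_EFinP.
  - apply: emeasurable_funD => //; apply: measurable_funeM.
    by apply/measurable_EFinP; exact: measurable_indic.
  move=> t _; rewrite abse_EFin -EFinM -EFinD lee_fin indicE.
  have [_|tB] := boolP (t \in B).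
    by rewrite mulr1; apply: le_trans (avgK t) _; rewrite lerDr ltW.
  rewrite mulr0 addr0; apply: hk0; first exact: leq_trans kk0 (leqnSn k).
  by rewrite ltNge; apply/negP => h; move/negP: tB; apply; apply/mem_set.
have mBi : measurable_fun setT (fun t => (\1_B t)%:E : \bar R).
  by apply/measurable_EFinP; exact: measurable_indic.
rewrite ge0_integralD //; last 3 first.
- by move=> t _; rewrite lee_fin ltW.
- by move=> t _; rewrite -EFinM lee_fin mulr_ge0 ?mulr_ge0.
- exact: measurable_funeM.
rewrite integral_cst // [X in (_ * X + _)%E](_ : _ = 1%E) // mule1.
rewrite ge0_integralZl_EFin ?mulr_ge0 //.
rewrite integral_indic // setIT.
apply: (@le_trans _ _ ((eta / 2)%:E + (2 * K)%:E * (eta / 2 / (2 * K + 1))%:E)%E).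
  apply: leeD => //; apply: lee_wpmul2l; first by rewrite lee_fin mulr_ge0.
  by apply: hN; exact: leq_trans kN (leqnSn k).
rewrite -EFinM -EFinD lee_fin [leRHS]splitr lerD2l mulrCA ler_piMr ?(ltW eta20) //.
by rewrite ler_pdivrMr ?mul1r ?lerDl // ltr_wpDl // mulr_ge0.
Qed.

End RootAverage.

(** * Averages over the cycle sizes of an Ewens permutation *)

Lemma cvg_sum_ord (R : realType) m (f : nat -> nat -> R) (c : nat -> R) :
  (forall k, f k @ \oo --> c k) ->
  (fun n => \sum_(k < m) f k n) @ \oo --> \sum_(k < m) c k.
Proof.
move=> fc; elim: m => [|m IH].
  rewrite big_ord0 (_ : (fun n => _) = fun=> 0); first exact: cvg_cst.
  by apply/funext => n; rewrite big_ord0.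
rewrite big_ord_recr (_ : (fun n => _) = fun n => \sum_(k < m) f k n + f m n).
  exact: cvgD.
by apply/funext => n; rewrite big_ord_recr.
Qed.

Section CycleProb.
Variables (R : realType) (theta : R).
Hypothesis theta_gt0 : 0 < theta.
Notation p := (cycle_prob theta).

Let theta_ge0 : 0 <= theta. Proof. exact: ltW. Qed.
Let theta_nat_gt0 n : 0 < theta + n%:R. Proof. by rewrite ltr_wpDr. Qed.
Let theta_nat_ge0 n : 0 <= theta + n%:R. Proof. exact/ltW. Qed.

Lemma cycle_prob_ge0 n k : 0 <= p n k.
Proof.
elim: n k => [|n IH] [|k] //=; first by rewrite divr_ge0.
by rewrite mulr_ge0 // divr_ge0.
Qed.

Lemma sum_cycle_prob n : \sum_(k < n.+1) p n.+1 k = 1.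
Proof.
elim: n => [|n IH]; first by rewrite big_ord1 /= addr0 divff // gt_eqF.
rewrite big_ord_recl -/(p n.+1) -[X in _ + X]/(\sum_(k < n.+1) n.+1%:R / (theta + n.+1%:R) * p n.+1 k).
rewrite -mulr_sumr IH mulr1 /= -mulrDl divff // gt_eqF //.
Qed.

(** Each step of the recursion multiplies [n%:R * p n k] by at most
[n.+1%:R / n%:R], and these factors telescope. *)
Lemma cycle_prob_le n k : (k.+1 < n)%N -> n%:R * p n k <= theta * (n%:R / (n - k.+1)%:R).
Proof.
elim: n k => [|n IH] [|k] //.
  rewrite ltnS subSS subn0 /= => n0; have nR : 0 < n%:R :> R by rewrite ltr0n.
  rewrite mulrCA ler_wpM2l ?(ltW theta_gt0) // ler_wpM2l // lef_pV2 ?posrE //.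
  by rewrite lerDr.
rewrite ltnS subSS => kn /=; have n0 : (0 < n)%N by apply: leq_ltn_trans kn.
have nR : 0 < n%:R :> R by rewrite ltr0n.
have d0 : 0 < (n - k.+1)%:R :> R by rewrite ltr0n subn_gt0.
have -> : n.+1%:R * (n%:R / (theta + n%:R) * p n k) = (n.+1%:R / (theta + n%:R)) * (n%:R * p n k).
  by ring.
have := IH k kn; rewrite [leRHS]mulrA ler_pdivlMr // => h.
rewrite [leRHS]mulrA ler_pdivlMr // -(mulrA (_ / _)).
have h2 : n.+1%:R / (theta + n%:R) <= n.+1%:R / n%:R :> R.
  by rewrite ler_wpM2l // lef_pV2 ?posrE // lerDr.
apply: (@le_trans _ _ (n.+1%:R / (theta + n%:R) * (theta * n%:R))).
  by rewrite ler_wpM2l // divr_ge0.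
apply: (le_trans (ler_wpM2r _ h2)); first by rewrite mulr_ge0.
by rewrite (_ : _ / _ * _ = theta * n.+1%:R) //; field; rewrite gt_eqF.
Qed.

(** The ratio [n / (n - k.+1)] is at most 2 for cycles of at most half the
points. *)
Lemma cycle_prob_le2 n k : (k.+1.*2 <= n)%N -> n%:R * p n k <= 2 * theta.
Proof.
move=> kn; have k1 : (k.+1 < n)%N by apply: leq_trans kn; rewrite -addnn -[X in (X < _)%N]addn0 ltn_add2l.
apply: (le_trans (cycle_prob_le k1)); rewrite mulrC ler_wpM2r ?(ltW theta_gt0) //.
rewrite ler_pdivrMr ?ltr0n ?subn_gt0 // -natrM ler_nat.
rewrite mulnBr -[X in (X <= _)%N]addn0 mul2n -addnn -addnBA; last first.
  by rewrite mul2n.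
by rewrite leq_add2l.
Qed.

Lemma cycle_prob_cvg k : (fun n => n%:R * p n k) @ \oo --> theta.
Proof.
have inv0 : (fun n : nat => (theta + n%:R)^-1) @ \oo --> (0 : R).
  apply: (@squeeze_cvgr _ _ _ _ (fun=> 0) (fun n => (n%:R)^-1)).
  - exists 1%N => // n /= n1; rewrite invr_ge0 addr_ge0 ?(ltW theta_gt0) //=.
    by rewrite lef_pV2 ?posrE ?ltr_wpDr ?ltr0n // lerDr ltW.
  - exact: cvg_cst.
  - by rewrite -cvg_shiftS; exact: cvg_harmonic.
have ratio : (fun n : nat => n.+1%:R / (theta + n%:R)) @ \oo --> (1 : R).
  have -> : (fun n : nat => n.+1%:R / (theta + n%:R)) =
            (fun n : nat => 1 + (1 - theta) * (theta + n%:R)^-1) :> (nat -> R).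
    apply/funext => n; rewrite -natr1.
    by field; rewrite gt_eqF // ltr_wpDr.
  have : (fun n : nat => 1 + (1 - theta) * (theta + n%:R)^-1) @ \oo --> (1 + (1 - theta) * 0 : R).
    apply: cvgD; first exact: cvg_cst.
    by apply: cvgM; first exact: cvg_cst.
  by rewrite mulr0 addr0.
elim: k => [|k IH]; rewrite -cvg_shiftS /=.
  have -> : (fun n : nat => n.+1%:R * (theta / (theta + n%:R))) =
     (fun n : nat => theta * (n.+1%:R / (theta + n%:R))) by apply/funext => n; rewrite mulrCA.
  have := cvgM (@cvg_cst _ theta _ \oo _) ratio; rewrite mulr1; exact.
have -> : (fun n : nat => n.+1%:R * (n%:R / (theta + n%:R) * p n k)) =
   (fun n : nat => (n.+1%:R / (theta + n%:R)) * (n%:R * p n k)).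
  by apply/funext => n; ring.
by have := cvgM ratio IH; rewrite mul1r; exact.
Qed.

(** The weights have sum 1 and each of them is of order [1 / n], so a bounded
number of indices does not matter. *)
Lemma cycle_average_cvg (y : nat -> R) (K l : R) :
  (forall k, `|y k| <= K) -> y @ \oo --> l ->
  (fun n => \sum_(k < n.+1) p n.+1 k * y k) @ \oo --> l.
Proof.
move=> yK yl; apply/cvgrPdist_le => /= e e0.
have K0 : 0 <= K by apply: le_trans (yK 0%N).
have e20 : 0 < e / 2 by rewrite divr_gt0.
have [k0 _ hk0] := (cvgrPdist_le _ _).1 yl _ e20.
pose M := K + `|l|.
have M0 : 0 <= M by rewrite addr_ge0.
have yM k : `|l - y k| <= M by rewrite distrC; apply: le_trans (ler_normB _ _) _; rewrite lerD2r.
pose c := k0%:R * (2 * theta * M) / (e / 2).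
have c0 : 0 <= c by rewrite divr_ge0 ?(ltW e20) // mulr_ge0 // mulr_ge0 // mulr_ge0 // ltW.
exists (maxn k0.*2 (Num.bound c)) => // n /=; rewrite geq_max => /andP[nk nc].
have n0 : 0 < n.+1%:R :> R by [].
have cn : c <= n.+1%:R.
  by apply: ltW; apply: lt_le_trans (archi_boundP c0) _; rewrite ler_nat (leq_trans nc).
rewrite [X in X - _](_ : l = \sum_(k < n.+1) p n.+1 k * l); last first.
  by rewrite -mulr_suml sum_cycle_prob mul1r.
rewrite -sumrB.
apply: le_trans (ler_norm_sum _ _ _) _.
apply: (@le_trans _ _ (\sum_(k < n.+1) ((if (k < k0)%N then 2 * theta * M / n.+1%:R else 0)
    + p n.+1 k * (e / 2)))).
  apply: ler_sum => k _; rewrite -mulrBr normrM ger0_norm ?cycle_prob_ge0 //.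
  case: ltnP => kk0.
    rewrite -[leLHS]addr0; apply: lerD; last by rewrite mulr_ge0 ?cycle_prob_ge0 // ltW.
    rewrite ler_pdivlMr // mulrAC ler_pM ?mulr_ge0 ?cycle_prob_ge0 //.
    rewrite mulrC cycle_prob_le2 // (leq_trans _ (leqnSn n)) // (leq_trans _ nk) //.
    by rewrite leq_double.
  by rewrite add0r ler_wpM2l ?cycle_prob_ge0 //; exact: hk0.
rewrite big_split /= -mulr_suml sum_cycle_prob mul1r [leRHS]splitr lerD2r.
rewrite -big_mkcond /=.
apply: (@le_trans _ _ (\sum_(k < k0) 2 * theta * M / n.+1%:R)).
  have k0n : (k0 <= n.+1)%N.
    by apply: leq_trans (leq_trans nk (leqnSn n)); rewrite -addnn leq_addr.
  by rewrite (big_ord_widen _ (fun=> 2 * theta * M / n.+1%:R) k0n).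
rewrite sumr_const card_ord -[leLHS]mulr_natl [leLHS]mulrA ler_pdivrMr //.
by move: cn; rewrite /c ler_pdivrMr // mulrC [leRHS]mulrC.
Qed.

(** Telescoping of [1 / (k (k + 1))]. *)
Lemma sum_inv_sqr_le m n : (0 < m)%N -> (m <= n)%N ->
  \sum_(m <= k < n) (k.+1%:R ^+ 2)^-1 <= m%:R^-1 :> R.
Proof.
move=> m0 mn; apply: (@le_trans _ _ (m%:R^-1 - n%:R^-1)); last by rewrite gerBl invr_ge0.
elim: n mn => [|n IH]; first by rewrite leqn0 => /eqP mE; rewrite mE in m0.
rewrite leq_eqVlt => /orP[/eqP ->|]; first by rewrite big_geq // subrr.
rewrite ltnS => mn; rewrite big_nat_recr //=; have := IH mn.
have n0 : 0 < n%:R :> R by rewrite ltr0n (leq_trans m0).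
have : (n.+1%:R ^+ 2)^-1 <= n%:R^-1 - n.+1%:R^-1 :> R.
  have -> : n%:R^-1 - n.+1%:R^-1 = (n.+1%:R * n%:R)^-1 :> R.
    have n1 : n%:R + 1 != 0 :> R by rewrite natr1 pnatr_eq0.
    by rewrite -[n.+1%:R]natr1; field; rewrite ?n1 gt_eqF.
  by rewrite lef_pV2 ?posrE ?exprn_gt0 ?mulr_gt0 // expr2 ler_pM2l // ler_nat.
by move=> hv hs; apply: le_trans (lerD hs hv) _; rewrite addrA subrK.
Qed.

(** A dominated convergence.  The coefficients tend to [theta] for each [k], and the
tail is uniformly small: for [k.+1.*2 <= n] the coefficient is at most [2 * theta] and
[z k] is summable, while for larger [k] one has [z k <= 4 * D / n ^ 2] and the
coefficients have sum [n]. *)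
Lemma cycle_sum_cvg (z : nat -> R) (D l : R) :
  (forall k, 0 <= z k <= D / k.+1%:R ^+ 2) ->
  (fun n => \sum_(k < n) theta * z k) @ \oo --> l ->
  (fun n => \sum_(k < n.+1) n.+1%:R * p n.+1 k * z k) @ \oo --> l.
Proof.
move=> zD sl; apply/cvgrPdist_le => /= e e0.
have D0 : 0 <= D.
  by have /andP[h1 h2] := zD 0%N; move: (le_trans h1 h2); rewrite expr1n divr1.
have z0 k : 0 <= z k by have /andP[] := zD k.
have e40 : 0 < e / 4 by rewrite divr_gt0.
have [m1 _ hm1] := (cvgrPdist_le _ _).1 sl _ e40.
pose c := 2 * theta * D / (e / 4).
have c0 : 0 <= c by rewrite divr_ge0 ?(ltW e40) // mulr_ge0 // mulr_ge0 // ltW.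
(* m is chosen so that the head of the series is close to l, and so that the first
   part of the tail is small. *)
pose m := (maxn m1 (Num.bound c)).+1.
have mR : 0 < m%:R :> R by [].
have cm : 2 * theta * D / m%:R <= e / 4.
  rewrite ler_pdivrMr // [leRHS]mulrC -ler_pdivrMr //; apply: ltW.
  apply: lt_le_trans (archi_boundP c0) _; rewrite ler_nat /m ltnW // ltnS.
  exact: leq_maxr.
have fin : (fun n => \sum_(k < m) `|n%:R * p n k - theta| * z k) @ \oo --> (0 : R).
  have h k : (fun n => `|n%:R * p n k - theta| * z k) @ \oo --> `|theta - theta| * z k.
    apply: cvgM; last exact: cvg_cst.
    by apply: cvg_norm; apply: cvgB; [exact: cycle_prob_cvg|exact: cvg_cst].
  have := @cvg_sum_ord R m _ _ h.
  by rewrite (eq_bigr (fun=> 0)) ?big1_eq // => k _; rewrite subrr normr0 mul0r.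
have [n1 _ hn1] := (cvgrPdist_le _ _).1 fin _ e40.
pose c' := 4 * D / (e / 4).
have c'0 : 0 <= c' by rewrite divr_ge0 ?(ltW e40) // mulr_ge0.
exists (maxn (maxn n1 m.*2) (Num.bound c')) => // n' /=.
rewrite !geq_max -andbA => /and3P[n1n mn cn]; set n := n'.+1.
have nR : 0 < n%:R :> R by [].
have c'n : 4 * D / n%:R <= e / 4.
  rewrite ler_pdivrMr // [leRHS]mulrC -ler_pdivrMr //; apply: ltW.
  apply: lt_le_trans (archi_boundP c'0) _; rewrite ler_nat /n.
  exact: leq_trans cn (leqnSn _).
have mn' : (m <= n)%N.
  by apply: leq_trans (leq_trans mn (leqnSn n')); rewrite -addnn leq_addr.
have hS : `|l - \sum_(k < m) theta * z k| <= e / 4.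
  by apply: hm1; rewrite /= /m ltnW // ltnS leq_maxl.
have hF : \sum_(k < m) `|n%:R * p n k - theta| * z k <= e / 4.
  have := hn1 n (leq_trans n1n (leqnSn _)); rewrite sub0r normrN ger0_norm //.
  by apply: sumr_ge0 => k _; rewrite mulr_ge0.
have split_sum : \sum_(k < n) n%:R * p n k * z k =
    \sum_(k < m) n%:R * p n k * z k + \sum_(m <= k < n) n%:R * p n k * z k.
  by rewrite -(big_mkord xpredT (fun k => n%:R * p n k * z k)) (big_cat_nat (n := m)) //= big_mkord.
have tail_ge0 : 0 <= \sum_(m <= k < n) n%:R * p n k * z k.
  by apply: sumr_ge0 => k _; rewrite mulr_ge0 // mulr_ge0 // cycle_prob_ge0.
have tail : \sum_(m <= k < n) n%:R * p n k * z k <= e / 4 + e / 4.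
  apply: (@le_trans _ _ (\sum_(m <= k < n) (2 * theta * D * (k.+1%:R ^+ 2)^-1 +
      4 * D / n%:R * p n k))).
    apply: ler_sum => k _; have /andP[_ zk] := zD k.
    have [kn|kn] := leqP k.+1.*2 n.
      rewrite -[leLHS]addr0; apply: lerD; last first.
        by rewrite mulr_ge0 ?cycle_prob_ge0 // divr_ge0 // mulr_ge0.
      rewrite -[leRHS]mulrA; apply: ler_pM => //.
        by rewrite mulr_ge0 ?cycle_prob_ge0.
      by rewrite cycle_prob_le2.
    rewrite -[leLHS]add0r; apply: lerD.
      by rewrite mulr_ge0 ?invr_ge0 ?sqr_ge0 // mulr_ge0 // mulr_ge0 // ltW.
    have -> : 4 * D / n%:R * p n k = n%:R * p n k * (D * (2 / n%:R) ^+ 2).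
      by field; rewrite gt_eqF.
    apply: ler_wpM2l; first by rewrite mulr_ge0 ?cycle_prob_ge0.
    apply: (le_trans zk); apply: ler_wpM2l => //.
    rewrite -exprVn lerXn2r ?nnegrE ?invr_ge0 ?divr_ge0 //.
    rewrite ler_pdivlMr // mulrC ler_pdivrMr // -natrM ler_nat.
    by rewrite mul2n ltnW.
  rewrite big_split /= -!mulr_sumr; apply: lerD.
    apply: le_trans cm; apply: ler_wpM2l; first by rewrite mulr_ge0 // mulr_ge0 // ltW.
    exact: sum_inv_sqr_le.
  apply: le_trans c'n; rewrite ler_piMr ?divr_ge0 ?mulr_ge0 //.
  rewrite -[leRHS](sum_cycle_prob n') -(big_mkord xpredT (fun k => p n k)).
  rewrite [leRHS](big_cat_nat (n := m)) // lerDr.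
  by apply: sumr_ge0 => k _; exact: cycle_prob_ge0.
have head : `|\sum_(k < m) theta * z k - \sum_(k < m) n%:R * p n k * z k| <= e / 4.
  apply: le_trans hF; rewrite -sumrB; apply: le_trans (ler_norm_sum _ _ _) _.
  by apply: ler_sum => k _; rewrite -mulrBl normrM (ger0_norm (z0 k)) distrC.
rewrite split_sum; move: hS head tail tail_ge0; rewrite !ler_distl.
move: (\sum_(k < m) theta * z k) (\sum_(k < m) _) (\sum_(m <= k < n) _) => A B C.
by move=> /andP[h1 h2] /andP[h3 h4] h5 h6; apply/andP; split; lra.
Qed.

End CycleProb.

(** * Mixtures of measures and weak convergence *)

Section SetFunctionIntegral.
Local Open Scope ereal_scope.
Context d (T : measurableType d) (R : realType).
Import HBNNSimple.

(** The mean measures are set functions known only on measurable sets.  This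
suffices, as simple functions have measurable level sets. *)
Lemma eq_set_function_integral (m1 m2 : set T -> \bar R) D (f : T -> \bar R) :
  (forall A, measurable A -> m1 A = m2 A) ->
  \int[m1]_(x in D) f x = \int[m2]_(x in D) f x.
Proof.
move=> m12; have E (h : {nnsfun T >-> R}) : sintegral m1 h = sintegral m2 h.
  by apply: eq_fsbigr => x _; rewrite m12.
rewrite /integral; congr (ereal_sup _ - ereal_sup _);
  by apply/seteqP; split => _ [h hf <-]; exists h.
Qed.

End SetFunctionIntegral.

Section FinitePacking.
Local Open Scope ereal_scope.
Context d (T : measurableType d) (R : realType) (m : {measure set T -> \bar R}).

Lemma is_finite_measureP (nu : set T -> \bar R) :
  (forall A, measurable A -> nu A = m A) -> m setT < +oo -> is_finite_measure nu.
Proof.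
move=> nuE moo; exists (mfrestr measurableT moo) => A mA.
by rewrite nuE // -[RHS]/(m (A `&` setT)) setIT.
Qed.

Definition probability_of of m setT = 1 : set T -> \bar R := m.

Section ProbabilityOf.
Hypothesis m1 : m setT = 1.
HB.instance Definition _ := isMeasure.Build _ _ _ (probability_of m1)
  (measure0 m) (@measure_ge0 _ _ _ m) (@measure_semi_sigma_additive _ _ _ m).
HB.instance Definition _ := Measure_isProbability.Build _ _ _ (probability_of m1) m1.

Lemma is_probabilityP (nu : set T -> \bar R) :
  (forall A, measurable A -> nu A = m A) -> is_probability nu.
Proof. by move=> nuE; exists (probability_of m1) => A mA; rewrite nuE. Qed.

End ProbabilityOf.
End FinitePacking.

Section WeakConvergence.
Variable R : realType.
Local Open Scope ereal_scope.

Lemma measurable_continuous_EFin (f : R[i] -> R) :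
  continuous f -> measurable_fun setT (EFin \o f).
Proof. by move=> cf; apply/measurable_EFinP; exact: continuous_measurableC. Qed.

Lemma continuous_addl (f : R[i] -> R) (B : R) : continuous f -> continuous (fun z => B + f z)%R.
Proof.
move=> cf z A /nbhs_ballP[e e0 eA].
apply: (cf z [set v | A (B + v)%R]); apply/nbhs_ballP; exists e => // v /= zv.
by apply: eA; move: zv; rewrite /ball /= opprD addrACA subrr add0r.
Qed.

(** Adding a constant reduces the test functions to nonnegative ones, provided
the masses converge, which is the case of a constant test function. *)
Lemma weakly_convergesP (m_ : nat -> set R[i] -> \bar R) (m : set R[i] -> \bar R)
    (nu_ : nat -> {measure set R[i] -> \bar R}) (nu : {measure set R[i] -> \bar R}) :
  (forall n A, measurable A -> m_ n A = nu_ n A) ->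
  (forall A, measurable A -> m A = nu A) ->
  (forall n, nu_ n setT < +oo) -> nu setT < +oo ->
  (forall (f : R[i] -> R) (K : R), continuous f -> (forall z, 0 <= f z)%R ->
     (forall z, f z <= K)%R ->
     (fun n => \int[nu_ n]_z (f z)%:E) @ \oo --> \int[nu]_z (f z)%:E) ->
  weakly_converges m_ m.
Proof.
move=> m_E mE nu_oo nuoo H; split.
- by move=> n; apply: is_finite_measureP (m_E n) (nu_oo n).
- exact: is_finite_measureP mE nuoo.
move=> f cf [B fB].
have B0 : (0 <= B)%R by apply: le_trans (fB 0%R).
rewrite (eq_set_function_integral _ _ mE).
have -> : (fun n => \int[m_ n]_z (f z)%:E) = (fun n => \int[nu_ n]_z (f z)%:E).
  by apply/funext => n; exact: eq_set_function_integral (m_E n).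
have ifin (p : {measure set R[i] -> \bar R}) (g : R[i] -> R) (K : R) :
    p setT < +oo -> continuous g -> (forall z, `|g z| <= K)%R -> p.-integrable setT (EFin \o g).
  move=> poo cg gK; apply: measurable_bounded_integrable => //.
    exact: continuous_measurableC.
  exists K; split; first exact: num_real.
  by move=> x Kx y _ /=; apply: le_trans (gK y) (ltW Kx).
have cB : continuous (cst B : R[i] -> R).
  by move=> z A /nbhs_singleton AB; apply/nbhs_normcP; exists 1%R => // w _; exact: AB.
have cBf := @continuous_addl f B cf.
have fB' z : (0 <= B + f z <= 2 * B)%R.
  by have := fB z; rewrite ler_norml => /andP[h1 h2]; apply/andP; split; lra.
have E (p : {measure set R[i] -> \bar R}) : p setT < +oo ->
    \int[p]_z (f z)%:E = \int[p]_z (B + f z)%:E - \int[p]_z (cst B z)%:E.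
  move=> poo; rewrite -integralB //.
  - by apply: eq_integral => z _; rewrite -EFinB addrAC subrr add0r.
  - apply: (ifin _ _ (2 * B)%R) => // z; have /andP[h1 h2] := fB' z.
    by rewrite ger0_norm.
  - by apply: (ifin _ _ `|B|%R).
rewrite E //; under eq_fun => n do rewrite E //.
apply: cvgeB.
- apply: fin_num_adde_defl; rewrite fin_numN; apply: integrable_fin_num => //.
  by apply: (ifin _ _ `|B|%R).
- by apply: (H _ (2 * B)%R) => // z; have /andP[] := fB' z.
- exact: (H _ B).
Qed.

End WeakConvergence.

Section RootMixtures.
Variables (R : realType).
Local Open Scope ereal_scope.
Variable nu_ : nat -> {measure set R[i] -> \bar R}.

Definition mixture (c : nat -> {nonneg R}) N : {measure set R[i] -> \bar R} :=
  msum (fun k => mscale (c k) (nu_ k)) N.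

Lemma integral_mixture c N (f : R[i] -> \bar R) : measurable_fun setT f ->
  (forall z, 0 <= f z) ->
  \int[mixture c N]_z f z = \sum_(k < N) ((c k)%:num)%:E * \int[nu_ k]_z f z.
Proof.
move=> mf f0; rewrite ge0_integral_measure_sum //; apply: eq_bigr => k _.
by rewrite ge0_integral_mscale.
Qed.

Definition infinite_mixture (c : nat -> {nonneg R}) : {measure set R[i] -> \bar R} :=
  mseries (fun k => mscale (c k) (nu_ k)) 0.

Lemma integral_infinite_mixture c (f : R[i] -> \bar R) : measurable_fun setT f ->
  (forall z, 0 <= f z) ->
  \int[infinite_mixture c]_z f z = \sum_(k <oo) ((c k)%:num)%:E * \int[nu_ k]_z f z.
Proof.
move=> mf f0; rewrite ge0_integral_measure_series //; apply: eq_eseriesr => k _.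
by rewrite ge0_integral_mscale.
Qed.

End RootMixtures.

(** * Convergence of the mixtures of root measures *)

Section UniformCircle.
Variable R : realType.
Local Open Scope ereal_scope.

Definition circle_point (r : R) : measurableTypeR R -> R[i] :=
  fun t : R => Complex (r * cos t)%R (r * sin t)%R.

Lemma measurable_circle_point r : measurable_fun setT (circle_point r).
Proof.
apply: measurable_fun_Complex; apply: measurable_funM => //;
  apply: continuous_measurable_fun; [exact: continuous_cos|exact: continuous_sin].
Qed.

HB.instance Definition _ r :=
  isMeasurableFun.Build _ _ _ _ (circle_point r) (measurable_circle_point r).

Definition uniform_circle_law r : probability R[i] R :=
  distribution (uniform_prob (@two_pi_gt0 R)) (circle_point r).

(** The density of the uniform law turns the integral into [circle_average]. *)
Lemma integral_uniform_circle (m : R) (f : R[i] -> R) :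
  continuous f -> (forall z, 0 <= f z)%R ->
  \int[uniform_circle_law (expR m)]_z (f z)%:E = (circle_average f m)%:E.
Proof.
move=> cf f0.
have mf := measurable_continuous_EFin cf.
rewrite ge0_integral_distribution //.
rewrite integral_uniform //; last 2 first.
- by apply: (measurableT_comp mf); exact: measurable_circle_point.
- by move=> t; rewrite lee_fin.
have cg : continuous (fun x => f (circle (expR m) x)).
  by move=> x; apply: continuous_comp; [exact: (continuous_circle (expR_ge0 m))|exact: cf].
rewrite subr0 /circle_average EFinM; congr (_ * _).
rewrite /Rintegral fineK; last first.
  apply: integrable_fin_num => //.
  apply: (@continuous_compact_integrable R (fun x => f (circle (expR m) x))).
    exact: segment_compact.
  exact: continuous_subspaceT.
by apply: eq_integral => x _; rewrite /= circleE.
Qed.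

End UniformCircle.

Lemma integral_bounded_le (R : realType) (mu : {measure set R[i] -> \bar R})
    (f : R[i] -> R) (K : R) : continuous f ->
  (forall z, 0 <= f z) -> (forall z, f z <= K) ->
  (\int[mu]_z (f z)%:E <= K%:E * mu setT)%E.
Proof.
move=> cf f0 fK; have K0 : 0 <= K by apply: le_trans (f0 0) (fK 0).
have mf := measurable_continuous_EFin cf.
have f0E z : [set: R[i]] z -> (0 <= (f z)%:E)%E by rewrite lee_fin.
have fKE z : [set: R[i]] z -> ((f z)%:E <= K%:E)%E by rewrite lee_fin.
by rewrite -integral_cst //; exact: ge0_le_integral.
Qed.

Section MeanMixture.
Local Open Scope ereal_scope.
Variables (R : realType) (theta : R) (L : probability R[i] R).
Hypothesis theta_gt0 : (0 < theta)%R.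
Hypothesis L0 : L [set 0%R] = 0.
Notation p := (cycle_prob theta).
Notation nu k := (root_measure L k.+1).

Lemma cycle_coef_ge0 n k : (0 <= n%:R * p n k / k.+1%:R)%R.
Proof. by rewrite divr_ge0 // mulr_ge0 // cycle_prob_ge0. Qed.

Definition cycle_coef n k : {nonneg R} := NngNum (cycle_coef_ge0 n k).

Lemma limit_coef_ge0 k : (0 <= theta / k.+1%:R)%R.
Proof. by rewrite divr_ge0 // ltW. Qed.

Definition limit_coef k : {nonneg R} := NngNum (limit_coef_ge0 k).

(** [sum_ewens_porbits] applied to the mean of the spectral measure. *)
Lemma mean_spectral_mixture N d (Omega : measurableType d) (P : probability Omega R)
    (M : {RV P >-> 'M[R[i]]_N}) A :
  follows_ensemble theta L P M -> measurable A ->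
  mean_measure P (fun w => spectral_measure (M w)) A =
  \sum_(k < N) (N%:R * p N k / k.+1%:R)%:E * nu k A.
Proof.
move=> hM mA; rewrite (mean_spectral_measure L0 hM mA).
pose g k := fine (root_measure L k A).
have gE k : root_measure L k A = (g k)%:E by rewrite fineK // root_measure_fin_num.
under eq_bigr => t _.
  under eq_bigr do rewrite gE.
  rewrite sumEFin -EFinM.
  over.
rewrite sumEFin sum_ewens_porbits // -sumEFin.
by apply: eq_bigr => k _; rewrite gE -EFinM.
Qed.

Variables (m : R).
Hypothesis lln : forall e eta : R, (0 < e)%R -> (0 < eta)%R ->
  exists N : nat, forall k, (N <= k)%N ->
  product_law L k [set t | (e <= `|ln (normc t) / k%:R - m|)%R] <= eta%:E.

Lemma normalized_coef_ge0 n k : (0 <= p n k / k.+1%:R)%R.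
Proof. by rewrite divr_ge0 // cycle_prob_ge0. Qed.

Definition normalized_coef n k : {nonneg R} := NngNum (normalized_coef_ge0 n k).

Lemma integral_root_measure_fin_num (f : R[i] -> R) (K : R) k : continuous f ->
  (forall z, 0 <= f z)%R -> (forall z, f z <= K)%R ->
  \int[root_measure L k]_z (f z)%:E \is a fin_num.
Proof. by move=> cf f0 fK; rewrite (integral_root_measure cf f0 fK). Qed.

(** The integral against the mixture is the average, with weights [p n.+1 k], of
the integrals against [root_measure L k.+1] divided by its mass [k.+1]. *)
Lemma normalized_mixture_cvg (f : R[i] -> R) (K : R) : continuous f ->
  (forall z, 0 <= f z)%R -> (forall z, f z <= K)%R ->
  (fun n => \int[mixture (fun k => nu k) (normalized_coef n.+1) n.+1]_z (f z)%:E) @ \oo -->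
  \int[uniform_circle_law (expR m)]_z (f z)%:E.
Proof.
move=> cf f0 fK; rewrite integral_uniform_circle //.
pose y k := (fine (\int[nu k]_z (f z)%:E) / k.+1%:R)%R.
have yK k : (`|y k| <= K)%R.
  have K0 : (0 <= K)%R by apply: le_trans (f0 0%R) (fK 0%R).
  have i0 : (0 <= fine (\int[nu k]_z (f z)%:E))%R.
    by apply: fine_ge0; apply: integral_ge0 => z _; rewrite lee_fin.
  rewrite ger0_norm ?divr_ge0 // ler_pdivrMr // -lee_fin fineK; last first.
    exact: (integral_root_measure_fin_num _ cf f0 fK).
  apply: le_trans (integral_bounded_le _ cf f0 fK) _.
  by rewrite -[X in _ * X]/(root_measure L k.+1 setT) root_measureT.
have yl : y @ \oo --> circle_average f m by exact: root_measure_average_cvg.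
have := cycle_average_cvg theta_gt0 yK yl.
have -> : (fun n => \int[mixture (fun k => nu k) (normalized_coef n.+1) n.+1]_z (f z)%:E) =
   EFin \o (fun n => \sum_(k < n.+1) p n.+1 k * y k)%R.
  apply/funext => n; rewrite integral_mixture //.
    rewrite /comp -sumEFin; apply: eq_bigr => k _.
    rewrite /y -[X in _ * X]fineK ?(integral_root_measure_fin_num _ cf f0 fK) // -EFinM.
    congr (_%:E); rewrite (_ : (normalized_coef n.+1 k)%:num = p n.+1 k / k.+1%:R)%R //.
    by rewrite [LHS]mulrAC [RHS]mulrA.
  exact: (measurable_continuous_EFin cf).
by move=> h; apply: cvg_EFin; [exact: nearW|exact: h].
Qed.

Section Restriction.
Variables (r1 r2 C : R).
Hypotheses (r10 : (0 < r1)%R) (r1m : (r1 < expR m)%R) (mr2 : (expR m < r2)%R).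
Let E := [set z : R[i] | ~ (r1 < normc z < r2)%R].
Hypothesis C0 : (0 < C)%R.
(* The half-width on the logarithmic scale of the largest window centred at m that is
   contained in the annulus. *)
Let eps := Num.min (m - ln r1)%R (ln r2 - m)%R.
Hypothesis hC : forall k, (0 < k)%N ->
  product_law L k [set t | (eps <= `|ln (normc t) / k%:R - m|)%R] <= (C / k%:R ^+ 2)%:E.

Lemma log_window_gt0 : (0 < eps)%R.
Proof.
have r20 : (0 < r2)%R by apply: lt_trans mr2; exact: expR_gt0.
rewrite lt_min !subr_gt0 -{1}(expRK m) ltr_ln ?posrE ?expR_gt0 // r1m.
by rewrite -[X in (X < _)%R](expRK m) ltr_ln ?posrE ?expR_gt0.
Qed.

Lemma measurable_restriction_set : measurable E.
Proof.
rewrite (_ : E = ~` (@normc R @^-1` `]r1, r2[%classic)).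
  apply: measurableC; rewrite -[X in measurable X]setTI.
  by apply: (@measurable_normc R).
by apply/seteqP; split => z /=; rewrite in_itv.
Qed.

Let mE := measurable_restriction_set.

(** All the [k.+1] roots have the same modulus, and it leaves the annulus only in
the event bounded by the hypothesis: the mass is at most [k.+1] times
[C / k.+1 ^ 2]. *)
Lemma root_measure_restriction_le k : nu k E <= (C / k.+1%:R)%:E.
Proof.
have r20 : (0 < r2)%R by apply: lt_trans mr2; exact: expR_gt0.
rewrite root_measureE.
apply: (@le_trans _ _ (\sum_(j < k.+1) (C / k.+1%:R ^+ 2)%:E)); last first.
  rewrite sumEFin sumr_const card_ord lee_fin -mulr_natl.
  by rewrite le_eqVlt; apply/orP; left; apply/eqP; field; rewrite addrC natr1 pnatr_eq0.
apply: lee_sum => j _; apply: le_trans (hC (ltn0Sn k)).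
apply: le_measure; rewrite ?inE.
- by rewrite -[X in measurable X]setTI; apply: measurable_croot.
- exact: measurable_log_mean_event.
move=> t h; rewrite /= leNgt; apply/negP => ht; apply: h; rewrite normc_croot.
set u := (ln (normc t) / k.+1%:R)%R in ht *.
move: ht; rewrite /eps lt_min => /andP[].
rewrite !ltr_norml => /andP[h1 _] /andP[_ h2].
rewrite -[X in (X < _ < _)%R]lnK ?posrE // -[X in (_ < _ < X)%R]lnK ?posrE //.
by rewrite !ltr_expR; apply/andP; split; lra.
Qed.

Definition restricted_root_measure k : {measure set R[i] -> \bar R} :=
  mrestr (nu k) mE.

Lemma integral_restricted_root_measure_le (f : R[i] -> R) (K : R) k : continuous f ->
  (forall z, 0 <= f z)%R -> (forall z, f z <= K)%R ->
  \int[restricted_root_measure k]_z (f z)%:E <= (K * (C / k.+1%:R))%:E.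
Proof.
move=> cf f0 fK; have K0 : (0 <= K)%R by apply: le_trans (f0 0%R) (fK 0%R).
apply: le_trans (integral_bounded_le _ cf f0 fK) _.
rewrite EFinM; apply: lee_wpmul2l; first by rewrite lee_fin.
rewrite -[X in X <= _]/(nu k (setT `&` E)) setTI; exact: root_measure_restriction_le.
Qed.

(** The bounds of order [1 / k] on the restricted root measures and the
coefficients of order [1 / k] give a series dominated by the inverse squares, to
which [cycle_sum_cvg] applies. *)
Lemma restricted_mixture_cvg (f : R[i] -> R) (K : R) : continuous f ->
  (forall z, 0 <= f z)%R -> (forall z, f z <= K)%R ->
  \int[infinite_mixture restricted_root_measure limit_coef]_z (f z)%:E \is a fin_num /\
  (fun n => \int[mixture restricted_root_measure (cycle_coef n.+1) n.+1]_z (f z)%:E) @ \oo -->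
  \int[infinite_mixture restricted_root_measure limit_coef]_z (f z)%:E.
Proof.
move=> cf f0 fK; have K0 : (0 <= K)%R by apply: le_trans (f0 0%R) (fK 0%R).
have mf := measurable_continuous_EFin cf.
have f0E z : 0 <= (f z)%:E by rewrite lee_fin.
pose x k := \int[restricted_root_measure k]_z (f z)%:E.
have x0 k : 0 <= x k by exact: integral_ge0.
have xle k : x k <= (K * (C / k.+1%:R))%:E by exact: integral_restricted_root_measure_le.
have xfin k : x k \is a fin_num.
  by rewrite ge0_fin_numE //; apply: le_lt_trans (xle k) _; rewrite ltry.
pose z k := (fine (x k) / k.+1%:R)%R.
have zD k : (0 <= z k <= (K * C) / k.+1%:R ^+ 2)%R.
  rewrite divr_ge0 ?fine_ge0 //= ler_pdivrMr //.
  have -> : (K * C / k.+1%:R ^+ 2 * k.+1%:R = K * (C / k.+1%:R))%R.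
    by field; rewrite addrC natr1 pnatr_eq0.
  by rewrite -lee_fin fineK.
pose S n := (\sum_(k < n) theta * z k)%R.
have tz0 k : (0 <= theta * z k)%R.
  by rewrite mulr_ge0 ?(ltW theta_gt0) //; have /andP[] := zD k.
have Snd : nondecreasing_seq S.
  apply/nondecreasing_seqP => n; rewrite /S big_ord_recr /= lerDl; exact: tz0.
have KC0 : (0 <= K * C)%R by rewrite mulr_ge0 // ltW.
have Sub : has_ubound (range S).
  exists (theta * (K * C) + theta * (K * C))%R => _ [n _ <-].
  apply: (@le_trans _ _ (S n.+1)); first exact: Snd.
  rewrite /S -(big_mkord xpredT (fun k => theta * z k)%R) big_ltn //.
  have tzD k : (theta * z k <= theta * (K * C) * (k.+1%:R ^+ 2)^-1)%R.
    by rewrite -mulrA ler_wpM2l ?(ltW theta_gt0) //; have /andP[] := zD k.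
  apply: lerD; first by apply: le_trans (tzD 0%N) _; rewrite expr1n invr1 mulr1.
  apply: (@le_trans _ _ (\sum_(1 <= k < n.+1) theta * (K * C) * (k.+1%:R ^+ 2)^-1)%R).
    by apply: ler_sum => k _; exact: tzD.
  rewrite -mulr_sumr ler_piMr //; first by rewrite mulr_ge0 ?(ltW theta_gt0).
  by apply: le_trans (sum_inv_sqr_le R (ltn0Sn 0) (ltn0Sn n)) _; rewrite invr1.
have Scvg : cvgn S by exact: nondecreasing_is_cvgn.
have intE : \int[infinite_mixture restricted_root_measure limit_coef]_z (f z)%:E = (limn S)%:E.
  rewrite integral_infinite_mixture //.
  transitivity (\sum_(k <oo) (theta * z k)%:E).
    apply: eq_eseriesr => k _; rewrite -/(x k) -[x k]fineK // -EFinM; congr (_%:E).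
    rewrite (_ : (limit_coef k)%:num = theta / k.+1%:R)%R //.
    by rewrite [LHS]mulrAC [RHS]mulrA.
  rewrite -EFin_lim //; apply/congr_lim/funext => n.
  by rewrite /= big_mkord sumEFin.
rewrite intE; split => //.
have := cycle_sum_cvg theta_gt0 zD Scvg.
have -> : (fun n => \int[mixture restricted_root_measure (cycle_coef n.+1) n.+1]_z (f z)%:E) =
   EFin \o (fun n => \sum_(k < n.+1) n.+1%:R * p n.+1 k * z k)%R.
  apply/funext => n; rewrite integral_mixture // /comp -sumEFin; apply: eq_bigr => k _.
  rewrite -/(x k) -[x k]fineK // -EFinM; congr (_%:E).
  rewrite (_ : (cycle_coef n.+1 k)%:num = n.+1%:R * p n.+1 k / k.+1%:R)%R //.
  by rewrite [LHS]mulrAC [RHS]mulrA.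
by move=> h; apply: cvg_EFin; [exact: nearW|exact: h].
Qed.

End Restriction.
End MeanMixture.

(** * Transfer to the law of Z and conclusion *)

Section Transfer.
Local Open Scope ereal_scope.
Variables (R : realType) (L : probability R[i] R).
Context dZ (OmegaZ : measurableType dZ) (PZ : probability OmegaZ R) (Z : {RV PZ >-> R[i]}).
Hypothesis hZ : has_law PZ Z L.
Hypothesis logZ_int : PZ.-integrable setT (EFin \o (fun w => ln (normc (Z w)))).

Let lawZ A : measurable A -> A `<=` setT -> distribution PZ Z A = L A.
Proof. by move=> mA _; exact: hZ. Qed.

Lemma integrable_log_law : L.-integrable setT (EFin \o (fun t => ln (normc t))).
Proof.
have mln : measurable_fun setT (EFin \o (fun t : R[i] => ln (normc t))).
  by apply/measurable_EFinP; exact: measurable_ln_normc.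
have mabs : measurable_fun setT (fun t : R[i] => `|(ln (normc t))%:E|).
  by apply: measurableT_comp.
apply/integrableP; split => //.
rewrite -(eq_measure_integral _ lawZ) ge0_integral_distribution //.
by have /integrableP[] := logZ_int.
Qed.

Lemma expectation_log_law :
  fine 'E_PZ[fun w => ln (normc (Z w))] = fine (\int[L]_t (ln (normc t))%:E).
Proof.
rewrite unlock -(eq_measure_integral _ lawZ) integral_distribution //.
by apply/measurable_EFinP; exact: measurable_ln_normc.
Qed.

End Transfer.

Section ClassU.
Local Open Scope ereal_scope.
Variables (R : realType) (theta : R) (L : probability R[i] R).
Hypothesis L0 : L [set 0%R] = 0.
Context d (Omega : measurableType d) (P : probability Omega R).
Variables (a : nat -> {RV P >-> nat}) (T : nat -> nat -> {RV P >-> R[i]}).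
Hypothesis haT : limit_variables theta L a T.
Context dZ (OmegaZ : measurableType dZ) (PZ : probability OmegaZ R) (Z : {RV PZ >-> R[i]}).
Hypothesis hZ : has_law PZ Z L.

(** The class is a property of independent copies of [ln (normc Z)] on any
probability space; the variables [ln (normc (T 1 k.+1))] are such copies. *)
Lemma class_U_product_law : class_U 2 PZ (fun w => ln (normc (Z w))) ->
  forall eps : R, (0 < eps)%R -> exists2 C : R, (0 < C)%R & forall k, (0 < k)%N ->
  product_law L k [set t | (eps <= `|ln (normc t) / k%:R -
     fine 'E_PZ[fun w => ln (normc (Z w))]|)%R] <= (C / k%:R ^+ 2)%:E.
Proof.
move=> [_ hU] eps eps0.
have mln := @measurable_ln_normc R.
have mY k : measurable_fun setT (fun w => ln (normc (T 1%N k.+1 w))).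
  exact: (measurableT_comp mln).
pose Y k : {RV P >-> R} := HB.pack (fun w => ln (normc (T 1%N k.+1 w)))
  (isMeasurableFun.Build _ _ _ _ _ (mY k)).
have hY k : has_law P (Y k) (pushforward PZ (fun w => ln (normc (Z w)))).
  move=> A mA.
  have mB : measurable ((fun t : R[i] => ln (normc t)) @^-1` A).
    by rewrite -[X in measurable X]setTI; exact: mln.
  by rewrite -[RHS]/(PZ (Z @^-1` ((fun t : R[i] => ln (normc t)) @^-1` A))) hZ // -(law_T1 haT k mB).
have iY : independent_rvs P (fun k => Y k : Omega -> R).
  move=> s E us hE; apply: (independent_T1 haT us) => i si; split => //.
  have [_ [A mA <-]] := hE i si.
  exists ((fun t : R[i] => ln (normc t)) @^-1` A) => //.
  by rewrite -[X in measurable X]setTI; exact: mln.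
have [C C0 hC] := hU _ _ P Y hY iY _ eps0.
exists C => // k k0; apply: le_trans (product_law_log_mean L0 haT k _ _) _.
apply: le_trans (hC k k0) _.
by rewrite powR_mulrn.
Qed.

End ClassU.

Theorem proposition3p15 (R : realType) (theta : R) (theta_gt0 : 0 < theta)
    (L : probability R[i] R) (L0 : L [set 0] = 0%E)
    (d : nat -> measure_display) (Omega : forall N, measurableType (d N))
    (P : forall N, probability (Omega N) R)
    (M : forall N, {RV (P N) >-> 'M[R[i]]_N})
    (hM : forall N, (0 < N)%N -> follows_ensemble theta L (P N) (M N))
    (d' : measure_display) (Omega' : measurableType d')
    (P' : probability Omega' R)
    (a : nat -> {RV P' >-> nat}) (T : nat -> nat -> {RV P' >-> R[i]})
    (haT : limit_variables theta L a T)
    (dZ : measure_display) (OmegaZ : measurableType dZ)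
    (PZ : probability OmegaZ R) (Z : {RV PZ >-> R[i]})
    (hZ : has_law PZ Z L)
    (logZ_int : PZ.-integrable setT (EFin \o (fun w => ln (normc (Z w))))) :
  let mu_ N := mean_measure (P N) (fun w => spectral_measure (M N w)) in
  let mu_oo := mean_measure P' (limit_measure (fun k => a k) (fun k p => T k p)) in
  let r := expR (fine 'E_PZ[fun w => ln (normc (Z w))]) in
  [/\ forall N, (0 < N)%N -> is_probability (fun A => (N%:R^-1)%:E * mu_ N A)%E,
      weakly_converges (fun n => fun A => ((n.+1%:R)^-1)%:E * mu_ n.+1 A)%E
        (uniform_circle r) &
      class_U 2 PZ (fun w => ln (normc (Z w))) ->
      forall r1 r2 : R, 0 < r1 -> r1 < r -> r < r2 ->
        let E := [set z : R[i] | ~ (r1 < normc z < r2)] in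
        is_finite_measure (restriction mu_oo E) /\
        weakly_converges (fun n => restriction (mu_ n.+1) E)
          (restriction mu_oo E)].
Proof.
move=> mu_ mu_oo r.
pose m := fine 'E_PZ[fun w => ln (normc (Z w))].
have lln (e eta : R) : 0 < e -> 0 < eta -> exists N : nat, forall k, (N <= k)%N ->
    (product_law L k [set t | (e <= `|ln (normc t) / k%:R - m|)%R] <= eta%:E)%E.
  rewrite /m (expectation_log_law hZ logZ_int).
  exact: (product_law_lln L0 haT (integrable_log_law hZ logZ_int)).
have mu_E N A : (0 < N)%N -> measurable A ->
    mu_ N A = (\sum_(k < N) (N%:R * cycle_prob theta N k / k.+1%:R)%:E * root_measure L k.+1 A)%E.
  by move=> N0 mA; exact: (mean_spectral_mixture theta_gt0 L0 (hM N N0) mA).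
have normE N A : (0 < N)%N -> measurable A -> ((N%:R^-1)%:E * mu_ N A)%E =
    mixture (fun k => root_measure L k.+1) (normalized_coef theta_gt0 N) N A.
  move=> N0 mA; rewrite mu_E // ge0_sume_distrr; last first.
    by move=> k _; rewrite mule_ge0 // lee_fin; exact: (cycle_coef_ge0 theta_gt0).
  apply: eq_bigr => k _; rewrite muleA -EFinM; congr (_%:E * _)%E.
  by rewrite -mulrA mulKf // pnatr_eq0 -lt0n.
have normT N : (0 < N)%N ->
    mixture (fun k => root_measure L k.+1) (normalized_coef theta_gt0 N) N setT = 1%E.
  case: N => // n _; rewrite -[LHS]/(\sum_(k < n.+1) ((normalized_coef theta_gt0 n.+1 k)%:num)%:E
     * root_measure L k.+1 setT)%E.
  under eq_bigr do rewrite root_measureT -EFinM.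
  rewrite sumEFin; congr (_%:E); rewrite -[RHS](sum_cycle_prob theta_gt0 n).
  apply: eq_bigr => k _; rewrite (_ : (normalized_coef theta_gt0 n.+1 k)%:num =
    cycle_prob theta n.+1 k / k.+1%:R) //.
  by rewrite divfK // pnatr_eq0.
split.
- by move=> N N0; exact: (is_probabilityP (normT N N0) (fun A => @normE N A N0)).
- apply: (@weakly_convergesP _ _ _
    (fun n => mixture (fun k => root_measure L k.+1) (normalized_coef theta_gt0 n.+1) n.+1)
    (uniform_circle_law r)).
  + by move=> n A; exact: normE.
  + by [].
  + by move=> n; rewrite normT // ltry.
  + by rewrite ltey_eq fin_num_measure.
  + by move=> f K cf f0 fK; exact: (normalized_mixture_cvg theta_gt0 lln cf f0 fK).
move=> hU r1 r2 r10 r1r rr2 E.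
have [C C0 hC] := class_U_product_law L0 haT hZ hU (log_window_gt0 r10 r1r rr2).
have mE : measurable E := measurable_restriction_set r1 r2.
pose nuE := restricted_root_measure L r1 r2.
pose muN n := mixture nuE (cycle_coef theta_gt0 n.+1) n.+1.
pose muoo := infinite_mixture nuE (limit_coef theta_gt0).
have muNE n A : measurable A -> restriction (mu_ n.+1) E A = muN n A.
  by move=> mA; rewrite /restriction mu_E //; exact: measurableI.
have muooE A : measurable A -> restriction mu_oo E A = muoo A.
  move=> mA; rewrite /restriction /mu_oo (mean_limit_measure theta_gt0 L0 haT) //.
  exact: measurableI.
have c1 : continuous (cst 1 : R[i] -> R).
  by move=> z A /nbhs_singleton A1; apply/nbhs_normcP; exists 1 => // w _; exact: A1.
have int1 (p : {measure set R[i] -> \bar R}) : (\int[p]_z (cst 1%R z)%:E)%E = p setT.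
  by rewrite -[LHS]/(\int[p]_z (cst 1%:E z))%E integral_cst // mul1e.
have muoo_fin : (muoo setT < +oo)%E.
  have [+ _] := restricted_mixture_cvg theta_gt0 r10 rr2 C0 hC c1 (fun=> ler01) (fun=> lexx 1).
  by rewrite int1 ge0_fin_numE.
have muN_fin n : (muN n setT < +oo)%E.
  apply: lte_sum_pinfty => k _; apply: lte_mul_pinfty => //.
  apply: (@le_lt_trans _ _ (C / k.+1%:R)%:E); last exact: ltry.
  rewrite -[X in (X <= _)%E]/(root_measure L k.+1 (setT `&` E)) setTI.
  exact: (root_measure_restriction_le r10 rr2 hC).
split; first exact: is_finite_measureP muooE muoo_fin.
apply: (weakly_convergesP muNE muooE muN_fin muoo_fin) => f K cf f0 fK.
by have [_] := restricted_mixture_cvg theta_gt0 r10 rr2 C0 hC cf f0 fK.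
Qed.
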